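(* Let $r\ge 1$ and let $P_i, W_i$, $1\le i\le r$, be non-constant polynomials with complex coefficients such that $$P_1\circ W_1=P_2\circ W_2=\dots=P_r\circ W_r$$ and $$\gcd(\deg P_1,\deg P_2,\dots,\deg P_r)=1,\qquad \gcd(\deg W_1,\deg W_2,\dots,\deg W_r)=1.$$ Then at least one of the $P_i$, $1\le i\le r$, is linearly equivalent either to a Chebyshev polynomial or to a power, and at least one of the $W_i$, $1\le i\le r$, is linearly equivalent either to a Chebyshev polynomial or to a power.
   Context: All polynomials are in $\mathbb C[z]$, and $\circ$ denotes composition, $(f_1\circ f_2)(z)=f_1(f_2(z))$. Two polynomials $U,V$ are called linearly equivalent if $U=\mu\circ V\circ\nu$ for some polynomials $\mu,\nu$ of degree one. The Chebyshev polynomials $T_n$, $n\ge 1$, are defined by $T_n(\cos\varphi)=\cos n\varphi$. A power is a polynomial $z^n$ with $n\ge 1$ (in particular, polynomials of degree one are linearly equivalent to the power $z^1=T_1$). *)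

(* Defs.v *)
From mathcomp Require Import all_boot all_order all_algebra.
From mathcomp Require Import complex.
From mathcomp Require Import reals topology normedtype trigo.

Set Implicit Arguments.
Unset Strict Implicit.
Unset Printing Implicit Defensive.

Import Order.TTheory GRing.Theory Num.Theory.

Local Open Scope ring_scope.
Local Open Scope complex_scope.

(* The field of complex numbers is R[i] for R : realType. *)

(* The zero polynomial gets degree 0. *)
Definition pdeg (A : nzRingType) (p : {poly A}) : nat := (size p).-1.

(* size = 2 means degree exactly one. *)
Definition linearly_equivalent (A : nzRingType) (U V : {poly A}) : Prop :=
  exists mu nu : {poly A},
    [/\ size mu = 2%N, size nu = 2%N & U = mu \Po (V \Po nu)].

Definition is_power (A : nzRingType) (V : {poly A}) : Prop :=
  exists2 n : nat, (1 <= n)%N & V = 'X^n.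

(* T is the n-th Chebyshev polynomial T_n; it exists and is unique by
   chebyshev_exists and chebyshev_unique below. *)
Definition chebyshev_of (R : realType) (n : nat) (T : {poly R[i]}) : Prop :=
  forall phi : R, T.[(cos phi)%:C] = (cos (phi *+ n))%:C.

Definition is_chebyshev (R : realType) (T : {poly R[i]}) : Prop :=
  exists2 n : nat, (1 <= n)%N & chebyshev_of n T.

Lemma chebyshev_exists (R : realType) (n : nat) :
  exists T : {poly R[i]}, chebyshev_of n T.
Proof.
suff [T [U [hT _]]] : exists T U : {poly R[i]},
    chebyshev_of n T /\ chebyshev_of n.+1 U by exists T.
elim: n => [|n [T [U [hT hU]]]].
  by exists 1, 'X; split=> phi; rewrite ?hornerX // hornerC mulr0n cos0.
exists U, ('X * U *+ 2 - T); split=> // phi.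
rewrite hornerD hornerN hornerMn hornerM hornerX hT hU.
rewrite -rmorphM -rmorphMn -rmorphB; congr _%:C.
have -> : phi *+ n.+2 = phi *+ n.+1 + phi by rewrite mulrSr.
have -> : phi *+ n = phi *+ n.+1 - phi by rewrite mulrSr addrK.
rewrite (cosD _ phi) (cosB _ phi) mulr2n [cos phi * _]mulrC.
by rewrite opprD addrA addrK.
Qed.

Lemma chebyshev_unique (R : realType) (n : nat) (T U : {poly R[i]}) :
  chebyshev_of n T -> chebyshev_of n U -> T = U.
Proof.
move=> hT hU; apply/eqP; rewrite -subr_eq0; apply/negP => /negP TU0.
pose f (k : nat) : R[i] := ((k.+1%:R : R)^-1)%:C.
have f_inj : injective f.
  by move=> j k [] /invr_inj /eqP; rewrite eqr_nat => /eqP [].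
have := @max_poly_roots _ (T - U) [seq f k | k <- iota 0 (size (T - U)%R)] TU0.
rewrite map_inj_uniq // iota_uniq size_map size_iota ltnn => h.
suff /h/(_ isT) : all (root (T - U))
  [seq f k | k <- iota 0 (size (T - U)%R)] by [].
apply/allP => _ /mapP[k _ ->].
have fk : (k.+1%:R : R)^-1 \in `[-1, 1].
  rewrite in_itv /= (le_trans (lerN10 R)) ?invr_ge0 //=.
  by rewrite invf_le1 ?ler1n ?ltr0n.
by rewrite /root hornerD hornerN /f -(acosK fk) hT hU subrr.
Qed.

(* Main.v *)
(** Fix [V = P_i \Po W_i].  The degrees of the left (resp. right) components of
    [V] are closed under gcd, and a component is determined by its degree up to
    a linear polynomial; left gcds come from approximate roots, right gcds from
    a degree count in the algebra [F[A, B]] (whose nonzero elements have degrees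
    divisible by [gcdn (pdeg A) (pdeg B)]).

    For two components of coprime degrees [m], [n] one has Ritt's second theorem.
    If [f \Po A = g \Po B] with [pdeg f = m] and [pdeg g = n], then over a point
    [(x, y)] with [f.[x] = g.[y]] lie at most [gcd(e_x, e_y)] points [t], where
    [e_x], [e_y] are the multiplicities of [f] at [x] and of [g] at [y].
    Counting the zeros of the derivative of [f \Po A] bounds the total
    ramification, and this forces [f] or [g] to be totally ramified over some
    point, or all of [f], [g], [A], [B] to have the ramification of Chebyshev
    polynomials; the latter satisfy a Pell equation, hence a linear differential
    equation which determines them.

    For more than two components argue by induction on their number, replacing
    two of them, of degrees [a] and [b], by their gcd.  If that gcd is special
    while neither of the two is, there is a component of degree [e > 2] dividing
    [b] and prime to [a] (or vice versa), which is a power [z^e].  For left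
    components the multiplicities over the corresponding critical value are then
    divisible by [e], up to one exception; for right components there is a
    rotation symmetry of order [e].  A special polynomial with such a property is
    a power with the same center, and this passes from the gcd to one of the two
    components. *)
Require Import Defs.
From mathcomp Require Import all_boot all_order all_algebra.
From mathcomp Require Import complex.
From mathcomp Require Import reals trigo.
From mathcomp Require Import zify ring cyclic.

Set Implicit Arguments.
Unset Strict Implicit.
Unset Printing Implicit Defensive.

(** * Ramification profiles of coprime degrees *)

(** The condition [e > 2] is dictated by Chebyshev polynomials: they have double points in their
    fibers and the symmetry [z -> -z] up to linear changes, but neither higher multiplicities nor
    symmetries of higher order, so [e = 2] could not separate them from powers. The induction has to
    pass information from two components to their gcd and back. The explicit shapes in Ritt's second
    theorem do not survive this; divisibility of multiplicities (on the left) and equivariance under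
    a rotation (on the right) do, since both behave well under composition. Ramification is counted
    by roots of derivatives, and the points over [(x, y)] by a polynomial identity, in place of
    Riemann surfaces. *)

Lemma sum_sub_size (s : seq nat) : all (leq 1) s -> \sum_(f <- s) (f - 1) + size s = sumn s.
Proof.
elim: s => [|x s IHs] /=; first by rewrite big_nil.
by move=> /andP[x1 /IHs <-]; rewrite big_cons; lia.
Qed.

Lemma size_le_sumn (s : seq nat) : all (leq 1) s -> size s <= sumn s.
Proof. by move=> /sum_sub_size <-; rewrite leq_addl. Qed.

Lemma double_size_le (s : seq nat) :
  all (leq 1) s -> 2 * size s <= sumn s + count_mem 1 s.
Proof. by elim: s => //= x s IHs /andP[x1 /IHs]; case: eqP => xN /=; lia. Qed.

Lemma all_le2 (s : seq nat) :
  all (leq 1) s -> sumn s + count_mem 1 s = 2 * size s -> all (geq 2) s.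
Proof.
elim: s => //= x s IHs /andP[x1 s1].
have := double_size_le s1; case: eqP => [->|xN] /=; move=> h e.
  by apply: IHs => //; lia.
by apply/andP; split; [lia|apply: IHs => //; lia].
Qed.

Lemma all_leq2 s : all (leq 1) s -> count_mem 1 s = 0 -> all (leq 2) s.
Proof.
elim: s => //= x s IHs /andP[x1 s1]; case: eqP => //= xN c0.
by rewrite IHs // andbT; lia.
Qed.

Lemma count1_le2 (s : seq nat) :
  all (leq 1) s -> all (geq 2) s -> sumn s + count_mem 1 s = 2 * size s.
Proof.
elim: s => //= x s IHs /andP[x1 s1] /andP[x2 s2].
by have := IHs s1 s2; case: eqP => /=; lia.
Qed.

(** Let [s] and [t] list the multiplicities of the left components [f] and [g] over one value. Over
    a point of multiplicity [e] of [f] the polynomial [A] has at most the sum of the [gcdn e f], [f]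
    in [t], as its number of preimages, so [excess] bounds the ramification of [A] from below. *)
Definition excess (s t : seq nat) := \sum_(e <- s) \sum_(f <- t) (f - gcdn e f).
Definition gcds (s t : seq nat) := \sum_(e <- s) \sum_(f <- t) gcdn e f.

Lemma gcdsC s t : gcds s t = gcds t s.
Proof.
by rewrite /gcds exchange_big; apply: eq_bigr => e _; apply: eq_bigr => f _; rewrite gcdnC.
Qed.

Lemma excess_gcds (s t : seq nat) : all (leq 1) t -> excess s t + gcds s t = size s * sumn t.
Proof.
move=> t1; rewrite /excess /gcds -big_split /= -sum1_size big_distrl /=.
apply: eq_bigr => e _; rewrite mul1n sumnE -big_split /=.
rewrite big_seq [RHS]big_seq; apply: eq_bigr => f ft.
have f1 : 0 < f by apply: (allP t1).
by rewrite subnK // dvdn_leq // dvdn_gcdr.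
Qed.

(** An entry 1 is coprime to everything, so it contributes the whole ramification of [t]. *)
Lemma count1_excess (s t : seq nat) :
  count_mem 1 s * \sum_(f <- t) (f - 1) <= excess s t.
Proof.
elim: s => [|e s IHs]; rewrite /excess ?big_nil // big_cons /= mulnDl.
apply: leq_add => //; case: eqP => [->|] //.
by rewrite mul1n; apply: leq_sum => f _; rewrite gcd1n.
Qed.

(** The entry 1 alone uses up the bound, so the entry 2 contributes nothing: each [f] is at most
    [gcdn 2 f]. *)
Lemma excess_le2 (s t : seq nat) : all (leq 1) t ->
  1 \in s -> 2 \in s -> excess s t <= \sum_(f <- t) (f - 1) -> all (geq 2) t.
Proof.
move=> t1 s1 s2; rewrite /excess (big_rem 1) //= (@big_rem _ _ _ _ (rem 1 s) 2) /=; last by rewrite rem_mem.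
have -> : \sum_(f <- t) (f - gcdn 1 f) = \sum_(f <- t) (f - 1).
  by apply: eq_bigr => f _; rewrite gcd1n.
rewrite -[X in _ <= X]addn0 leq_add2l leqn0 addn_eq0 => /andP[z _].
apply/allP => f ft; move: z; rewrite (big_rem f) //= addn_eq0 => /andP[+ _].
rewrite subn_eq0 => /leq_trans; apply.
by rewrite dvdn_leq // dvdn_gcdl.
Qed.

(** With [e = a * g] and [f = b * g] the defect is [(a + b - 2) * g], and [a != b] makes it at least
    [g]; the case [g = 1] follows from the sizes of [e] and [f]. *)
Lemma pair_defect e f : 2 <= e -> 2 <= f -> e != f -> 2 <= e + f - 2 * gcdn e f.
Proof.
move=> e2 f2; have g0 : 0 < gcdn e f by rewrite gcdn_gt0; lia.
have /dvdnP[a] := dvdn_gcdl e f; have /dvdnP[b] := dvdn_gcdr e f.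
move: (gcdn e f) g0 => g g0 fE eE; rewrite fE eE eqn_pmul2r // => ab.
have a0 : 0 < a by case: a eE ab => //; lia.
have b0 : 0 < b by case: b fE ab => //; lia.
have [g1|g1] := eqVneq g 1; first by move: eE fE; rewrite g1 => eE fE; lia.
have : 3 * g <= (a + b) * g by rewrite leq_mul2r; lia.
by rewrite mulnDl; lia.
Qed.

(* At least two of the four edges of a 4-cycle with unequal ends are unequal. *)
Lemma double_defect e f (s t : seq nat) :
  all (leq 2) s -> all (leq 2) t -> e \in s -> f \in t -> e != f ->
  1 < size s -> 1 < size t ->
  4 <= \sum_(e <- s) \sum_(f <- t) (e + f - 2 * gcdn e f).
Proof.
move=> s2 t2 es ft ef ss st.
have [e' [r es']] : exists e' r, perm_eq s [:: e, e' & r].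
  have := perm_to_rem es; have := perm_size (perm_to_rem es).
  case: (rem e s) => [|e' r] /= h p; first by rewrite h in ss.
  by exists e', r.
have [f' [r' ft']] : exists f' r, perm_eq t [:: f, f' & r].
  have := perm_to_rem ft; have := perm_size (perm_to_rem ft).
  case: (rem f t) => [|f' r'] /= h p; first by rewrite h in st.
  by exists f', r'.
have e2 : 2 <= e by apply: (allP s2).
have f2 : 2 <= f by apply: (allP t2).
have e'2 : 2 <= e' by apply: (allP s2); rewrite (perm_mem es') !inE eqxx orbT.
have f'2 : 2 <= f' by apply: (allP t2); rewrite (perm_mem ft') !inE eqxx orbT.
pose h e f := e + f - 2 * gcdn e f.
rewrite (perm_big _ es') /= !big_cons; apply: (@leq_trans (h e f + h e f' + (h e' f + h e' f'))).
  have pd i j : 2 <= i -> 2 <= j -> i != j -> 2 <= h i j by apply: pair_defect.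
  have := pd _ _ e2 f2 ef; move: (pd e f' e2 f'2) (pd e' f e'2 f2) (pd e' f' e'2 f'2).
  move: (h e f) (h e f') (h e' f) (h e' f') => w x y z.
  have [e1|_] := eqVneq e f'; last by move=> /(_ isT) x2 _ _ w2; lia.
  have [e3|_] := eqVneq e' f; last by move=> _ /(_ isT) y2 _ w2; lia.
  by rewrite e3 -e1 eq_sym ef => _ _ /(_ isT) z2 w2; lia.
rewrite [X in _ <= X]addnA (leq_trans _ (leq_addr _ _)) //.
by apply: leq_add; rewrite (perm_big _ ft') /= !big_cons /h; lia.
Qed.

Lemma sum_eq_of_le (T : eqType) (r : seq T) (F G : T -> nat) : uniq r ->
  (forall c, c \in r -> F c <= G c) -> \sum_(c <- r) G c <= \sum_(c <- r) F c ->
  forall c, c \in r -> G c = F c.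
Proof.
move=> ur le; rewrite leqNgt => /negP nlt c cr; apply/eqP; rewrite eqn_leq le // andbT leqNgt.
apply/negP => lt; apply: nlt; rewrite !(bigD1_seq c) //= -addSn leq_add //.
by rewrite big_seq_cond [X in _ <= X]big_seq_cond leq_sum // => d /andP[/le].
Qed.

(** The last condition is the Riemann-Hurwitz count for a polynomial of degree [m] whose critical
    values all lie in [r]. *)
Definition profile (T : eqType) (r : seq T) (m : nat) (E : T -> seq nat) :=
  [/\ forall c, c \in r -> all (leq 1) (E c), forall c, c \in r -> sumn (E c) = m
    & \sum_(c <- r) (m - size (E c)) = m.-1].

(** The ramification of two Chebyshev polynomials of coprime degrees. The asymmetry is genuine: [E]
    has odd degree, hence one simple point over each value, while both simple points of [G] may lie
    over the same value when its degree is even. *)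
Definition chebyshev_profile (T : eqType) (r : seq T) (E G : T -> seq nat) :=
  exists c1 c2, [/\ c1 \in r, c2 \in r, c1 != c2,
    [/\ all (geq 2) (E c1), all (geq 2) (E c2), all (geq 2) (G c1) & all (geq 2) (G c2)]
    & [/\ count_mem 1 (E c1) = 1, count_mem 1 (E c2) = 1
        & count_mem 1 (G c1) + count_mem 1 (G c2) = 2]].

Section Profiles.
Variables (T : eqType) (r : seq T).
Hypothesis ur : uniq r.

Section OneSided.
Variables (m n : nat) (E G : T -> seq nat).
Hypotheses (m1 : 1 < m) (n1 : 1 < n) (pE : profile r m E) (pG : profile r n G).
Hypothesis genus : \sum_(c <- r) (m * n - gcds (E c) (G c)) <= (m * n).-1.

Let E1 c : c \in r -> all (leq 1) (E c). Proof. by case: pE => + _ _; apply. Qed.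
Let G1 c : c \in r -> all (leq 1) (G c). Proof. by case: pG => + _ _; apply. Qed.
Let Em c : c \in r -> sumn (E c) = m. Proof. by case: pE => _ + _; apply. Qed.
Let Gn c : c \in r -> sumn (G c) = n. Proof. by case: pG => _ + _; apply. Qed.
Let sumE : \sum_(c <- r) (m - size (E c)) = m.-1. Proof. by case: pE. Qed.
Let sumG : \sum_(c <- r) (n - size (G c)) = n.-1. Proof. by case: pG. Qed.

Let sE c : c \in r -> size (E c) <= m.
Proof. by move=> cr; rewrite -(Em cr) size_le_sumn ?E1. Qed.
Let sG c : c \in r -> size (G c) <= n.
Proof. by move=> cr; rewrite -(Gn cr) size_le_sumn ?G1. Qed.

Let bE c : c \in r -> \sum_(f <- G c) (f - 1) = n - size (G c).
Proof. by move=> cr; rewrite -(Gn cr) -sum_sub_size ?G1 // addnK. Qed.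

(** By [excess_gcds], [m * n - gcds] is [n] times the ramification of [E] plus the excess; the first
    part sums to [n * (m - 1)] out of the allowed [m * n - 1]. *)
Lemma excess_total : \sum_(c <- r) excess (E c) (G c) <= n.-1.
Proof.
have e : \sum_(c <- r) (m * n - gcds (E c) (G c)) =
    n * m.-1 + \sum_(c <- r) excess (E c) (G c).
  rewrite -sumE big_distrr -big_split /= big_seq [RHS]big_seq; apply: eq_bigr => c cr.
  have := excess_gcds (E c) (G1 cr); rewrite Gn // => eg.
  have := sE cr; move: (excess _ _) (gcds _ _) (size _) eg => x y z; nia.
move: genus; rewrite e; move: (bigop _ _ _) => x; nia.
Qed.

Lemma excess_ge c : c \in r -> count_mem 1 (E c) * (n - size (G c)) <= excess (E c) (G c).
Proof. by move=> cr; rewrite -bE // count1_excess. Qed.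

Lemma size_count c : c \in r -> 2 * size (E c) <= m + count_mem 1 (E c).
Proof. by move=> cr; rewrite -(Em cr) double_size_le ?E1. Qed.

Lemma sum_split2 (a : T -> nat) c1 c2 : c1 \in r -> c2 \in r -> c1 != c2 ->
  \sum_(c <- r) a c = a c1 + a c2 + \sum_(c <- r | (c != c1) && (c != c2)) a c.
Proof.
move=> r1 r2 c12; rewrite (bigD1_seq c1) //= -addnA; congr (_ + _).
rewrite (bigID (pred1 c2)) /=; congr (_ + _).
rewrite -big_filter (_ : [seq c <- r | (c != c1) && (c == c2)] = [:: c2]) ?big_seq1 //.
rewrite (@eq_filter _ _ (pred1 c2)); first by rewrite filter_pred1_uniq.
by move=> c /=; case: (eqVneq c c1) => [->|] //=; rewrite (negbTE c12).
Qed.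

(* The total excess is at most the total ramification of [G], so [E] has exactly
   one entry [1] over each [c] where [G] is ramified. *)
Lemma unramified_case :
  (forall c, c \in r -> 0 < n - size (G c) -> 0 < count_mem 1 (E c)) ->
  (exists2 c, c \in r & size (G c) = 1) \/ chebyshev_profile r E G.
Proof.
move=> unr.
have eqS : forall c, c \in r -> excess (E c) (G c) = n - size (G c).
  apply: (@sum_eq_of_le _ _ (fun c => n - size (G c)) (fun c => excess (E c) (G c)) ur) => [c cr|]; last by rewrite sumG excess_total.
  apply: leq_trans _ (excess_ge cr); case: (posnP (n - size (G c))) => [->//|b0].
  by rewrite leq_pmull // unr.
have cnt c : c \in r -> 0 < n - size (G c) -> count_mem 1 (E c) = 1.
  move=> cr b0; apply/eqP; rewrite eqn_leq unr // andbT.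
  by have := excess_ge cr; rewrite eqS // -{2}[n - _]mul1n leq_pmul2r.
have [c1 r1 b1] : exists2 c, c \in r & 0 < n - size (G c).
  apply/hasP; apply: contraT => /hasPn b0; move: sumG.
  rewrite big_seq big1 => [|c /b0]; [by case: n n1 => [|[]]|by rewrite -eqn0Ngt => /eqP].
have [/hasP[c2 r2 /andP[c21 b2]]|/hasPn none] :=
    boolP (has (fun c => (c != c1) && (0 < n - size (G c))) r); last first.
  left; exists c1 => //.
  have := sumG; rewrite (bigD1_seq c1) //= big_seq_cond big1 => [|c /andP[cr cc1]].
    by have := sG r1; move: (size _) n1; lia.
  by have := none c cr; rewrite cc1 -eqn0Ngt => /eqP.
right; have c12 : c1 != c2 by rewrite eq_sym.
(* A single entry 1 leaves at most [(m + 1) / 2] entries, so [E] ramifies by at least [(m - 1) / 2]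
   over each of [c1] and [c2]. This exhausts [m - 1]: both bounds are equalities and [E] is
   unramified elsewhere. *)
have h1 := size_count r1; have h2 := size_count r2.
rewrite !cnt // in h1 h2.
have := sumE; rewrite (sum_split2 _ r1 r2 c12).
set rest := bigop _ _ _ => sE2; have [s1 s2] := (sE r1, sE r2).
have rest0 : rest = 0 by move: s1 s2 h1 h2 sE2; lia.
have p1 : 2 * size (E c1) = m + 1 by move: s1 s2 h1 h2 sE2; lia.
have p2 : 2 * size (E c2) = m + 1 by move: s1 s2 h1 h2 sE2; lia.
(* If [G] ramified over a third [c], then [E] would have a single entry 1 there and so would ramify
   too. *)
have := sumG; rewrite (sum_split2 _ r1 r2 c12) big_seq_cond big1 => [|c /and3P[cr cc1 cc2]]; last first.
  apply/eqP; rewrite eqn0Ngt; apply/negP => bc; have := size_count cr; rewrite cnt //.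
  move: rest0; rewrite /rest; move/eqP; rewrite sum_nat_seq_eq0 => /allP/(_ c cr).
  by rewrite cc1 cc2 /= => /eqP z h; have := sE cr; lia.
rewrite addn0 => b12.
have le2E c : c \in r -> 0 < n - size (G c) -> 2 * size (E c) = m + 1 -> all (geq 2) (E c).
  by move=> cr bc pc; apply: all_le2; rewrite ?E1 // Em // cnt.
have in2 c : c \in r -> 0 < n - size (G c) -> 2 * size (E c) = m + 1 -> 1 \in E c /\ 2 \in E c.
  move=> cr bc pc; split; first by rewrite -has_pred1 has_count cnt.
  apply: contraT => no2; have := le2E c cr bc pc => le2.
  have : count_mem 1 (E c) = size (E c).
    apply/eqP; rewrite -all_count; apply/allP => e ec /=.
    have := allP le2 e ec; have := allP (E1 cr) e ec.
    by case: e ec => [|[|[|e]]] // ec; rewrite ec in no2.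
  by rewrite cnt // => s; move: pc; rewrite -s; lia.
have le2G c : c \in r -> 0 < n - size (G c) -> 2 * size (E c) = m + 1 -> all (geq 2) (G c).
  move=> cr bc pc; have [i1 i2] := in2 c cr bc pc.
  by apply: (excess_le2 (s := E c)); rewrite ?G1 // eqS // bE.
exists c1, c2; split=> //; first by rewrite !le2E ?le2G.
split; rewrite ?cnt //.
have := count1_le2 (G1 r1) (le2G c1 r1 b1 p1); have := count1_le2 (G1 r2) (le2G c2 r2 b2 p2).
rewrite !Gn //; move: (sG r1) (sG r2) b12; lia.
Qed.

End OneSided.

(** Having no entry 1 over [c0] costs [E] at least [m / 2] of its ramification [m - 1], so this
    happens at one point only. If [c1] were different, each entry 1 of [E] over [c1] would add at
    least [n / 2] to the excess, which leaves room for one such entry; then [E] ramifies by at least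
    [(m - 1) / 2] over [c1], too much together with [c0]. *)
Lemma mixed_case m n (E G : T -> seq nat) c0 c1 : 1 < m -> 1 < n ->
  profile r m E -> profile r n G ->
  \sum_(c <- r) (m * n - gcds (E c) (G c)) <= (m * n).-1 ->
  c0 \in r -> c1 \in r -> count_mem 1 (E c0) = 0 -> count_mem 1 (G c1) = 0 -> c0 = c1.
Proof.
move=> m1 n1 pE pG genus r0 r1 u0 v1; apply/eqP; apply: contraT => c01.
have ex := excess_total m1 n1 pE pG genus.
have [E1 Em sumE] := pE; have [G1 Gn sumG] := pG.
have sE c : c \in r -> size (E c) <= m by move=> cr; rewrite -(Em c cr) size_le_sumn ?E1.
have sG c : c \in r -> size (G c) <= n by move=> cr; rewrite -(Gn c cr) size_le_sumn ?G1.
have hE0 := size_count pE r0; have hG1 := size_count pG r1; rewrite u0 in hE0; rewrite v1 in hG1.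
have hE1 := size_count pE r1.
have unr c : c \in r -> c != c0 -> 0 < count_mem 1 (E c).
  move=> cr cc0; rewrite lt0n; apply/eqP => uc; have := size_count pE cr; rewrite uc.
  have := sumE; rewrite (sum_split2 _ cr r0 cc0).
  have := sE c0 r0; have := sE c cr; lia.
have ge c : c \in r -> c != c0 -> n - size (G c) <= excess (E c) (G c).
  move=> cr cc0; apply: leq_trans _ (excess_ge E pG cr).
  by rewrite leq_pmull // unr.
move: ex; rewrite -sumG !(sum_split2 _ r0 r1 c01).
have : \sum_(c <- r | (c != c0) && (c != c1)) (n - size (G c)) <=
    \sum_(c <- r | (c != c0) && (c != c1)) excess (E c) (G c).
  by rewrite big_seq_cond [X in _ <= X]big_seq_cond leq_sum // => c /and3P[cr cc0 _]; apply: ge.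
have := excess_ge E pG r1; have := sumG; have := sumE; rewrite !(sum_split2 _ r0 r1 c01).
set s1 := bigop _ _ _; set s2 := bigop _ _ _; set s3 := bigop _ _ _.
have := sE _ r0; have := sE _ r1; have := sG _ r0; have := sG _ r1.
have := unr c1 r1; rewrite eq_sym c01 => /(_ isT).
move: hE0 hG1 hE1 (s1) (s2) (s3).
move: (excess _ _) (excess _ _) (count_mem 1 (E c1)).
move: (size (E c0)) (size (E c1)) (size (G c0)) (size (G c1)).
move=> p0 p1 q0 q1 x0 x1 u h1 h2 h3 {}s1 {}s2 {}s3 u1 lq1 lq0 lp1 lp0 e1 e2 exu s23 tot.
have x1n : x1 <= n.-1 by lia.
have : u < 2.
  rewrite ltnNge; apply/negP => u2.
  have : 2 * (n - q1) <= u * (n - q1) by rewrite leq_mul2r u2 orbT.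
  by lia.
by move=> u2; lia.
Qed.

(* Writing [e = x + 2], [f = y + 2] for the entries over [c0], the bound becomes
   [\sum (e + f - 2 * gcdn e f) + (q - 2) * \sum x + (p - 2) * \sum y <= 2]
   with [p], [q] the numbers of entries. *)
Lemma common_case m n (E G : T -> seq nat) c0 : 1 < m -> 1 < n -> coprime m n ->
  profile r m E -> profile r n G ->
  \sum_(c <- r) (m * n - gcds (E c) (G c)) <= (m * n).-1 ->
  c0 \in r -> count_mem 1 (E c0) = 0 -> count_mem 1 (G c0) = 0 ->
  size (E c0) = 1 \/ size (G c0) = 1.
Proof.
move=> m1 n1 cmn pE pG genus r0 u0 v0.
have ex := excess_total m1 n1 pE pG genus.
have [E1 Em sumE] := pE; have [G1 Gn sumG] := pG.
have sE c : c \in r -> size (E c) <= m by move=> cr; rewrite -(Em c cr) size_le_sumn ?E1.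
have sG c : c \in r -> size (G c) <= n by move=> cr; rewrite -(Gn c cr) size_le_sumn ?G1.
have E2 := all_leq2 (E1 _ r0) u0; have G2 := all_leq2 (G1 _ r0) v0.
have hE0 := size_count pE r0; have hG0 := size_count pG r0.
rewrite u0 addn0 in hE0; rewrite v0 addn0 in hG0.
set p := size (E c0) in hE0 *; set q := size (G c0) in hG0 *.
have p0 : 0 < p.
  by rewrite /p lt0n size_eq0; apply/eqP => e; have := Em _ r0; rewrite e /=; move: m1; lia.
have q0 : 0 < q.
  by rewrite /q lt0n size_eq0; apply/eqP => e; have := Gn _ r0; rewrite e /=; move: n1; lia.
have [|p1] := eqVneq p 1; [by left|have [|q1] := eqVneq q 1; [by right|exfalso]].
have p2 : 1 < p by lia.
have q2 : 1 < q by lia.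
have sumE' : \sum_(c <- r | c != c0) (m - size (E c)) = p.-1.
  have := sumE; rewrite (bigD1_seq c0) //= -/p; have := sE _ r0; rewrite -/p.
  by move: (bigop _ _ _) => x; lia.
have sumG' : \sum_(c <- r | c != c0) (n - size (G c)) = q.-1.
  have := sumG; rewrite (bigD1_seq c0) //= -/q; have := sG _ r0; rewrite -/q.
  by move: (bigop _ _ _) => x; lia.
(* Over any other point [E] ramifies by at most [p - 1], so it has at least [m - 2 * (p - 1)]
   entries 1 there. *)
have others : (m - 2 * p + 2) * q.-1 <= \sum_(c <- r | c != c0) excess (E c) (G c).
  rewrite -sumG' big_distrr /= big_seq_cond [X in _ <= X]big_seq_cond leq_sum // => c /andP[cr cc0].
  apply: leq_trans _ (excess_ge E pG cr); rewrite leq_mul2r; apply/orP; right.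
  have : m - size (E c) <= p.-1.
    by rewrite -sumE' -big_filter (big_rem c) ?mem_filter ?cc0 //= leq_addr.
  have := size_count pE cr; have := sE _ cr.
  move: (count_mem _ _) (size _) => x y; lia.
have main : excess (E c0) (G c0) + (m - 2 * p + 2) * q.-1 <= n.-1.
  by apply: leq_trans ex; rewrite (bigD1_seq c0) //= leq_add2l.
have := excess_gcds (E c0) (G1 _ r0); rewrite Gn // -/p => eg.
set D := \sum_(e <- E c0) \sum_(f <- G c0) (e + f - 2 * gcdn e f).
have eg' : D + 2 * gcds (E c0) (G c0) = q * m + p * n.
  rewrite /D /gcds big_distrr -big_split /=.
  have -> : q * m + p * n = \sum_(e <- E c0) (e * q + n).
    rewrite big_split /= -big_distrl /= -sumnE Em // big_const_seq count_predT iter_addn_0.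
    by rewrite -/p mulnC [n * p]mulnC.
  rewrite big_seq [RHS]big_seq; apply: eq_bigr => e ee.
  rewrite big_distrr -big_split /= -(Gn _ r0) sumnE /q -sum1_size big_distrr -big_split /=.
  rewrite big_seq [RHS]big_seq; apply: eq_bigr => f ff; rewrite muln1.
  have e2 := allP E2 e ee; have f2 := allP G2 f ff.
  have le1 : gcdn e f <= e by rewrite dvdn_leq ?dvdn_gcdl //; apply: leq_trans e2.
  have le2 : gcdn e f <= f by rewrite dvdn_leq ?dvdn_gcdr //; apply: leq_trans f2.
  by lia.
have D2 : D <= 2.
  move: eg eg' main hE0 hG0 p2 q2; move: (gcds _ _) (excess _ _) D => x y D.
  clear; case: p => [|[|p]] //; case: q => [|[|q]] //= eg eg' main hE0 hG0 _ _.
  have [m' mE] : exists m', m = m' + 2 * p.+2 by exists (m - 2 * p.+2); lia.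
  have [n' nE] : exists n', n = n' + 2 * q.+2 by exists (n - 2 * q.+2); lia.
  move: main; have -> : m - 2 * p.+2 = m' by lia.
  subst m n => main; nia.
(* One unequal pair would already give [D >= 4]. So all entries equal one [d >= 2], which divides
   the coprime numbers [m] and [n]. *)
have eqEG e f : e \in E c0 -> f \in G c0 -> e = f.
  move=> ee ff; apply/eqP; apply: contraT => ef.
  by have := double_defect E2 G2 ee ff ef p2 q2; rewrite -/D; lia.
have [d dE] : exists d, d \in E c0.
  by move: p0; rewrite /p; case: (E c0) => // d s _; exists d; rewrite inE eqxx.
have dvdE s : {in s, forall e, e = d} -> d %| sumn s.
  elim: s => [|e s IHs] h; first by rewrite dvdn0.
  rewrite /= dvdn_add ?IHs //; first by rewrite (h e) ?inE ?eqxx.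
  by move=> f fs; apply: h; rewrite inE fs orbT.
have [f fG] : exists f, f \in G c0.
  by move: q0; rewrite /q; case: (G c0) => // f s _; exists f; rewrite inE eqxx.
have dm : d %| m.
  by rewrite -(Em _ r0) dvdE // => e ee; rewrite (eqEG e f) // (eqEG d f).
have dn : d %| n by rewrite -(Gn _ r0) dvdE // => e ee; rewrite (eqEG d e).
have : d %| gcdn m n by rewrite dvdn_gcd dm.
by rewrite (eqP cmn) dvdn1 => /eqP d1; have := allP E2 d dE; rewrite d1.
Qed.

(** If [E] has an entry 1 wherever [G] ramifies, or conversely, [unramified_case] decides. Otherwise
    some [c0] lacks entries 1 in [E] and some [c1] lacks them in [G]; these points coincide, and one
    of the profiles is a single entry there. *)
Lemma ritt_profiles m n (E G : T -> seq nat) : 1 < m -> 1 < n -> coprime m n ->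
  profile r m E -> profile r n G ->
  \sum_(c <- r) (m * n - gcds (E c) (G c)) <= (m * n).-1 ->
  [\/ exists2 c, c \in r & size (E c) = 1, exists2 c, c \in r & size (G c) = 1,
      chebyshev_profile r E G | chebyshev_profile r G E].
Proof.
move=> m1 n1 cmn pE pG genus.
have [|/hasPn unrE] := boolP (has (fun c => (0 < n - size (G c)) && (count_mem 1 (E c) == 0)) r); last first.
  have [|s1|ch] := unramified_case m1 n1 pE pG genus.
  - move=> c cr b0; have := unrE c cr; rewrite b0 /= => ne.
    by rewrite lt0n.
  - exact: Or42.
  - exact: Or43.
move=> /hasP[c0 r0 /andP[b0 /eqP u0]].
have [|/hasPn unrG] := boolP (has (fun c => (0 < m - size (E c)) && (count_mem 1 (G c) == 0)) r); last first.
  have genus' : \sum_(c <- r) (n * m - gcds (G c) (E c)) <= (n * m).-1.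
    rewrite mulnC (eq_bigr (fun c => m * n - gcds (E c) (G c))) // => c _.
    by rewrite gcdsC.
  have [|s1|ch] := unramified_case n1 m1 pG pE genus'.
  - move=> c cr a0; have := unrG c cr; rewrite a0 /= => ne.
    by rewrite lt0n.
  - exact: Or41.
  - exact: Or44.
move=> /hasP[c1 r1 /andP[a1 /eqP v1]].
have c01 := mixed_case m1 n1 pE pG genus r0 r1 u0 v1; rewrite -c01 in v1.
have [s1|s1] := common_case m1 n1 cmn pE pG genus r0 u0 v1.
  by apply: Or41; exists c0.
by apply: Or42; exists c0.
Qed.

End Profiles.

Import Order.TTheory GRing.Theory Num.Theory.
Local Open Scope ring_scope.

(** * The lattice of decompositions *)

Lemma size_pdeg (A : nzRingType) (p : {poly A}) : (0 < pdeg p)%N -> size p = (pdeg p).+1.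
Proof. by rewrite /pdeg; case: (size p). Qed.

Lemma pdeg_comp (A : idomainType) (p q : {poly A}) :
  pdeg (p \Po q) = (pdeg p * pdeg q)%N.
Proof. exact: size_comp_poly. Qed.

Lemma size_neq0 (A : nzRingType) (p : {poly A}) : p != 0 -> size p = (pdeg p).+1.
Proof. by move=> p0; rewrite /pdeg prednK // size_poly_gt0. Qed.

Lemma pdegM (A : idomainType) (p q : {poly A}) :
  p != 0 -> q != 0 -> pdeg (p * q) = (pdeg p + pdeg q)%N.
Proof.
by move=> p0 q0; rewrite /pdeg size_mul // (size_neq0 p0) (size_neq0 q0) addnS.
Qed.

Lemma pdegX (A : idomainType) (p : {poly A}) n : pdeg (p ^+ n) = (pdeg p * n)%N.
Proof. exact: size_exp. Qed.

Lemma size_le_coef0 (A : nzRingType) (p : {poly A}) k :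
  (size p <= k.+1)%N -> p`_k = 0 -> (size p <= k)%N.
Proof.
move=> sp pk; apply/leq_sizeP => j; rewrite leq_eqVlt => /predU1P[<- //|].
by move/leq_sizeP: sp => /(_ j).
Qed.

Lemma comp_poly_inj (A : idomainType) (p q w : {poly A}) :
  (0 < pdeg w)%N -> p \Po w = q \Po w -> p = q.
Proof.
move=> w1 /eqP; rewrite -subr_eq0 -comp_polyB => /eqP e; apply/eqP.
rewrite -subr_eq0; set r := p - q in e *.
have r0 : pdeg r = 0%N.
  apply/eqP; move: (pdeg_comp r w); rewrite e /pdeg size_poly0 /= => /esym/eqP.
  by rewrite muln_eq0 => /orP[//|/eqP w0]; rewrite /pdeg w0 in w1.
have /size1_polyC rE : (size r <= 1)%N by move: r0; rewrite /pdeg; case: (size r) => [|[]].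
by move: e; rewrite rE comp_polyC => /eqP.
Qed.

(** * Left gcds through approximate roots *)

Section SumPow.
Variable F : idomainType.
Variables (x y : {poly F}) (d : nat) (kappa : F).
Hypotheses (sx : size x = d.+1) (sy : size y = d.+1).
Hypotheses (lx : lead_coef x = kappa) (ly : lead_coef y = kappa).

(** The cofactor of [x - y] in [x ^+ h.+1 - y ^+ h.+1]. As the leading coefficients of [x] and [y]
    agree, the top terms add up instead of cancelling. *)
Let S h : {poly F} := \sum_(i < h.+1) x ^+ (h - i) * y ^+ i.

Let x0 : x != 0. Proof. by rewrite -size_poly_gt0 sx. Qed.
Let y0 : y != 0. Proof. by rewrite -size_poly_gt0 sy. Qed.

Let sizeT h (i : 'I_h.+1) : size (x ^+ (h - i) * y ^+ i) = (d * h).+1.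
Proof.
rewrite size_mul ?expf_neq0 //; have := ltn_ord i.
rewrite -[size (x ^+ _)]prednK ?size_poly_gt0 ?expf_neq0 //.
rewrite -[size (y ^+ _)]prednK ?size_poly_gt0 ?expf_neq0 //.
by rewrite !size_exp sx sy /=; nia.
Qed.

Lemma size_sum_pow h : (size (S h) <= (d * h).+1)%N.
Proof.
rewrite (leq_trans (size_sum _ _ _)) //; apply/bigmax_leqP => i _.
by rewrite sizeT.
Qed.

Lemma coef_sum_pow h : (S h)`_(d * h) = kappa ^+ h *+ h.+1.
Proof.
rewrite coef_sum (eq_bigr (fun _ => kappa ^+ h)) ?sumr_const ?card_ord // => i _.
have := lead_coefE (x ^+ (h - i) * y ^+ i); rewrite sizeT /= => <-.
rewrite lead_coefM !lead_coef_exp lx ly -exprD subnK //.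
by rewrite -ltnS.
Qed.

End SumPow.

(* The other factor of [x ^+ h - y ^+ h] has the full degree [d * h.-1]. *)
Lemma eq_of_close_powers (F : numDomainType) (x y : {poly F}) d h :
  size x = d.+1 -> size y = d.+1 -> lead_coef x = lead_coef y ->
  (size (x ^+ h.+1 - y ^+ h.+1)%R <= d * h)%N -> x = y.
Proof.
move=> sx sy lxy; rewrite subrXX; set s := \sum_(i < _) _.
have /esym sE : s = \sum_(i < h.+1) x ^+ (h - i) * y ^+ i by apply: eq_bigr.
have cs := coef_sum_pow sx sy (erefl _) (esym lxy) h; rewrite sE in cs.
have s_top : s`_(d * h) != 0.
  by rewrite cs mulrn_eq0 /= expf_neq0 // lead_coef_eq0 -size_poly_gt0 sx.
apply: contraTeq; rewrite -subr_eq0 => xy0.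
have s0 : s != 0 by apply: contraNneq s_top => ->; rewrite coef0.
rewrite size_mul // -ltnNge.
have : (d * h < size s)%N.
  by rewrite ltnNge; apply/negP => /leq_sizeP/(_ _ (leqnn _)) /eqP; apply/negP.
move: xy0; rewrite -size_poly_gt0; set a := size (x - y); set b := size s; clearbody a b; lia.
Qed.

(** [b] is the polynomial part of a root of order [h.+1] of [p] at infinity, found one coefficient
    at a time from the top. *)
Lemma approximate_root (F : numFieldType) (p : {poly F}) m h kappa :
  size p = (m * h.+1).+1 -> kappa ^+ h.+1 = lead_coef p ->
  exists b : {poly F}, [/\ size b = m.+1, lead_coef b = kappa
                         & (size (p - b ^+ h.+1)%R <= m * h)%N].
Proof.
move=> sp kp.
have k0 : kappa != 0.
  apply/eqP => k0; move: kp; rewrite k0 expr0n /= => /esym/eqP.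
  by rewrite lead_coef_eq0 -size_poly_eq0 sp.
suff H j : (j <= m)%N -> exists b : {poly F}, [/\ size b = m.+1, lead_coef b = kappa
                         & (size (p - b ^+ h.+1)%R <= m * h + (m - j))%N].
  by have := H m (leqnn m); rewrite subnn addn0.
elim: j => [_|j IHj jm].
  exists (kappa *: 'X^m).
  have s1 : size (kappa *: 'X^m) = m.+1 by rewrite size_scale ?size_polyXn.
  have l1 : lead_coef (kappa *: 'X^m) = kappa by rewrite lead_coefZ lead_coefXn mulr1.
  split=> //; rewrite subn0 exprZn -exprM kp.
  rewrite addnC -mulnS; apply: size_le_coef0.
    rewrite (leq_trans (size_polyD _ _)) // geq_max sp leqnn /= size_polyN.
    by rewrite (leq_trans (size_scale_leq _ _)) // size_polyXn.
  by rewrite coefB coefZ coefXn eqxx mulr1 lead_coefE sp subrr.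
have [b [sb lb pb]] := IHj (ltnW jm).
set i := (m - j.+1)%N.
have im : (i < m)%N by rewrite /i; lia.
(* Adding [c *: 'X^i] to [b] changes the coefficient of degree [m * h + i] in [b ^+ h.+1] by
   [c * (kappa ^+ h *+ h.+1)]; this [c] cancels the error in that degree. *)
pose c := (p - b ^+ h.+1)`_(m * h + i) / (kappa ^+ h *+ h.+1).
have d0 : kappa ^+ h *+ h.+1 != 0 by rewrite mulrn_eq0 /= expf_neq0.
pose e := c *: 'X^i; exists (b + e).
have se : (size e <= i.+1)%N by rewrite (leq_trans (size_scale_leq _ _)) // size_polyXn.
have seb : (size e < size b)%N by rewrite sb; lia.
have sbe : size (b + e) = m.+1 by rewrite size_polyDl.
have lbe : lead_coef (b + e) = kappa by rewrite lead_coefDl.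
split=> //.
have -> : p - (b + e) ^+ h.+1 = (p - b ^+ h.+1) - ((b + e) ^+ h.+1 - b ^+ h.+1) by ring.
rewrite subrXX [b + e - b]addrAC subrr add0r.
set s := \sum_(_ < _) _.
have ss : (size s <= (m * h).+1)%N by apply: size_sum_pow sbe sb _.
have cs : s`_(m * h) = kappa ^+ h *+ h.+1 by apply: coef_sum_pow sbe sb lbe lb _.
have ij : (m - j)%N = i.+1 by rewrite /i; lia.
apply: size_le_coef0.
  rewrite (leq_trans (size_polyD _ _)) // geq_max size_polyN.
  rewrite (leq_trans pb) ?ij ?addnS //=.
  rewrite (leq_trans (size_polyMleq _ _)) //; move: se ss.
  by move: (size e) (size s) => a1 a2; lia.
rewrite coefB /e -scalerAl coefZ coefXnM ifF; last by apply/negbTE; rewrite -leqNgt leq_addl.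
by rewrite addnK cs /c divfK // subrr.
Qed.

Lemma size_sub_lead (A : nzRingType) (p q : {poly A}) :
  p != 0 -> size p = size q -> lead_coef p = lead_coef q ->
  (size (p - q)%R < size p)%N.
Proof.
move=> p0 spq lpq; have sp : (0 < size p)%N by rewrite size_poly_gt0.
rewrite -[X in (_ < X)%N](prednK sp) ltnS; apply: size_le_coef0.
  rewrite prednK // (leq_trans (size_polyD _ _)) // size_polyN -spq.
  by rewrite maxnn leqnn.
by rewrite coefB {2}spq -!lead_coefE lpq subrr.
Qed.

(** [B1] and [B2] are approximate roots of order [h] of [f] and [g]. The [h]-th powers of [B1 \Po A]
    and [B2 \Po B] both approximate [f \Po A], closely enough for [eq_of_close_powers]. *)
Lemma left_lcm (F : numClosedFieldType) (f g A B : {poly F}) m n k h :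
  (0 < m)%N -> (0 < n)%N -> (0 < k)%N -> (0 < h)%N ->
  pdeg f = (m * h)%N -> pdeg g = (n * h)%N -> pdeg A = (k * n)%N -> pdeg B = (k * m)%N ->
  f \Po A = g \Po B ->
  exists B1 B2 : {poly F}, [/\ pdeg B1 = m, pdeg B2 = n & B1 \Po A = B2 \Po B].
Proof.
case: h => // h m0 n0 k0 _ df dg dA dB e.
have sf : size f = (m * h.+1).+1 by rewrite size_pdeg df ?muln_gt0 ?m0.
have sg : size g = (n * h.+1).+1 by rewrite size_pdeg dg ?muln_gt0 ?n0.
have sA : size A = (k * n).+1 by rewrite size_pdeg dA ?muln_gt0 ?k0.
have sB : size B = (k * m).+1 by rewrite size_pdeg dB ?muln_gt0 ?k0.
pose kf := h.+1.-root (lead_coef f).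
have kfE : kf ^+ h.+1 = lead_coef f by rewrite /kf rootCK.
(* Among the roots of [lead_coef g], the one giving [b1 \Po A] and [b2 \Po B] the same leading
   coefficient; another choice would be off by a root of unity. *)
pose kg := kf * lead_coef A ^+ m / lead_coef B ^+ n.
have lB0 : lead_coef B != 0 by rewrite lead_coef_eq0 -size_poly_gt0 sB.
have sA1 : (1 < size A)%N by rewrite sA ltnS muln_gt0 k0.
have sB1 : (1 < size B)%N by rewrite sB ltnS muln_gt0 k0.
have kgE : kg ^+ h.+1 = lead_coef g.
  have := congr1 lead_coef e; rewrite !lead_coef_comp // sf sg /=.
  rewrite /kg exprMn exprVn exprMn kfE -!exprM => ->.
  by rewrite mulfK // expf_neq0.
have [b1 [sb1 lb1 a1]] := approximate_root sf kfE.
have [b2 [sb2 lb2 a2]] := approximate_root sg kgE.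
exists b1, b2; rewrite /pdeg sb1 sb2; split=> //.
have s1 : size (b1 \Po A) = (k * m * n).+1.
  by rewrite size_pdeg pdeg_comp dA /pdeg sb1 /=; [lia|rewrite !muln_gt0 k0 n0 m0].
have s2 : size (b2 \Po B) = (k * m * n).+1.
  by rewrite size_pdeg pdeg_comp dB /pdeg sb2 /=; [lia|rewrite !muln_gt0 k0 n0 m0].
apply: (eq_of_close_powers (h := h) s1 s2).
  by rewrite !lead_coef_comp // sb1 sb2 lb1 lb2 /= /kg divfK // expf_neq0.
have -> : (b1 \Po A) ^+ h.+1 - (b2 \Po B) ^+ h.+1 =
   ((g - b2 ^+ h.+1) \Po B) - ((f - b1 ^+ h.+1) \Po A).
  by rewrite !comp_polyB -!rmorphXn /= e; ring.
rewrite (leq_trans (size_polyD _ _)) // geq_max size_polyN.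
have H (p q : {poly F}) a : (0 < a)%N -> (0 < pdeg q)%N -> (size p <= a)%N -> (size (p \Po q) <= a * pdeg q)%N.
  move=> a0 q0 pa; rewrite (leq_trans (size_comp_poly_leq _ _)) // -/(pdeg q).
  case: (size p) pa => [|j] /= ja; last by nia.
  by nia.
have H0 (p q : {poly F}) a : (0 < pdeg q)%N -> (size p <= a)%N -> (size (p \Po q) <= a * pdeg q)%N.
  case: a => [|a] q0 pa; last exact: H.
  by move: pa; rewrite leqn0 size_poly_eq0 => /eqP->; rewrite comp_poly0 size_poly0.
apply/andP; split.
  have dB0 : (0 < pdeg B)%N by rewrite dB muln_gt0 k0.
  rewrite (leq_trans (H0 _ _ _ dB0 a2)) // dB; lia.
have dA0 : (0 < pdeg A)%N by rewrite dA muln_gt0 k0.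
rewrite (leq_trans (H0 _ _ _ dA0 a1)) // dA; lia.
Qed.

(** A common element of [F[A]] and [F[B]] has degree divisible by the lcm [k * m * n] of their
    degrees, which is the degree of [B1 \Po A]; subtracting a multiple of a power of the latter
    lowers the degree. *)
Lemma left_gcd (F : fieldType) (A B B1 B2 : {poly F}) m n k :
  (0 < m)%N -> (0 < n)%N -> (0 < k)%N -> coprime m n ->
  pdeg A = (k * n)%N -> pdeg B = (k * m)%N -> pdeg B1 = m -> pdeg B2 = n ->
  B1 \Po A = B2 \Po B ->
  forall f g : {poly F}, f \Po A = g \Po B ->
  exists2 Q : {poly F}, f = Q \Po B1 & g = Q \Po B2.
Proof.
move=> m0 n0 k0 cmn dA dB dB1 dB2 eB f g.
have dA0 : (0 < pdeg A)%N by rewrite dA muln_gt0 k0.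
have dB0 : (0 < pdeg B)%N by rewrite dB muln_gt0 k0.
have [N] := ubnP (size f); elim: N => // N IHN in f g * => fN e.
have [/eqP df0|df0] := boolP (pdeg f == 0%N).
  have /size1_polyC fE : (size f <= 1)%N by move: df0; rewrite /pdeg; case: (size f) => [|[]].
  exists f; first by rewrite fE comp_polyC.
  by apply: (comp_poly_inj dB0); rewrite -e fE !comp_polyC.
have de : (pdeg f * n = pdeg g * m)%N.
  apply/eqP; rewrite -(eqn_pmul2l k0); apply/eqP.
  have := pdeg_comp f A; rewrite e pdeg_comp dA dB.
  by move: (pdeg f) (pdeg g) => a b; nia.
have /dvdnP[h fh] : (m %| pdeg f)%N.
  by rewrite -(Gauss_dvdl _ cmn) de dvdn_mull.
have gh : (pdeg g = h * n)%N.
  by apply/eqP; rewrite -(eqn_pmul2r m0) -de fh; apply/eqP; lia.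
have h0 : (0 < h)%N by move: df0; rewrite fh; case: h {fh gh}.
have sf : size f = (h * m).+1 by rewrite size_pdeg ?fh // muln_gt0 h0.
have sB1 : size B1 = m.+1 by rewrite size_pdeg dB1.
have sB2 : size B2 = n.+1 by rewrite size_pdeg dB2.
have lB1 : lead_coef B1 != 0 by rewrite lead_coef_eq0 -size_poly_gt0 sB1.
pose c := lead_coef f / lead_coef B1 ^+ h.
have lf0 : lead_coef f != 0 by rewrite lead_coef_eq0 -size_poly_gt0 sf.
have c0 : c != 0 by rewrite mulf_neq0 // invr_eq0 expf_neq0.
have B1e0 : B1 ^+ h != 0 by rewrite -lead_coef_eq0 lead_coef_exp expf_neq0.
have lt : (size (f - c *: B1 ^+ h)%R < size f)%N.
  apply: size_sub_lead; first by rewrite -lead_coef_eq0.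
    rewrite size_scale // sf -(prednK (n := size (B1 ^+ h))) ?size_poly_gt0 //.
    by rewrite size_exp sB1 /= mulnC.
  by rewrite lead_coefZ lead_coef_exp divfK // expf_neq0.
have [||Q Qf Qg] := IHN (f - c *: B1 ^+ h) (g - c *: B2 ^+ h).
- by rewrite (leq_trans lt).
- by rewrite !comp_polyB !comp_polyZ !rmorphXn /= eB e.
exists (Q + c *: 'X^h).
  by rewrite comp_polyD comp_polyZ rmorphXn /= comp_polyX -Qf subrK.
by rewrite comp_polyD comp_polyZ rmorphXn /= comp_polyX -Qg subrK.
Qed.

(** * Right gcds through the algebra [F[A, B]] *)

Lemma sum_distinct_size (R : nzRingType) (a : nat -> {poly R}) n :
  (forall i j, (i < j < n)%N -> a i != 0 -> a j != 0 -> size (a i) != size (a j)) ->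
  (forall i, (i < n)%N -> a i = 0) \/
  exists i, [/\ (i < n)%N, a i != 0 & size (\sum_(j < n) a j)%R = size (a i)].
Proof.
elim: n => [|n IHn] dist; first by left.
rewrite big_ord_recr /=; have [|a0|[i [ltin ai0 si]]] := IHn.
- by move=> i j /andP[ij jn]; apply: dist; rewrite ij ltnW.
- have -> : \sum_(j < n) a j = 0 by apply: big1 => i _; apply: a0.
  rewrite add0r; have [an0|an0] := eqVneq (a n) 0.
    by left=> i; rewrite ltnS leq_eqVlt => /predU1P[->|/a0].
  by right; exists n.
have [->|an0] := eqVneq (a n) 0; first by right; exists i; rewrite addr0 ltnW.
have := dist i n; rewrite ltin ltnSn => /(_ isT ai0 an0).
rewrite -si neq_ltn => /orP[lt|lt]; right.
  by exists n; rewrite addrC size_polyDl.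
by exists i; rewrite size_polyDl // ltnW // si.
Qed.

(** The nonzero terms have degrees in different classes modulo [k], so leading terms cannot
    cancel. *)
Lemma sum_residues (R : idomainType) (a : nat -> {poly R}) k :
  (forall i, a i = 0 \/ (k %| pdeg (a i))%N) ->
  \sum_(i < k) a i * 'X^i = 0 -> forall i, (i < k)%N -> a i = 0.
Proof.
move=> ak s0.
have sE i : a i != 0 -> size (a i * 'X^i) = (pdeg (a i) + i).+1.
  by move=> ai; rewrite size_mulXn // addnC /pdeg -addSn prednK // size_poly_gt0.
have mX0 j : a j * 'X^j != 0 -> a j != 0 by apply: contraNneq => ->; rewrite mul0r.
move=> l; have [i j /andP[ij jk] /mX0 ai0 /mX0 aj0|a0|[i [ik /mX0 ai0]]] :=
    @sum_distinct_size _ (fun i => a i * 'X^i) k.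
- rewrite !sE // eqSS.
  case: (ak i) ai0 => [->|di _]; first by rewrite eqxx.
  case: (ak j) aj0 => [->|dj _]; first by rewrite eqxx.
  apply/eqP => e.
  have : (pdeg (a i) + i = pdeg (a j) + j %[mod k])%N by rewrite e.
  rewrite -(divnK di) -(divnK dj) !modnMDl !modn_small ?(ltn_trans ij) // => ije.
  by rewrite ije ltnn in ij.
- move=> /a0 /eqP; rewrite mulf_eq0 (negbTE (monic_neq0 (monicXn _ _))) orbF.
  by move/eqP.
by rewrite s0 size_poly0 sE.
Qed.

Lemma map_horner_eq0 (F : fieldType) (P : {poly {poly F}}) (s : F) :
  map_poly (horner_eval s) P = 0 -> exists Q, P = ('X - s%:P)%:P * Q.
Proof.
move=> P0; exists (\poly_(i < size P) (P`_i %/ ('X - s%:P))).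
apply/polyP => i; rewrite coefCM coef_poly; case: ltnP => iP; last first.
  by rewrite mulr0 nth_default.
rewrite mulrC divpK // dvdp_XsubCl rootE.
by have := congr1 (fun q : {poly F} => q`_i) P0; rewrite coef_map coef0 /= /horner_eval => ->.
Qed.

(* Gauss's lemma, by cancelling one linear factor of [c] at a time. *)
Lemma lead_coef_dvd_coef (F : closedFieldType) (c : {poly F}) (M Q D : {poly {poly F}}) gamma :
  c != 0 -> lead_coef M = gamma%:P -> gamma != 0 -> c%:P * M = Q * D ->
  forall i, lead_coef D %| D`_i.
Proof.
have [N] := ubnP (size c); elim: N => // N IHN in c Q D *.
move=> cN c0 lM g0 e i.
have [sc1|sc1] := boolP (size c == 1%N).
  have := congr1 lead_coef e; rewrite !lead_coefM lead_coefC lM => l.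
  have /dvdp_trans : lead_coef D %| 1.
    rewrite (dvdp_trans (dvdp_mull (lead_coef Q) (dvdpp _))) // -l.
    by rewrite dvdp1 mulrC mul_polyC size_scale.
  by apply; rewrite dvd1p.
have [s /rootP cs] := closed_rootP _ sc1.
have [c' cE] : exists c', c = c' * ('X - s%:P).
  by apply/dvdpP; rewrite dvdp_XsubCl; apply/rootP.
have c'0 : c' != 0 by apply: contraNneq c0 => c'0; rewrite cE c'0 mul0r.
have c'N : (size c' < N)%N.
  by move: cN; rewrite cE size_mul ?polyXsubC_eq0 // size_XsubC addn2 /= ltnS.
have X0 : ('X - s%:P)%:P != 0 :> {poly {poly F}} by rewrite polyC_eq0 polyXsubC_eq0.
have := congr1 (map_poly (horner_eval s)) e.
rewrite !rmorphM /= map_polyC /= /horner_eval cs mul0r => /esym/eqP.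
rewrite mulf_eq0 => /orP[] /eqP /map_horner_eq0 [E EE].
  apply: (IHN c' E) => //; apply: (mulfI X0).
  by rewrite [RHS]mulrA -EE -e cE polyCM mulrA [_%:P * c'%:P]mulrC.
have {}IHN : lead_coef E %| E`_i.
  apply: (IHN c' Q) => //; apply: (mulfI X0).
  by rewrite [RHS]mulrCA -EE -e cE polyCM mulrA [_%:P * c'%:P]mulrC.
by rewrite EE lead_coefM lead_coefC coefCM dvdp_mul.
Qed.

Lemma poly_dependence (F : fieldType) (T : finType) (p : T -> {poly F}) d :
  (forall t, size (p t) <= d)%N -> (d < #|T|)%N ->
  exists2 c : T -> F, exists t, c t != 0 & \sum_t c t *: p t = 0.
Proof.
move=> sp dT; pose M : 'M[F]_(#|T|, d) := \matrix_i poly_rV (p (enum_val i)).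
have : kermx M != 0.
  rewrite -mxrank_eq0 mxrank_ker subn_eq0 -ltnNge.
  by rewrite (leq_ltn_trans (rank_leq_col _)).
move=> /rowV0Pn[v /sub_kermxP vM v0].
exists (fun t => v 0 (enum_rank t)).
  have [i vi] : exists i, v 0 i != 0.
    apply/existsP; apply: contraR v0; rewrite negb_exists => /forallP v0.
    by apply/eqP/rowP => i; rewrite mxE; apply/eqP; have := v0 i; rewrite negbK.
  by exists (enum_val i); rewrite enum_valK.
have -> : \sum_t v 0 (enum_rank t) *: p t = rVpoly (v *m M).
  rewrite mulmx_sum_row linear_sum /= (reindex (@enum_val T predT)) /=.
    apply: eq_bigr => i _; rewrite linearZ /= rowK poly_rV_K // enum_valK.
    by [].
  by apply: onW_bij; exact: enum_val_bij.
by rewrite vM linear0.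
Qed.

Section Subalgebra.
Variable F : numClosedFieldType.
Variables (A B B1 B2 : {poly F}) (m n k : nat).
Hypotheses (m0 : (0 < m)%N) (n0 : (0 < n)%N) (k0 : (0 < k)%N) (cmn : coprime m n).
Hypotheses (dA : pdeg A = (k * n)%N) (dB : pdeg B = (k * m)%N).
Hypotheses (dB1 : pdeg B1 = m) (dB2 : pdeg B2 = n) (eB : B1 \Po A = B2 \Po B).

(* The image of [ev] is the algebra [F[A, B]]. *)
Local Notation ev := (horner_eval B \o map_poly (comp_poly A)).

Let dA0 : (0 < pdeg A)%N. Proof. by rewrite dA muln_gt0 k0. Qed.
Let dB0 : (0 < pdeg B)%N. Proof. by rewrite dB muln_gt0 k0. Qed.
Let sA : size A = (k * n).+1. Proof. by rewrite size_pdeg dA // muln_gt0 k0. Qed.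
Let sB : size B = (k * m).+1. Proof. by rewrite size_pdeg dB // muln_gt0 k0. Qed.

Lemma evE (u : {poly {poly F}}) : ev u = \sum_(j < size u) (u`_j \Po A) * B ^+ j.
Proof.
rewrite /= /horner_eval (@horner_coef_wide _ (size u)) ?size_poly //.
by apply: eq_bigr => j _; rewrite coef_map.
Qed.

(* Distinct powers of [B] contribute degrees that are distinct modulo [k * n]. *)
Lemma ev_small (u : {poly {poly F}}) : (size u <= n)%N -> u != 0 -> ev u != 0 /\ (k %| pdeg (ev u))%N.
Proof.
move=> un u0; rewrite evE.
pose a j := (u`_j \Po A) * B ^+ j.
have Ae0 p : (p \Po A == 0) = (p == 0).
  by apply/eqP/eqP => [e|->]; rewrite ?comp_poly0 //; apply: (comp_poly_inj dA0); rewrite comp_poly0.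
have B0 j : B ^+ j != 0 by rewrite expf_neq0 // -size_poly_gt0 sB.
have a0 j : (a j == 0) = (u`_j == 0) by rewrite /a mulf_eq0 Ae0 (negbTE (B0 j)) orbF.
have sa j : a j != 0 -> size (a j) = (k * (pdeg (u`_j) * n + m * j)).+1.
  move=> aj; have pA : u`_j \Po A != 0 by rewrite Ae0 -a0.
  rewrite size_neq0 // /a pdegM // pdeg_comp pdegX dA dB.
  by congr _.+1; move: (pdeg _) => d; lia.
have [i j /andP[ij jn] ai aj|z|[i [iu ai si]]] := @sum_distinct_size _ a (size u).
- rewrite !sa // eqSS eqn_pmul2l //; apply/eqP => e.
  have : (m * i = m * j %[mod n])%N.
    by rewrite -(modnMDl (pdeg u`_i)) e modnMDl.
  move/eqP; rewrite eq_sym eqn_mod_dvd ?leq_mul2l ?(ltnW ij) ?orbT // -mulnBr.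
  rewrite Gauss_dvdr 1?coprime_sym // => /dvdn_leq.
  by move: ij jn un; lia.
- case/eqP: u0; apply/polyP => j; rewrite coef0.
  have [ju|ju] := ltnP j (size u); last by rewrite nth_default.
  by apply/eqP; rewrite -a0 z.
rewrite -size_poly_gt0 /pdeg si; split; first by rewrite size_poly_gt0.
by rewrite sa //= dvdn_mulr.
Qed.

Lemma evC (c : {poly F}) : ev c%:P = c \Po A.
Proof. by rewrite /= map_polyC /horner_eval hornerC. Qed.

Lemma evX : ev 'X = B.
Proof. by rewrite /= map_polyX /horner_eval hornerX. Qed.

Lemma evM (u v : {poly {poly F}}) : ev (u * v) = ev u * ev v.
Proof. exact: rmorphM. Qed.

Lemma evD (u v : {poly {poly F}}) : ev (u + v) = ev u + ev v.
Proof. exact: rmorphD. Qed.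

Lemma evXn (u : {poly {poly F}}) h : ev (u ^+ h) = ev u ^+ h.
Proof. exact: rmorphXn. Qed.

Lemma evB (u v : {poly {poly F}}) : ev (u - v) = ev u - ev v.
Proof. exact: rmorphB. Qed.

(** [Rel] is a monic equation of degree [n] for [B] over [F[A]]; the remainder modulo it is covered
    by [ev_small]. *)
Lemma ev_dvd (u : {poly {poly F}}) : ev u = 0 \/ (k %| pdeg (ev u))%N.
Proof.
pose c := (lead_coef B2)^-1.
pose Rel : {poly {poly F}} := map_poly polyC (c *: B2) - (c *: B1)%:P.
have sB2 : size B2 = n.+1 by rewrite size_pdeg dB2.
have c0 : c != 0 by rewrite invr_eq0 lead_coef_eq0 -size_poly_gt0 sB2.
have sM : size (map_poly polyC (c *: B2) : {poly {poly F}}) = n.+1.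
  by rewrite size_map_inj_poly ?polyC0 //; [rewrite size_scale|exact: polyC_inj].
have sC : (size ((c *: B1)%:P : {poly {poly F}}) < size (map_poly polyC (c *: B2) : {poly {poly F}}))%N.
  by rewrite sM ltnS (leq_trans (size_polyC_leq1 _)).
have sR : size Rel = n.+1 by rewrite -sM; apply: size_polyDl; rewrite size_polyN.
have mR : Rel \is monic.
  rewrite monicE lead_coefDl ?size_polyN // lead_coef_map_inj ?polyC0 //; last exact: polyC_inj.
  by rewrite lead_coefZ /c mulVf // -invr_eq0.
have eR : ev Rel = 0.
  rewrite /Rel evB; apply/eqP; rewrite subr_eq0; apply/eqP.
  rewrite evC comp_polyZ eB -comp_polyZ /= /horner_eval -map_poly_comp.
  have -> : map_poly (comp_poly A \o polyC) (c *: B2) = map_poly polyC (c *: B2).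
    by apply: eq_map_poly => x /=; rewrite comp_polyC.
  by [].
rewrite (Pdiv.IdomainMonic.divp_eq mR u) evD evM eR mulr0 add0r.
set v := Pdiv.IdomainDefs.modp _ _.
have lt : (size v < size Rel)%N by rewrite Pdiv.CommonIdomain.ltn_modp monic_neq0.
have [v0|/ev_small v0] := eqVneq v 0; first by left; rewrite v0 rmorph0.
by right; case: v0 => //; rewrite -ltnS -sR.
Qed.

(** An equation of degree [k] for the variable over [F[A, B]], by counting dimensions: the
    [(k + 1) * n * (I + 1)] products of [A ^+ i], [B ^+ j] and ['X^l] have degree at most
    [k * n * I + k * m * n + k], so they are dependent once [I] is large. *)
Lemma ev_relation : exists u : nat -> {poly {poly F}},
  [/\ forall l, (size (u l) <= n)%N, ev (u k) != 0
    & \sum_(l < k.+1) ev (u l) * 'X^l = 0].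
Proof.
pose I := (k * m * n + k).+1.
pose T := ('I_k.+1 * 'I_n.-1.+1 * 'I_I.+1)%type.
pose p (t : T) : {poly F} := A ^+ t.2 * B ^+ t.1.2 * 'X^(t.1.1).
pose d := (k * n * I + k * m * n + k).+1.
have A0 : A != 0 by rewrite -size_poly_gt0 sA.
have B0 : B != 0 by rewrite -size_poly_gt0 sB.
have sp t : (size (p t) <= d)%N.
  rewrite size_neq0 /p; last by rewrite !mulf_neq0 ?expf_neq0 ?polyX_eq0.
  rewrite !pdegM ?mulf_neq0 ?expf_neq0 ?polyX_eq0 // !pdegX dA dB /pdeg size_polyX /=.
  have := ltn_ord t.1.1; have := ltn_ord t.1.2; have := ltn_ord t.2.
  move: (nat_of_ord t.1.1) (nat_of_ord t.1.2) (nat_of_ord t.2) => a b c ca ba aa.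
  rewrite prednK // in ba; rewrite /d !ltnS mul1n.
  rewrite !leq_add // ?leq_mul //; nia.
have dT : (d < #|{: T}|)%N.
  by rewrite !card_prod !card_ord prednK // /d /I; nia.
have [c [[[l0 j0] i0] c0] cs] := poly_dependence sp dT.
pose u l : {poly {poly F}} :=
  \poly_(j < n) \poly_(i < I.+1) c (inord l, inord j, inord i).
have su l : (size (u l) <= n)%N by apply: size_poly.
have sum0 : \sum_(l < k.+1) ev (u l) * 'X^l = 0.
  have sc : \sum_l \sum_j \sum_i c (l, j, i) *: p (l, j, i) = 0.
    by rewrite -[RHS]cs pair_bigA pair_bigA; apply: eq_bigr => -[[l j] i] _.
  rewrite -[RHS]sc.
  apply: eq_bigr => l _; rewrite /u poly_def rmorph_sum mulr_suml.
  rewrite -(big_mkord predT (fun j => ev ((\poly_(i < I.+1) c (inord l, inord j, inord i)) *: 'X^j) * 'X^l)).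
  rewrite -{1}(prednK n0) big_mkord; apply: eq_bigr => j _.
  rewrite -mul_polyC evM evC rmorphXn /= -/(ev 'X) evX.
  rewrite poly_def rmorph_sum !mulr_suml; apply: eq_bigr => i _.
  by rewrite !inord_val /= comp_polyZ rmorphXn /= comp_polyX -!scalerAl.
(* Without the term [l = k] the remaining exponents lie in distinct classes modulo [k], and all
   coefficients would vanish. *)
exists u; split=> //; apply/negP => /eqP uk0.
have : u l0 != 0.
  apply: contraNneq c0 => /(congr1 (fun q : {poly {poly F}} => q`_j0`_i0)).
  rewrite coef_poly (leq_trans (ltn_ord j0)) ?prednK // coef_poly ltn_ord !inord_val.
  by rewrite !coef0 => ->.
move=> /(ev_small (su _))[/eqP ul0 _]; apply: ul0.
move: sum0; rewrite big_ord_recr /= -/(ev (u k)) uk0 mul0r addr0 => sum0.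
have H := sum_residues (fun i => ev_dvd (u i)) sum0.
have := ltn_ord l0; rewrite ltnS leq_eqVlt => /predU1P[->|/H//].
exact: uk0.
Qed.

(* The remainder of [A(T) - A] by [\sum_l ev (u l) T^l] vanishes by [sum_residues],
   so Gauss's lemma applies to the exact pseudo-division. *)
Lemma ev_relation_quotients (u : nat -> {poly {poly F}}) :
  ev (u k) != 0 -> \sum_(l < k.+1) ev (u l) * 'X^l = 0 ->
  forall l, (l <= k)%N -> ev (u k) %| ev (u l).
Proof.
move=> uk0 sum0.
pose D : {poly {poly {poly F}}} := \poly_(l < k.+1) u l.
pose M : {poly {poly {poly F}}} := map_poly (fun c => c%:P%:P) A - ('X%:P)%:P.
have uk0' : u k != 0 by apply: contraNneq uk0 => ->; rewrite rmorph0.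
have sD : size D = k.+1 by rewrite size_poly_eq.
have lD : lead_coef D = u k by rewrite lead_coefE sD coef_poly ltnSn.
pose E := map_poly ev.
have Ecoef p i : (E p)`_i = ev p`_i by rewrite coef_map.
have EM : E M = map_poly polyC A - A%:P.
  rewrite /E /M rmorphB /= map_polyC /=; congr (_ - _%:P).
    rewrite -map_poly_comp; apply: eq_map_poly => c /=.
    by transitivity (ev c%:P%:P); [|rewrite evC comp_polyC].
  by transitivity (ev 'X%:P); [|rewrite evC comp_polyX].
have ED : E D = \poly_(l < k.+1) ev (u l).
  by apply/polyP => i; rewrite Ecoef !coef_poly; case: ifP => // _; rewrite rmorph0.
have := Pdiv.WeakIdomain.divp_eq M D.
set Q := Pdiv.IdomainDefs.divp _ _; set R := Pdiv.IdomainDefs.modp _ _.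
set N := Pdiv.IdomainDefs.scalp _ _; rewrite lD -mul_polyC => e.
have sR : (size R <= k)%N.
  rewrite -ltnS -sD Pdiv.CommonIdomain.ltn_modp -lead_coef_eq0 lD //.
have {}e : (ev (u k) ^+ N)%:P * E M = E Q * E D + E R.
  have EMul p q : E (p * q) = E p * E q by exact: rmorphM.
  have EAdd p q : E (p + q) = E p + E q by exact: rmorphD.
  have := congr1 E e; rewrite EAdd !EMul => <-; congr (_ * _).
  by rewrite -rmorphXn /E map_polyC.
have ER : E R = 0.
  have : \sum_(l < k) ev R`_l * 'X^l = 0.
    have <- : (E R).['X] = \sum_(l < k) ev R`_l * 'X^l.
      rewrite (@horner_coef_wide _ k); last first.
        by rewrite (leq_trans _ sR) // size_poly.
      by apply: eq_bigr => i _; rewrite Ecoef.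
    have := congr1 (fun p => p.['X]) e.
    rewrite hornerD !hornerM EM hornerD hornerN !hornerC -/(A \Po 'X) comp_polyXr subrr mulr0.
    have -> : (E D).['X] = 0 by rewrite ED horner_poly.
    by rewrite mulr0 add0r.
  move=> rs; apply/polyP => i; rewrite Ecoef coef0.
  have [ik|ik] := ltnP i k; last by rewrite nth_default ?rmorph0 // (leq_trans sR).
  by apply: (sum_residues (a := fun i => ev R`_i) _ rs) => // j; apply: ev_dvd.
have lM : lead_coef (E M) = (lead_coef A)%:P.
  rewrite EM lead_coefDl ?lead_coef_map_inj ?polyC0 //; try exact: polyC_inj.
  rewrite size_polyN size_map_inj_poly ?polyC0 //; last exact: polyC_inj.
  by rewrite sA (leq_ltn_trans (size_polyC_leq1 _)) // ltnS muln_gt0 k0.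
rewrite ER addr0 in e.
move=> l lk.
have lA0 : lead_coef A != 0 by rewrite lead_coef_eq0 -size_poly_gt0 sA.
have := lead_coef_dvd_coef (expf_neq0 N uk0) lM lA0 e l.
rewrite Ecoef lead_coefE ED size_poly_eq //= !coef_poly ltnSn.
by rewrite ltnS lk.
Qed.

(** An explicit form of Lueroth's theorem: [w] is the equation of the variable over [F(A, B)] made
    monic, its coefficients are polynomials by [ev_relation_quotients], and [W] is its constant
    term. *)
Lemma right_gcd : exists W A' B' : {poly F},
  [/\ pdeg W = k, A = A' \Po W & B = B' \Po W].
Proof.
have [u [su uk0 sum0]] := ev_relation.
have dv := ev_relation_quotients uk0 sum0.
pose w l := ev (u l) %/ ev (u k).
have wE l : (l <= k)%N -> ev (u l) = w l * ev (u k).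
  by move=> lk; rewrite /w divpK // dv.
have wk : w k = 1 by rewrite /w divpp.
have wsum : \sum_(l < k.+1) w l * 'X^l = 0.
  apply: (mulIf uk0); rewrite mul0r -[RHS]sum0 mulr_suml; apply: eq_bigr => l _.
  by rewrite mulrAC -wE // -ltnS.
have dvd_of p v : ev v != 0 -> (p * ev v = 0 \/ (k %| pdeg (p * ev v))%N) ->
    p = 0 \/ (k %| pdeg p)%N.
  move=> v0; have [->|p0] := eqVneq p 0; first by left.
  case=> [/eqP|]; first by rewrite mulf_eq0 (negbTE p0) (negbTE v0).
  have [/eqP|dv0] := ev_dvd v; first by rewrite (negbTE v0).
  by rewrite pdegM // dvdn_addl //; right.
have dw l : (l <= k)%N -> w l = 0 \/ (k %| pdeg (w l))%N.
  by move=> lk; apply: dvd_of uk0 _; rewrite -wE //; apply: ev_dvd.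
pose b l := w l * 'X^l.
have bE l : b l != 0 -> [/\ w l != 0 & size (b l) = (pdeg (w l) + l).+1].
  move=> bl; have wl : w l != 0 by apply: contraNneq bl => wl; rewrite /b wl mul0r.
  by split=> //; rewrite /b size_mulXn // addnC size_neq0.
(* The degrees of the terms [w l * 'X^l] are distinct modulo [k] except for [l = 0] and [l = k], so
   these two must cancel each other. *)
have /andP[W0 /eqP dW] : (w 0 != 0) && (pdeg (w 0) == k).
  apply: contraT; rewrite negb_and negbK => nW.
  have [i j /andP[ij]|z|[i [ik bi si]]] := @sum_distinct_size _ b k.+1.
  - rewrite ltnS => jk /bE[wi ->] /bE[wj ->]; rewrite eqSS; apply/eqP => e.
    have ik : (i < k)%N by rewrite (leq_trans ij).
    have di : (k %| pdeg (w i))%N.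
      by case: (dw i (ltnW ik)) wi => // ->; rewrite eqxx.
    have dj : (k %| pdeg (w j))%N by case: (dw j jk) wj => // ->; rewrite eqxx.
    have : (i = j %[mod k])%N.
      by rewrite -(modnMDl (pdeg (w i) %/ k)) divnK // e -{1}(divnK dj) modnMDl.
    rewrite modn_small // => ij'.
    have jE : j = k.
      by apply/eqP; rewrite eqn_leq jk leqNgt; apply/negP => jk'; rewrite modn_small // in ij'; rewrite ij' ltnn in ij.
    rewrite jE modnn in ij'; move: e wi; rewrite ij' jE wk /pdeg size_poly1 /= addn0 add0n => e.
    by case/orP: nW => [->//|]; rewrite /pdeg e eqxx.
  - have := z k (ltnSn k); rewrite /b wk mul1r => /eqP.
    by rewrite (negbTE (monic_neq0 (monicXn _ _))).
  by move: si; rewrite wsum size_poly0 size_neq0.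
(* Stated for quotients of elements of [F[A, B]], because [w 0] itself is only known as such a
   quotient. Their degrees are still divisible by [k], so powers of [w 0] remove leading terms. *)
have main N (p : {poly F}) (v v' : {poly {poly F}}) : (size p < N)%N -> ev v != 0 -> p * ev v = ev v' -> exists P, p = P \Po w 0.
  elim: N => // N IHN in p v v' *; move=> pN v0 pv.
  have [->|p0] := eqVneq p 0; first by exists 0; rewrite comp_poly0.
  have [//|/eqP|/dvdnP[h ph]] := dvd_of p v v0.
    by rewrite pv; apply: ev_dvd.
    by rewrite (negbTE p0).
  pose c := lead_coef p / lead_coef (w 0) ^+ h.
  have lw0 : lead_coef (w 0) != 0 by rewrite lead_coef_eq0.
  have lp0 : lead_coef p != 0 by rewrite lead_coef_eq0.
  have c0 : c != 0 by rewrite mulf_neq0 // invr_eq0 expf_neq0.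
  have lt : (size (p - c *: w 0 ^+ h)%R < size p)%N.
    apply: size_sub_lead => //.
      by rewrite size_scale // !size_neq0 ?expf_neq0 // pdegX dW ph mulnC.
    by rewrite lead_coefZ lead_coef_exp divfK // expf_neq0.
  have [|||P PE] := IHN (p - c *: w 0 ^+ h) (v * u k ^+ h)
     (v' * u k ^+ h - c%:P%:P * v * u 0 ^+ h).
  - by rewrite (leq_trans lt).
  - by rewrite evM evXn mulf_neq0 // expf_neq0.
  - rewrite evB !evM !evXn evC comp_polyC.
    rewrite (wE 0%N) // exprMn -pv -mul_polyC; ring.
  exists (P + c *: 'X^h).
  by rewrite comp_polyD comp_polyZ rmorphXn /= comp_polyX -PE subrK.
have ev1 : ev 1 = 1 by exact: rmorph1.
have [||A' EA] := main (size A).+1 A 1 ('X%:P) (ltnSn _).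
- by rewrite ev1 oner_neq0.
- by rewrite evC ev1 mulr1 comp_polyX.
have [||B' EB'] := main (size B).+1 B 1 'X (ltnSn _).
- by rewrite ev1 oner_neq0.
- by rewrite evX ev1 mulr1.
by exists (w 0), A', B'.
Qed.

End Subalgebra.

(** One coprime pair serves both sides: comparing degrees gives [pdeg f * n = pdeg g * m], so the
    quotients of the left degrees by their gcd are those of the right degrees, interchanged. *)
Lemma ritt_square (F : numClosedFieldType) (f g A B : {poly F}) :
  (0 < pdeg f)%N -> (0 < pdeg g)%N -> (0 < pdeg A)%N -> (0 < pdeg B)%N ->
  f \Po A = g \Po B ->
  exists Q W f' g' A' B' : {poly F},
  [/\ [/\ f = Q \Po f', g = Q \Po g', A = A' \Po W & B = B' \Po W],
      f' \Po A' = g' \Po B',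
      [/\ pdeg f' = pdeg B', pdeg g' = pdeg A', (0 < pdeg f')%N, (0 < pdeg g')%N
        & coprime (pdeg f') (pdeg g')],
      pdeg Q = gcdn (pdeg f) (pdeg g) & pdeg W = gcdn (pdeg A) (pdeg B)].
Proof.
move=> f0 g0 A0 B0 e.
pose k := gcdn (pdeg A) (pdeg B); pose h := gcdn (pdeg f) (pdeg g).
have k0 : (0 < k)%N by rewrite gcdn_gt0 A0.
have h0 : (0 < h)%N by rewrite gcdn_gt0 f0.
pose n := (pdeg A %/ k)%N; pose m := (pdeg B %/ k)%N.
have dA : pdeg A = (k * n)%N by rewrite mulnC divnK // dvdn_gcdl.
have dB : pdeg B = (k * m)%N by rewrite mulnC divnK // dvdn_gcdr.
have n0 : (0 < n)%N by move: A0; rewrite dA muln_gt0 => /andP[].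
have m0 : (0 < m)%N by move: B0; rewrite dB muln_gt0 => /andP[].
have cmn : coprime m n.
  by rewrite coprime_sym /coprime -(eqn_pmul2l k0) muln_gcdr -dA -dB muln1.
have de : (pdeg f * n = pdeg g * m)%N.
  apply/eqP; rewrite -(eqn_pmul2l k0); apply/eqP.
  have := pdeg_comp f A; rewrite e pdeg_comp dA dB.
  by move: (pdeg f) (pdeg g) => a b; nia.
have /dvdnP[h' fh] : (m %| pdeg f)%N by rewrite -(Gauss_dvdl _ cmn) de dvdn_mull.
have gh : (pdeg g = h' * n)%N.
  by apply/eqP; rewrite -(eqn_pmul2r m0) -de fh; apply/eqP; lia.
have hE : h = h'.
  by rewrite /h fh gh -muln_gcdr (eqP cmn) muln1.
have dF : pdeg f = (m * h)%N by rewrite hE mulnC.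
have dG : pdeg g = (n * h)%N by rewrite hE mulnC.
have [B1 [B2 [d1 d2 eB]]] := left_lcm m0 n0 k0 h0 dF dG dA dB e.
have [Q fQ gQ] := left_gcd m0 n0 k0 cmn dA dB d1 d2 eB e.
have [W [A' [B' [dW AW BW]]]] := right_gcd m0 n0 k0 cmn dA dB d1 d2 eB.
have dA' : pdeg A' = n.
  by apply/eqP; rewrite -(eqn_pmul2r k0) -{1}dW -pdeg_comp -AW dA mulnC.
have dB' : pdeg B' = m.
  by apply/eqP; rewrite -(eqn_pmul2r k0) -{1}dW -pdeg_comp -BW dB mulnC.
exists Q, W, B1, B2, A', B'; rewrite d1 d2 dA' dB' dW; split=> //.
  by apply: (@comp_poly_inj _ _ _ W); rewrite ?dW // -!comp_polyA -AW -BW.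
rewrite -/h; apply/eqP; rewrite -(eqn_pmul2r m0) -{1}d1 -pdeg_comp -fQ dF mulnC.
by [].
Qed.

(** * Multiplicities and Ritt's second theorem *)

Lemma poly_eq0_everywhere (F : numFieldType) (p : {poly F}) : (forall x, p.[x] = 0) -> p = 0.
Proof.
move=> p0; apply/eqP/negPn/negP => pN0.
have := @max_poly_roots _ p [seq k%:R | k <- iota 0 (size p)] pN0.
rewrite size_map size_iota ltnn map_inj_uniq ?iota_uniq; last first.
  by move=> i j /eqP; rewrite eqr_nat => /eqP.
move=> h; suff /h/(_ isT) : all (root p) [seq k%:R | k <- iota 0 (size p)] by [].
by apply/allP => x _; rewrite rootE p0.
Qed.

Section Multiplicity.
Variable F : numClosedFieldType.
Implicit Types p q : {poly F}.

Definition rootseq p : seq F := sval (closed_field_poly_normal p).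

Lemma rootseqE p : p = lead_coef p *: \prod_(z <- rootseq p) ('X - z%:P).
Proof. exact: (svalP (closed_field_poly_normal p)). Qed.

Lemma mupZ x (c : F) p : c != 0 -> mup x (c *: p) = mup x p.
Proof. by move=> c0; rewrite -mul_polyC mupMr // rootC. Qed.

Lemma mup_rootseq x p : p != 0 -> mup x p = count_mem x (rootseq p).
Proof.
by move=> p0; rewrite {1}(rootseqE p) mupZ ?lead_coef_eq0 // mu_prod_XsubC.
Qed.

Lemma size_rootseq p : p != 0 -> size (rootseq p) = pdeg p.
Proof.
move=> p0; rewrite /pdeg {2}(rootseqE p) size_scale ?lead_coef_eq0 //.
by rewrite size_prod_XsubC.
Qed.

Lemma root_rootseq x p : p != 0 -> root p x = (x \in rootseq p).
Proof.
by move=> p0; rewrite {1}(rootseqE p) rootZ ?lead_coef_eq0 // root_prod_XsubC.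
Qed.

Lemma sum_count_mem (T : eqType) (r s : seq T) : uniq r ->
  (\sum_(x <- r) count_mem x s = count [in r] s)%N.
Proof.
move=> ur; have cE (t : seq T) x : count_mem x t = (\sum_(y <- t) (y == x))%N.
  by elim: t => [|y t IHt]; rewrite ?big_nil // big_cons -IHt.
under eq_bigr do rewrite cE; rewrite exchange_big /=; elim: s => [|y s IHs]; first by rewrite big_nil.
rewrite big_cons IHs /=; congr (_ + _)%N.
rewrite -(count_uniq_mem y ur) cE; apply: eq_bigr => x _.
by rewrite eq_sym.
Qed.

Lemma sum_count_uniq (T : eqType) (r s : seq T) : uniq r ->
  (\sum_(x <- r) count_mem x s <= size s)%N.
Proof. by move=> ur; rewrite sum_count_mem // count_size. Qed.

Lemma sum_count_supp (T : eqType) (r s : seq T) : uniq r -> {subset s <= r} ->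
  (\sum_(x <- r) count_mem x s = size s)%N.
Proof. by move=> ur sr; rewrite sum_count_mem //; apply/eqP; rewrite -all_count; apply/allP. Qed.

Lemma sum_count_undup (T : eqType) (s : seq T) : (\sum_(x <- undup s) count_mem x s = size s)%N.
Proof. by apply: sum_count_supp => [|x]; rewrite ?undup_uniq // mem_undup. Qed.

Definition mult p x : nat := mup x (p - p.[x]%:P).
Definition fiber p c : seq F := undup (rootseq (p - c%:P)).

Lemma pdeg_subC p c : (0 < pdeg p)%N -> pdeg (p - c%:P) = pdeg p.
Proof.
move=> p0; rewrite /pdeg size_polyDl // size_polyN.
by rewrite (leq_ltn_trans (size_polyC_leq1 _)) // size_pdeg.
Qed.

Lemma lead_coef_subC p c : (0 < pdeg p)%N -> lead_coef (p - c%:P) = lead_coef p.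
Proof.
move=> p0; rewrite lead_coefDl // size_polyN.
by rewrite (leq_ltn_trans (size_polyC_leq1 _)) // size_pdeg.
Qed.

Lemma pdeg_gt0_neq0 p : (0 < pdeg p)%N -> p != 0.
Proof. by apply: contraTneq => ->; rewrite /pdeg size_poly0. Qed.

Lemma subC_neq0 p c : (0 < pdeg p)%N -> p - c%:P != 0.
Proof. by move=> p0; apply: pdeg_gt0_neq0; rewrite pdeg_subC. Qed.

Lemma mem_fiber p c x : (0 < pdeg p)%N -> (x \in fiber p c) = (p.[x] == c).
Proof.
by move=> p0; rewrite mem_undup -root_rootseq ?subC_neq0 // rootE !hornerE subr_eq0.
Qed.

Lemma uniq_fiber p c : uniq (fiber p c).
Proof. exact: undup_uniq. Qed.

Lemma mult_gt0 p x : (0 < pdeg p)%N -> (0 < mult p x)%N.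
Proof.
by move=> p0; rewrite /mult -XsubC_dvd ?subC_neq0 // dvdp_XsubCl rootE !hornerE subrr.
Qed.

Lemma sum_mult p c : (0 < pdeg p)%N -> (\sum_(x <- fiber p c) mult p x = pdeg p)%N.
Proof.
move=> p0; rewrite -(pdeg_subC c p0) -size_rootseq ?subC_neq0 // -sum_count_undup.
rewrite -/(fiber p c) [LHS]big_seq [RHS]big_seq; apply: eq_bigr => x.
by rewrite mem_fiber // => /eqP <-; rewrite /mult mup_rootseq ?subC_neq0.
Qed.

Lemma size_fiber_pdeg p c : (0 < pdeg p)%N -> (size (fiber p c) <= pdeg p)%N.
Proof.
by move=> p0; rewrite -(sum_mult c p0) -sum1_size; apply: leq_sum => x _; apply: mult_gt0.
Qed.

Lemma mup_exp x p e : p != 0 -> mup x (p ^+ e) = (e * mup x p)%N.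
Proof.
move=> p0; elim: e => [|e IHe]; first by rewrite expr0 mupNroot // root1.
by rewrite exprS mupM ?expf_neq0 // IHe mulSn.
Qed.

Lemma mult_factor p x : (0 < pdeg p)%N ->
  exists2 q, q.[x] != 0 & p = p.[x]%:P + ('X - x%:P) ^+ mult p x * q.
Proof.
move=> p0; have [e [q]] := multiplicity_XsubC (p - p.[x]%:P) x.
rewrite subC_neq0 //= => qx pE; exists q => //.
suff <- : e = mult p x by rewrite mulrC -pE addrC subrK.
by rewrite /mult pE mupMr // mup_XsubCX eqxx.
Qed.

Lemma mup_eq p x e q : q.[x] != 0 -> p = ('X - x%:P) ^+ e * q -> mup x p = e.
Proof. by move=> qx ->; rewrite mulrC mupMr // mup_XsubCX eqxx. Qed.

Lemma pdeg_deriv p : pdeg p^`() = (pdeg p).-1.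
Proof.
rewrite /pdeg; case sp : (size p) => [|[|n]] /=.
- by move/eqP: sp; rewrite size_poly_eq0 => /eqP->; rewrite deriv0 size_poly0.
- by have /eqP := sp; move=> /eqP/eq_leq/size1_polyC ->; rewrite derivC size_poly0.
have p0 : p != 0 by rewrite -size_poly_gt0 sp.
apply/eqP; rewrite eqn_leq -ltnS; apply/andP; split.
  by have := lt_size_deriv p0; rewrite sp; case: (size _).
have : (n < size p^`())%N.
  rewrite ltnNge; apply/negP => /leq_sizeP/(_ n (leqnn _))/eqP.
  rewrite coef_deriv mulrn_eq0 /=; apply/negP.
  by have := p0; rewrite -lead_coef_eq0 lead_coefE sp.
by case: (size _).
Qed.

Lemma deriv_neq0 p : (0 < pdeg p)%N -> p^`() != 0.
Proof.
move=> p0; rewrite -size_poly_gt0.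
have : (0 < size p^`())%N.
  rewrite ltnNge; apply/negP => /leq_sizeP/(_ (pdeg p).-1 (leq0n _))/eqP.
  rewrite coef_deriv mulrn_eq0 /= prednK //; apply/negP.
  by rewrite -lead_coefE lead_coef_eq0 pdeg_gt0_neq0.
by [].
Qed.

Lemma mult_deriv p x : (0 < pdeg p)%N -> mult p x = (mup x p^`()).+1.
Proof.
move=> p0; have [q qx pE] := mult_factor x p0; have := mult_gt0 x p0.
move: pE; case: (mult p x) => // e pE _; congr _.+1; apply/esym.
apply: (@mup_eq _ _ _ (q *+ e.+1 + ('X - x%:P) * q^`())).
  by rewrite !hornerE subrr mul0r addr0 hornerMn mulrn_eq0.
rewrite pE derivD derivC add0r derivM deriv_exp derivXsubC mul1r /=.
by rewrite mulrDr mulrnAl mulrnAr exprSr mulrA.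
Qed.

Lemma sum_mult_pred_le p s : (0 < pdeg p)%N -> uniq s ->
  (\sum_(x <- s) (mult p x).-1 <= (pdeg p).-1)%N.
Proof.
move=> p0 us; rewrite -pdeg_deriv -size_rootseq ?deriv_neq0 //.
apply: leq_trans (sum_count_uniq _ us); apply: leq_sum => x _.
by rewrite mult_deriv //= mup_rootseq // deriv_neq0.
Qed.

Lemma sum_mult_pred p s : (0 < pdeg p)%N -> uniq s -> {subset rootseq p^`() <= s} ->
  (\sum_(x <- s) (mult p x).-1 = (pdeg p).-1)%N.
Proof.
move=> p0 us sub; rewrite -pdeg_deriv -size_rootseq ?deriv_neq0 //.
rewrite -(sum_count_supp us sub); apply: eq_bigr => x _.
by rewrite mult_deriv //= mup_rootseq // deriv_neq0.
Qed.

Lemma sum_mult_pred_fiber p c : (0 < pdeg p)%N ->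
  (\sum_(x <- fiber p c) (mult p x).-1 = pdeg p - size (fiber p c))%N.
Proof.
move=> p0; rewrite -(sum_mult c p0) -sum1_size -sumnB; last by move=> x _; apply: mult_gt0.
by apply: eq_bigr => x _; rewrite subn1.
Qed.

Lemma mult_comp p q x : (0 < pdeg p)%N -> (0 < pdeg q)%N ->
  mult (p \Po q) x = (mult p q.[x] * mult q x)%N.
Proof.
move=> p0 q0; have [r rx pE] := mult_factor q.[x] p0.
rewrite {1}/mult horner_comp {1}pE comp_polyD comp_polyC comp_polyM rmorphXn /= comp_polyB comp_polyX comp_polyC.
rewrite addrAC subrr add0r mupMl; last by rewrite rootE horner_comp.
by rewrite mup_exp // subC_neq0.
Qed.

End Multiplicity.

(** * Points over a point of the curve [f(x) = g(y)] *)

Section Fibers.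
Variable F : numClosedFieldType.
Variables (f g A B : {poly F}) (m n : nat).
Hypotheses (m0 : (0 < m)%N) (n0 : (0 < n)%N) (cmn : coprime m n).
Hypotheses (df : pdeg f = m) (dg : pdeg g = n) (dA : pdeg A = n) (dB : pdeg B = m).
Hypothesis eAB : f \Po A = g \Po B.

Let f0 : (0 < pdeg f)%N. Proof. by rewrite df. Qed.
Let g0 : (0 < pdeg g)%N. Proof. by rewrite dg. Qed.
Let A0 : (0 < pdeg A)%N. Proof. by rewrite dA. Qed.
Let B0 : (0 < pdeg B)%N. Proof. by rewrite dB. Qed.

(** For [k = 1] the equation of [ev_relation] is linear in the variable, so the values of [A] and
    [B] determine the point wherever its leading coefficient [d] is nonzero. *)
Lemma birational : exists2 d : {poly F}, d != 0 &
  forall s t, d.[s] != 0 -> A.[s] = A.[t] -> B.[s] = B.[t] -> s = t.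
Proof.
have dA1 : pdeg A = (1 * n)%N by rewrite mul1n.
have dB1 : pdeg B = (1 * m)%N by rewrite mul1n.
have [u [_ u1]] := ev_relation m0 n0 (ltn0Sn 0) cmn dA1 dB1 df dg eAB.
rewrite big_ord_recr big_ord1 /= expr0 mulr1 expr1 => rel.
pose ev := (horner_eval B \o map_poly (comp_poly A)).
have evE' (v : {poly {poly F}}) s t : A.[s] = A.[t] -> B.[s] = B.[t] -> (ev v).[s] = (ev v).[t].
  move=> eA eB; rewrite /ev !evE !horner_sum; apply: eq_bigr => j _.
  by rewrite !hornerM !horner_exp !horner_comp eA eB.
exists (ev (u 1%N)) => // s t ds eA eB.
have r x : (ev (u 0%N)).[x] + (ev (u 1%N)).[x] * x = 0.
  by have := congr1 (fun p => p.[x]) rel; rewrite hornerD hornerM hornerX horner0.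
have := r s; rewrite -(r t) (evE' _ _ _ eA eB) => /addrI; rewrite (evE' _ _ _ eA eB) in ds *.
by move=> /(mulfI ds).
Qed.

(* For fixed [y] both sides are polynomials in [x]: the left one by exchanging
   the roles of the roots of [A - x] and [B - y], as in the symmetry of the resultant. *)
Lemma fiber_product x y :
  \prod_(t <- rootseq (A - x%:P)) (y - B.[t]) = (g.[y] - f.[x]) / lead_coef g.
Proof.
have lA : lead_coef A != 0 by rewrite lead_coef_eq0 pdeg_gt0_neq0.
have lg : lead_coef g != 0 by rewrite lead_coef_eq0 pdeg_gt0_neq0.
have AE z s : A.[s] - z = lead_coef A * \prod_(t <- rootseq (A - z%:P)) (s - t).
  have -> : A.[s] - z = (A - z%:P).[s] by rewrite !hornerE.
  rewrite {1}(rootseqE (A - z%:P)) lead_coef_subC // hornerZ horner_prod.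
  by congr (_ * _); apply: eq_bigr => t _; rewrite hornerXsubC.
have BE s : B.[s] - y = lead_coef B * \prod_(t <- rootseq (B - y%:P)) (s - t).
  have -> : B.[s] - y = (B - y%:P).[s] by rewrite !hornerE.
  rewrite {1}(rootseqE (B - y%:P)) lead_coef_subC // hornerZ horner_prod.
  by congr (_ * _); apply: eq_bigr => t _; rewrite hornerXsubC.
have sA z : size (rootseq (A - z%:P)) = n by rewrite size_rootseq ?subC_neq0 // pdeg_subC.
pose h : {poly F} := ((- lead_coef B) ^+ n)%:P *
  \prod_(s <- rootseq (B - y%:P)) (((-1) ^+ n / lead_coef A)%:P * (A.[s]%:P - 'X)).
have hE z : h.[z] = \prod_(t <- rootseq (A - z%:P)) (y - B.[t]).
  under eq_bigr => t _ do rewrite -opprB BE -mulNr.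
  rewrite big_split /= big_const_seq count_predT sA iter_mulr_1 exchange_big /=.
  rewrite hornerM hornerC horner_prod; congr (_ * _); apply: eq_bigr => s _.
  rewrite !hornerE AE mulrA divfK // -(sA z).
  under eq_bigr => t _ do rewrite -opprB -mulN1r.
  by rewrite big_split /= big_const_seq count_predT iter_mulr_1 signrMK.
have [d d0 dP] := birational.
(* If [z] is not the image of one of these points, the roots of [A - z] are simple and [B] separates
   them, so their images are all the roots of [g - f.[z]]. The factor [b] takes care of the finitely
   many other [z]. *)
pose bad := rootseq A^`() ++ rootseq d.
pose b : {poly F} := \prod_(z <- bad) ('X - (A.[z])%:P).
pose k : {poly F} := (lead_coef g)^-1 *: (g.[y]%:P - f).
suff hk : h - k = 0.
  by rewrite -hE; move/eqP: hk; rewrite subr_eq0 => /eqP ->; rewrite !hornerE mulrC.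
have b0 : b != 0 by rewrite monic_neq0 // monic_prod_XsubC.
apply: (mulfI b0); rewrite mulr0; apply: poly_eq0_everywhere => z.
have [bz|bz] := eqVneq b.[z] 0; first by rewrite hornerM bz mul0r.
rewrite hornerM hornerD hornerN hE; apply/eqP; rewrite mulf_eq0 (negbTE bz) subr_eq0 /=.
have good s : s \in bad -> A.[s] != z.
  move=> sb; apply: contraNneq bz => Asz; rewrite horner_prod (big_rem s) //=.
  by rewrite hornerXsubC Asz subrr mul0r.
set R := rootseq _.
have RE t : t \in R -> A.[t] = z.
  by rewrite -root_rootseq ?subC_neq0 // rootE !hornerE subr_eq0 => /eqP.
have uR : uniq R.
  apply: count_mem_uniq => t; have [tR|/count_memPn //] := boolP (t \in R).
  have := mult_deriv t A0; rewrite /mult RE // mup_rootseq ?subC_neq0 // => ->.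
  rewrite mup_rootseq ?deriv_neq0 //; congr _.+1; apply/count_memPn.
  by apply: contraL (tR) => tA; apply: contraNN (good t _) => [/RE/eqP //|]; rewrite mem_cat tA.
have uBR : uniq (map (horner B) R).
  rewrite map_inj_in_uniq // => s t /RE As /RE At; apply: dP; last by rewrite As.
  apply: contra_eqN (As) => ds; apply: good.
  by rewrite mem_cat -(root_rootseq s d0) rootE ds orbT.
have rg : all (root (g - (f.[z])%:P)) (map (horner B) R).
  apply/allP => _ /mapP[t tR ->]; rewrite rootE !hornerE subr_eq0 -horner_comp -eAB.
  by rewrite horner_comp RE.
have sg : size (g - (f.[z])%:P) = (size (map (horner B) R)).+1.
  by rewrite size_map sA size_pdeg pdeg_subC // dg.
have := all_roots_prod_XsubC sg rg; rewrite uniq_rootsE => /(_ uBR).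
move=> /(congr1 (fun p => p.[y])); rewrite lead_coef_subC // hornerZ horner_prod big_map !hornerE => e.
by rewrite e mulKf //; apply/eqP; apply: eq_bigr => t _; rewrite hornerXsubC.
Qed.

(** For fixed [x], [fiber_product] is an identity of polynomials in [y]; compare the multiplicity of
    one root on both sides. *)
Lemma sum_mult_fiber x y : f.[x] = g.[y] ->
  (\sum_(t <- fiber A x | B.[t] == y) mult A t = mult g y)%N.
Proof.
move=> fxgy; have lg : lead_coef g != 0 by rewrite lead_coef_eq0 pdeg_gt0_neq0.
have P : \prod_(t <- rootseq (A - x%:P)) ('X - (B.[t])%:P) = (lead_coef g)^-1 *: (g - (g.[y])%:P).
  apply/eqP; rewrite -subr_eq0; apply/eqP; apply: poly_eq0_everywhere => z.
  rewrite !hornerE horner_prod -fxgy mulrC -fiber_product; apply/eqP; rewrite subr_eq0; apply/eqP.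
  by apply: eq_bigr => t _; rewrite hornerXsubC.
rewrite /mult -(mupZ y _ (invr_neq0 lg)) -P -(big_map (horner B) predT (fun z => 'X - z%:P)).
rewrite mu_prod_XsubC count_map -big_filter.
rewrite big_seq (eq_bigr (fun t => count_mem t (rootseq (A - x%:P)))); last first.
  move=> t; rewrite mem_filter mem_fiber // => /andP[_ /eqP ->].
  by rewrite mup_rootseq // subC_neq0.
rewrite -big_seq sum_count_mem ?filter_uniq ?uniq_fiber //; apply: eq_in_count => t tR.
by rewrite inE /= mem_filter mem_undup tR andbT.
Qed.

(** Since [mult f x * mult A t = mult g y * mult B t], every term of [sum_mult_fiber] is divisible
    by [mult g y / d], while the sum is [mult g y]. *)
Lemma count_fiber_le x y : f.[x] = g.[y] ->
  (count (fun t => B.[t] == y) (fiber A x) <= gcdn (mult f x) (mult g y))%N.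
Proof.
move=> fxgy; set d := gcdn _ _.
have d0 : (0 < d)%N by rewrite gcdn_gt0 mult_gt0.
have dy : (d %| mult g y)%N by apply: dvdn_gcdr.
rewrite -(leq_pmul2r (m := mult g y %/ d)); last by rewrite divn_gt0 // dvdn_leq ?mult_gt0.
rewrite [X in (_ <= X)%N]mulnC divnK // -{2}(sum_mult_fiber fxgy) -sum1_count big_distrl /=.
rewrite big_seq_cond [X in (_ <= X)%N]big_seq_cond; apply: leq_sum => t.
rewrite mem_fiber // => /andP[/eqP At /eqP Bt]; rewrite mul1n dvdn_leq ?mult_gt0 //.
have := mult_comp t f0 A0; rewrite eAB mult_comp // At Bt => e.
have cop : coprime (mult g y %/ d) (mult f x %/ d).
  rewrite /coprime -(eqn_pmul2r d0) mul1n muln_gcdl !divnK ?dvdn_gcdl //.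
  by rewrite gcdnC.
rewrite -(Gauss_dvdr _ cop) -(dvdn_pmul2r d0) mulnAC !divnK ?dvdn_gcdl //.
by rewrite -e dvdn_mulr.
Qed.

Lemma mult_le_fiber t : (mult A t <= mult g B.[t])%N.
Proof.
have fg : f.[A.[t]] = g.[B.[t]] by rewrite -!horner_comp eAB.
rewrite -(sum_mult_fiber fg) (big_rem t) ?mem_fiber //= eqxx.
by apply: leq_addr.
Qed.

Lemma size_fiber_le x : 
  (size (fiber A x) <= \sum_(y <- fiber g f.[x]) gcdn (mult f x) (mult g y))%N.
Proof.
have -> : size (fiber A x) = (\sum_(y <- fiber g f.[x]) count (fun t => B.[t] == y) (fiber A x))%N.
  rewrite (eq_bigr (fun y => count_mem y (map (horner B) (fiber A x)))) => [|y _]; last first.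
    by rewrite count_map.
  rewrite sum_count_supp ?size_map ?uniq_fiber // => _ /mapP[t + ->].
  by rewrite !mem_fiber // => /eqP <-; rewrite -!horner_comp eAB.
rewrite big_seq [X in (_ <= X)%N]big_seq; apply: leq_sum => y.
by rewrite mem_fiber // => /eqP e; apply: count_fiber_le.
Qed.

End Fibers.

(** * The solutions of [f \Po A = g \Po B] in coprime degrees *)

Section RittSecond.
Variable F : numClosedFieldType.
Implicit Types u p f g A B : {poly F}.

Definition pow_form u (c t : F) : Prop :=
  exists k : F, u = c%:P + k *: ('X - t%:P) ^+ pdeg u.

Definition rotation (t z : F) : {poly F} := t%:P + z *: ('X - t%:P).

Definition equivariant u (t z : F) : Prop :=
  exists l b : F, u \Po rotation t z = l *: u + b%:P.

Definition almost_multiple e p (c : F) : Prop :=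
  forall x y, p.[x] = c -> p.[y] = c ->
  ~~ (e %| mult p x)%N -> ~~ (e %| mult p y)%N -> x = y.

(** Up to linear changes the classical solution is [f = B = z^m], [g = z^r h(z)^m],
    [A = z^r h(z^m)]. Of the last two shapes only the traces that pass to factors are recorded:
    multiplicities of [g] over the critical value, and the rotation symmetry of [A]. *)
Definition power_solution f A g B : Prop :=
  exists c x y t : F,
  [/\ pow_form f c x, almost_multiple (pdeg f) g c, pow_form B y t
    & forall z, z ^+ pdeg f = 1 -> equivariant A t z].

(** As [(pdeg u).-1] is the total ramification, the last inequality says that [c1] and [c2] carry
    all of it. *)
Definition chebyshev_ramified u : Prop :=
  exists c1 c2 : F, [/\ c1 != c2,
    forall x, u.[x] = c1 \/ u.[x] = c2 -> (mult u x <= 2)%N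
  & ((pdeg u).-1 <= (pdeg u - size (fiber u c1)) + (pdeg u - size (fiber u c2)))%N].

Lemma uniq_flatten_fibers p (r : seq F) : (0 < pdeg p)%N -> uniq r ->
  uniq (flatten [seq fiber p c | c <- r]).
Proof.
move=> p0; elim: r => //= c r IHr /andP[cr ur].
rewrite cat_uniq uniq_fiber IHr // andbT /=; apply/hasPn => x /flatten_mapP[d dr].
rewrite !mem_fiber // => /eqP xd; apply: contraNneq cr => xc.
by rewrite -xc xd.
Qed.

Lemma sum_fiber_defects p (r : seq F) : (0 < pdeg p)%N ->
  (\sum_(c <- r) (pdeg p - size (fiber p c)) =
   \sum_(x <- flatten [seq fiber p c | c <- r]) (mult p x).-1)%N.
Proof.
move=> p0; rewrite big_flatten big_map; apply: eq_bigr => c _.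
by rewrite sum_mult_pred_fiber.
Qed.

Lemma sum_fiber_defects_le p (r : seq F) : (0 < pdeg p)%N -> uniq r ->
  (\sum_(c <- r) (pdeg p - size (fiber p c)) <= (pdeg p).-1)%N.
Proof.
by move=> p0 ur; rewrite sum_fiber_defects // sum_mult_pred_le ?uniq_flatten_fibers.
Qed.

Lemma sum_fiber_defects_eq p (r : seq F) : (0 < pdeg p)%N -> uniq r ->
  (forall x, x \in rootseq p^`() -> p.[x] \in r) ->
  (\sum_(c <- r) (pdeg p - size (fiber p c)) = (pdeg p).-1)%N.
Proof.
move=> p0 ur sub; rewrite sum_fiber_defects // sum_mult_pred ?uniq_flatten_fibers // => x xr.
by apply/flatten_mapP; exists p.[x]; rewrite ?sub // mem_fiber.
Qed.

Lemma fiber_neq0 p c : (0 < pdeg p)%N -> exists x, p.[x] = c.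
Proof.
move=> p0; have := sum_mult c p0; case E : (fiber p c) => [|x s].
  by rewrite big_nil => e; rewrite -e in p0.
by exists x; apply/eqP; rewrite -mem_fiber // E inE eqxx.
Qed.

Lemma pow_form_of_fiber p c x : (0 < pdeg p)%N -> (size (fiber p c) <= 1)%N -> p.[x] = c ->
  pow_form p c x.
Proof.
move=> p0 s1 px; exists (lead_coef p).
have nz := subC_neq0 c p0.
have fx : fiber p c = [:: x].
  have : x \in fiber p c by rewrite mem_fiber // px.
  by case: (fiber p c) s1 => [|y []] //= _; rewrite inE => /eqP->.
have -> : ('X - x%:P) ^+ pdeg p = \prod_(z <- rootseq (p - c%:P)) ('X - z%:P).
  rewrite -(pdeg_subC c p0) -size_rootseq // -(count_predT (rootseq _)) -iter_mulr_1 -big_const_seq.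
  rewrite big_seq [RHS]big_seq; apply: eq_bigr => z.
  by rewrite -mem_undup -/(fiber p c) fx inE => /eqP->.
by rewrite -(lead_coef_subC c p0) -rootseqE addrC subrK.
Qed.

Lemma pow_formE p c x y : (0 < pdeg p)%N -> pow_form p c x -> (p.[y] == c) = (y == x).
Proof.
move=> p0 [k pE]; rewrite pE !hornerE.
have k0 : k != 0.
  by apply: contraTneq p0 => k0; rewrite pE k0 scale0r addr0 /pdeg size_polyC; case: (c == 0).
by rewrite -subr_eq0 addrAC subrr add0r mulf_eq0 (negbTE k0) expf_eq0 p0 subr_eq0.
Qed.

Lemma fiber_pow_form p c x : (0 < pdeg p)%N -> pow_form p c x -> fiber p c = [:: x].
Proof.
move=> p0 px; have := uniq_fiber p c.
have mem y : (y \in fiber p c) = (y == x) by rewrite mem_fiber // (pow_formE _ _ px).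
case: (fiber p c) mem => [|a [|b s]] mem //=.
- by have := mem x; rewrite eqxx.
- by move=> _; have := mem a; rewrite !inE eqxx => /esym/eqP->.
have := mem a; have := mem b; rewrite !inE !eqxx orbT => /esym/eqP-> /esym/eqP->.
by rewrite eqxx.
Qed.

Lemma mult_pow_form p c x : (0 < pdeg p)%N -> pow_form p c x -> mult p x = pdeg p.
Proof. by move=> p0 px; have := sum_mult c p0; rewrite (fiber_pow_form p0 px) big_seq1. Qed.

Lemma XsubC_rotation t z : ('X - t%:P) \Po rotation t z = z *: ('X - t%:P).
Proof. by rewrite comp_polyB comp_polyX comp_polyC /rotation addrC addKr. Qed.

Lemma pow_form_rotation p c t z : pow_form p c t ->
  p \Po rotation t z = c%:P + z ^+ pdeg p *: (p - c%:P).
Proof.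
move=> [k pE].
have e : p - c%:P = k *: ('X - t%:P) ^+ pdeg p by rewrite [X in X - _]pE addrAC subrr add0r.
rewrite e [in LHS]pE comp_polyD comp_polyC comp_polyZ rmorphXn /= XsubC_rotation.
by rewrite exprZn !scalerA mulrC.
Qed.

Lemma size_rotation t z : z != 0 -> size (rotation t z) = 2%N.
Proof.
move=> z0; rewrite /rotation addrC size_polyDl size_scale // size_XsubC //.
by rewrite (leq_ltn_trans (size_polyC_leq1 _)).
Qed.

Section Coprime.
Variables (f g A B : {poly F}) (m n : nat).
Hypotheses (m0 : (0 < m)%N) (n0 : (0 < n)%N) (cmn : coprime m n).
Hypotheses (df : pdeg f = m) (dg : pdeg g = n) (dA : pdeg A = n) (dB : pdeg B = m).
Hypothesis eAB : f \Po A = g \Po B.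

Let f0 : (0 < pdeg f)%N. Proof. by rewrite df. Qed.
Let g0 : (0 < pdeg g)%N. Proof. by rewrite dg. Qed.
Let A0 : (0 < pdeg A)%N. Proof. by rewrite dA. Qed.
Let B0 : (0 < pdeg B)%N. Proof. by rewrite dB. Qed.
Let cnm : coprime n m. Proof. by rewrite coprime_sym. Qed.

Lemma pow_form_solution c x : pow_form f c x -> power_solution f A g B.
Proof.
move=> px.
have fibB y : g.[y] = c -> (size (fiber B y) <= gcdn (mult g y) m)%N.
  move=> gy; have := size_fiber_le n0 m0 cnm dg df dB dA (esym eAB) y.
  by rewrite gy (fiber_pow_form f0 px) big_seq1 (mult_pow_form f0 px) df.
have almost : almost_multiple m g c.
  (* Each exceptional point at least halves the fiber of [B] over it, so two of them would give [B]
     ramification at least [m]. *)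
  move=> y y' gy gy' my my'; apply/eqP; apply: contraT => yy'.
  have half a : ~~ (m %| a)%N -> (2 * gcdn a m <= m)%N.
    move=> ma; have /dvdnP[k mE] := dvdn_gcdr a m.
    case: k mE => [|[|k]] mE; first by move: m0; rewrite mE.
      by case/negP: ma; rewrite mE mul1n dvdn_gcdl.
    by rewrite {2}mE leq_mul2r orbT.
  have := sum_fiber_defects_le (r := [:: y; y']) B0.
  rewrite /= inE yy' => /(_ isT); rewrite big_cons big_seq1 dB.
  have := fibB y gy; have := fibB y' gy'; have := half _ my; have := half _ my'.
  move: (size _) (size _) (gcdn _ _) (gcdn _ _) => a b d e; lia.
(* An exceptional [y] has multiplicity congruent to [n] modulo [m], hence prime to [m], and [B] has
   a single preimage of it. Without exceptions [m] divides [n], so [m = 1]. *)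
have [y0 gy0 fy0] : exists2 y0, g.[y0] = c & (size (fiber B y0) <= 1)%N.
  have [/hasP[y yf my]|/hasPn all] := boolP (has (fun y => ~~ (m %| mult g y)%N) (fiber g c)).
    rewrite mem_fiber // in yf; exists y; first exact/eqP.
    rewrite (leq_trans (fibB y (eqP yf))) //.
    have : (m %| n - mult g y)%N.
      rewrite -dg -(sum_mult c g0) (big_rem y) ?mem_fiber //= addKn.
      rewrite big_seq; apply: dvdn_sum => w wr.
      have wf := mem_rem wr; rewrite mem_fiber // in wf.
      apply: contraT => mw; have := almost _ _ (eqP wf) (eqP yf) mw my => wy.
      by rewrite wy mem_rem_uniqF ?uniq_fiber // in wr.
    have yn : (mult g y <= n)%N by rewrite -dg -(sum_mult c g0) (big_rem y) ?mem_fiber //= leq_addr.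
    move=> /dvdnP[k kE].
    have nE : n = (k * m + mult g y)%N by rewrite -kE subnK.
    by move: cmn; rewrite /coprime nE gcdnMDl gcdnC => /eqP->.
  have m1 : m = 1%N.
    have : (m %| gcdn m n)%N.
      rewrite dvdn_gcd dvdnn -dg -(sum_mult c g0) big_seq; apply: dvdn_sum => w /all.
      by rewrite negbK.
    by rewrite (eqP cmn) dvdn1 => /eqP.
  have [y gy] := fiber_neq0 c g0; exists y => //.
  by rewrite (leq_trans (fibB y gy)) // m1 gcdn1.
have [t Bt] := fiber_neq0 y0 B0.
have pB := pow_form_of_fiber B0 fy0 Bt.
exists c, x, y0, t; split=> //; first by rewrite df.
rewrite df => z zm.
have z0 : z != 0 by apply: contraTneq m0 => z0; rewrite z0 in zm; case: (m) zm => // k; rewrite expr0n /= => /eqP; rewrite eq_sym oner_eq0.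
have BR : B \Po rotation t z = B.
  by rewrite (pow_form_rotation z pB) dB zm scale1r addrC subrK.
have [k fE] := px; rewrite df in fE.
have k0 : k != 0.
  by apply: contraTneq f0 => k0; rewrite fE k0 scale0r addr0 /pdeg size_polyC; case: (c == 0).
set R := rotation t z in BR *.
have fAR : f \Po (A \Po R) = f \Po A by rewrite comp_polyA eAB -comp_polyA BR.
have fcomp p : f \Po p = c%:P + k *: (p - x%:P) ^+ m.
  by rewrite fE comp_polyD comp_polyC comp_polyZ rmorphXn /= comp_polyB comp_polyX comp_polyC.
(* [B] is invariant under [R], hence so is the [m]-th power of [A - x]; therefore [R] multiplies
   [A - x] by an [m]-th root of unity [w]. *)
have pw : ((A \Po R) - x%:P) ^+ m = (A - x%:P) ^+ m.
  by move: fAR; rewrite !fcomp => /addrI/(scalerI k0).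
have dAR : pdeg (A \Po R) = n by rewrite pdeg_comp /pdeg size_rotation // muln1 -/(pdeg A).
have AR0 : (0 < pdeg (A \Po R))%N by rewrite dAR.
pose w := lead_coef (A \Po R) / lead_coef A.
have lA : lead_coef A != 0 by rewrite lead_coef_eq0 pdeg_gt0_neq0.
have lAR : lead_coef (A \Po R) != 0 by rewrite lead_coef_eq0 pdeg_gt0_neq0.
have w0 : w != 0 by rewrite mulf_neq0 ?invr_neq0.
have wm : w ^+ m = 1.
  have := congr1 lead_coef pw; rewrite !lead_coef_exp !lead_coef_subC // => e.
  by rewrite expr_div_n e divff // expf_neq0.
exists w, (x - w * x).
have : (A \Po R) - x%:P = w *: (A - x%:P).
  apply: (@eq_of_close_powers _ _ _ n m.-1).
  - by rewrite size_pdeg pdeg_subC // dAR.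
  - by rewrite size_scale // size_pdeg pdeg_subC // dA.
  - by rewrite lead_coefZ !lead_coef_subC // /w divfK.
  by rewrite prednK // exprZn wm scale1r pw subrr size_poly0.
move/eqP; rewrite subr_eq => /eqP->; rewrite scalerBr polyCB polyCM mul_polyC.
by rewrite -addrA [- _ + _]addrC.
Qed.

End Coprime.
End RittSecond.

Section Profiles.
Variable F : numClosedFieldType.
Variables (f g A B : {poly F}) (m n : nat).
Hypotheses (m0 : (0 < m)%N) (n0 : (0 < n)%N) (cmn : coprime m n).
Hypotheses (df : pdeg f = m) (dg : pdeg g = n) (dA : pdeg A = n) (dB : pdeg B = m).
Hypothesis eAB : f \Po A = g \Po B.

Let f0 : (0 < pdeg f)%N. Proof. by rewrite df. Qed.
Let g0 : (0 < pdeg g)%N. Proof. by rewrite dg. Qed.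
Let A0 : (0 < pdeg A)%N. Proof. by rewrite dA. Qed.
Let B0 : (0 < pdeg B)%N. Proof. by rewrite dB. Qed.
Let cnm : coprime n m. Proof. by rewrite coprime_sym. Qed.

Lemma profile_fibers (p : {poly F}) r : (0 < pdeg p)%N -> uniq r ->
  (forall x, x \in rootseq p^`() -> p.[x] \in r) ->
  profile r (pdeg p) (fun c => map (mult p) (fiber p c)).
Proof.
move=> p0 ur sub; split=> [c _|c _|].
- by apply/allP => _ /mapP[x _ ->]; apply: mult_gt0.
- by rewrite sumnE big_map sum_mult.
by rewrite -(sum_fiber_defects_eq p0 ur sub); apply: eq_bigr => c _; rewrite size_map.
Qed.

Lemma size_fiber_comp_le c : (size (fiber (f \Po A) c) <=
  gcds (map (mult f) (fiber f c)) (map (mult g) (fiber g c)))%N.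
Proof.
have V0 : (0 < pdeg (f \Po A))%N by rewrite pdeg_comp muln_gt0 f0.
have sub : {subset fiber (f \Po A) c <= flatten [seq fiber A x | x <- fiber f c]}.
  move=> t; rewrite mem_fiber // horner_comp => ft; apply/flatten_mapP.
  by exists A.[t]; rewrite mem_fiber.
apply: leq_trans (uniq_leq_size (uniq_fiber _ _) sub) _.
rewrite size_flatten /shape -map_comp sumnE /gcds !big_map.
rewrite big_seq [X in (_ <= X)%N]big_seq; apply: leq_sum => x.
rewrite mem_fiber // => /eqP <-; rewrite big_map.
exact: (size_fiber_le m0 n0 cmn df dg dA dB eAB).
Qed.

Lemma fiber_genus r : uniq r ->
  (\sum_(c <- r) (m * n - gcds (map (mult f) (fiber f c)) (map (mult g) (fiber g c)))
    <= (m * n).-1)%N.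
Proof.
move=> ur; have dV : pdeg (f \Po A) = (m * n)%N by rewrite pdeg_comp df dA.
have V0 : (0 < pdeg (f \Po A))%N by rewrite dV muln_gt0 m0.
rewrite -dV; apply: leq_trans (sum_fiber_defects_le V0 ur); apply: leq_sum => c _.
by rewrite leq_sub2l // size_fiber_comp_le.
Qed.

(** The two special values for [A] are the simple points of [f] over [c1] and [c2], over which [A]
    has no more preimages than [g] has over [c1] and [c2]. Those for [B] are the two simple points
    of [g], possibly lying over one value. *)
Lemma chebyshev_solution r :
  chebyshev_profile r (fun c => map (mult f) (fiber f c)) (fun c => map (mult g) (fiber g c)) ->
  [/\ chebyshev_ramified f, chebyshev_ramified g, chebyshev_ramified A & chebyshev_ramified B].
Proof.
move=> [c1 [c2 [_ _ c12 [f1 f2 g1 g2] [uf1 uf2 ug]]]].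
have le2 (p : {poly F}) c x : all (geq 2) (map (mult p) (fiber p c)) -> (0 < pdeg p)%N ->
    p.[x] = c -> (mult p x <= 2)%N.
  by move=> /allP al p0 px; apply: al; apply: map_f; rewrite mem_fiber // px.
have cnt (p : {poly F}) c : (0 < pdeg p)%N -> all (geq 2) (map (mult p) (fiber p c)) ->
    (pdeg p + count_mem 1%N (map (mult p) (fiber p c)) = 2 * size (fiber p c))%N.
  move=> p0 al; have := count1_le2 _ al; rewrite size_map sumnE big_map sum_mult // => <- //.
  by apply/allP => _ /mapP[x _ ->]; apply: mult_gt0.
have sf1 := cnt f c1 f0 f1; have sf2 := cnt f c2 f0 f2; rewrite uf1 df in sf1; rewrite uf2 df in sf2.
have sg1 := cnt g c1 g0 g1; have sg2 := cnt g c2 g0 g2; rewrite dg in sg1 sg2.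
have simple c : count_mem 1%N (map (mult f) (fiber f c)) = 1%N -> exists2 x, f.[x] = c & mult f x = 1%N.
  move=> e; have : has (pred1 1%N) (map (mult f) (fiber f c)) by rewrite has_count e.
  by move=> /hasP[_ /mapP[x xf ->] /eqP]; rewrite mem_fiber // in xf; exists x => //; apply/eqP.
have [x1 fx1 mx1] := simple c1 uf1; have [x2 fx2 mx2] := simple c2 uf2.
have [y1 [y2 [y12 gy1 gy2 my1 my2]]] : exists y1 y2, [/\ y1 != y2, g.[y1] = c1 \/ g.[y1] = c2,
    g.[y2] = c1 \/ g.[y2] = c2, mult g y1 = 1%N & mult g y2 = 1%N].
  pose L := [seq y <- fiber g c1 ++ fiber g c2 | mult g y == 1%N].
  have uL : uniq L.
    rewrite filter_uniq // cat_uniq !uniq_fiber andbT /=; apply/hasPn => y /=.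
    by rewrite !mem_fiber // => /eqP->; rewrite eq_sym.
  have sL : size L = 2%N by rewrite size_filter count_cat -ug !count_map.
  have memL y : y \in L -> (g.[y] = c1 \/ g.[y] = c2) /\ mult g y = 1%N.
    rewrite mem_filter mem_cat !mem_fiber // => /andP[/eqP-> /orP[]/eqP]; first by split=> //; left.
    by split=> //; right.
  case: L uL sL memL => [|y1 [|y2 []]] //= /andP[+ _] _ memL; rewrite inE => y12.
  have [h1 e1] := memL y1 (mem_head _ _); have [|h2 e2] := memL y2; first by rewrite !inE eqxx orbT.
  by exists y1, y2.
have bnd_f : (forall x, f.[x] = c1 \/ f.[x] = c2 -> mult f x <= 2)%N.
  by move=> x [] e; [apply: le2 f1 f0 e | apply: le2 f2 f0 e].
have bnd_g : (forall y, g.[y] = c1 \/ g.[y] = c2 -> mult g y <= 2)%N.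
  by move=> y [] e; [apply: le2 g1 g0 e | apply: le2 g2 g0 e].
have eFG t : f.[A.[t]] = g.[B.[t]] by rewrite -!horner_comp eAB.
split.
- by exists c1, c2; split=> //; rewrite df; lia.
- by exists c1, c2; split=> //; rewrite dg; lia.
- exists x1, x2; split.
  + by apply: contraNneq c12 => e; rewrite -fx1 e fx2.
  + move=> t At; apply: leq_trans (mult_le_fiber m0 n0 cmn df dg dA dB eAB t) _.
    by apply: bnd_g; rewrite -eFG; case: At => ->; [left|right].
  have := size_fiber_le m0 n0 cmn df dg dA dB eAB x1.
  have := size_fiber_le m0 n0 cmn df dg dA dB eAB x2.
  rewrite mx1 mx2 fx1 fx2.
  under eq_bigr do rewrite gcd1n; under [X in _ -> (_ <= X)%N -> _]eq_bigr do rewrite gcd1n.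
  by rewrite !sum1_size dA; lia.
exists y1, y2; split=> //.
  move=> t Bt; apply: leq_trans (mult_le_fiber n0 m0 cnm dg df dB dA (esym eAB) t) _.
  by apply: bnd_f; rewrite eFG; case: Bt => ->.
have H y : g.[y] = c1 \/ g.[y] = c2 -> mult g y = 1%N -> (2 * size (fiber B y) <= m + 1)%N.
  move=> gy my; have := size_fiber_le n0 m0 cnm dg df dB dA (esym eAB) y; rewrite my.
  under eq_bigr do rewrite gcd1n.
  by rewrite sum1_size; case: gy => ->; lia.
by have := H y1 gy1 my1; have := H y2 gy2 my2; rewrite dB; lia.
Qed.

End Profiles.

Theorem ritt_second (F : numClosedFieldType) (f g A B : {poly F}) :
  (0 < pdeg f)%N -> (0 < pdeg g)%N -> coprime (pdeg f) (pdeg g) ->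
  pdeg A = pdeg g -> pdeg B = pdeg f -> f \Po A = g \Po B ->
  [\/ power_solution f A g B, power_solution g B f A
    | [/\ chebyshev_ramified f, chebyshev_ramified g, chebyshev_ramified A
        & chebyshev_ramified B]].
Proof.
move=> f0 g0 cfg dA dB e.
have cgf : coprime (pdeg g) (pdeg f) by rewrite coprime_sym.
have powf c x : (size (fiber f c) <= 1)%N -> f.[x] = c -> power_solution f A g B.
  by move=> s1 fx; apply: (pow_form_solution f0 g0 cfg erefl erefl dA dB e (pow_form_of_fiber f0 s1 fx)).
have powg c y : (size (fiber g c) <= 1)%N -> g.[y] = c -> power_solution g B f A.
  by move=> s1 gy; apply: (pow_form_solution g0 f0 cgf erefl erefl dB dA (esym e) (pow_form_of_fiber g0 s1 gy)).
have [f1|f1] := eqVneq (pdeg f) 1%N.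
  by apply: Or31; apply: (powf f.[0] 0) => //; rewrite -f1 size_fiber_pdeg.
have [g1|g1] := eqVneq (pdeg g) 1%N.
  by apply: Or32; apply: (powg g.[0] 0) => //; rewrite -g1 size_fiber_pdeg.
pose r := undup (map (horner f) (rootseq f^`()) ++ map (horner g) (rootseq g^`())).
have ur : uniq r by apply: undup_uniq.
have pf := @profile_fibers _ f r f0 ur; have pg := @profile_fibers _ g r g0 ur.
have {}pf : profile r (pdeg f) (fun c => map (mult f) (fiber f c)).
  by apply: pf => x xr; rewrite mem_undup mem_cat map_f.
have {}pg : profile r (pdeg g) (fun c => map (mult g) (fiber g c)).
  by apply: pg => x xr; rewrite mem_undup mem_cat map_f ?orbT.
have genus := fiber_genus f0 g0 cfg erefl erefl dA dB e ur.
have [||[c _]|[c _]|ch|ch] := ritt_profiles ur _ _ cfg pf pg genus; try lia.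
- rewrite size_map => s1; have [x fx] := fiber_neq0 c f0.
  by apply: Or31; apply: (powf c x) => //; rewrite s1.
- rewrite size_map => s1; have [y gy] := fiber_neq0 c g0.
  by apply: Or32; apply: (powg c y) => //; rewrite s1.
- by apply: Or33; apply: (chebyshev_solution f0 g0 cfg erefl erefl dA dB e ch).
apply: Or33.
by have [] := chebyshev_solution g0 f0 cgf erefl erefl dB dA (esym e) ch.
Qed.

(** * Chebyshev polynomials *)

Section Chebyshev.
Variable F : numClosedFieldType.
Implicit Types u v p q f g A B : {poly F}.

(* For [v = T_d] this says [(z^2 - 1) T_d'^2 = d^2 (T_d^2 - 1)]; it determines [v]
   up to sign and bounds its multiplicities, so Chebyshev polynomials are only
   made explicit at the very end. *)
Definition pell v : Prop :=
  ('X^2 - 1) * v^`() ^+ 2 = ((pdeg v)%:R ^+ 2) *: (v ^+ 2 - 1).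

Definition chebyshev_like u : Prop :=
  exists mu nu v : {poly F}, [/\ size mu = 2%N, size nu = 2%N, u = mu \Po (v \Po nu) & pell v].

Definition special u : Prop := (exists c t, pow_form u c t) \/ chebyshev_like u.

Definition affine (a b : F) : {poly F} := a *: 'X + b%:P.

Lemma size_affine a b : a != 0 -> size (affine a b) = 2%N.
Proof.
move=> a0; rewrite /affine size_polyDl size_scale // size_polyX //.
by rewrite (leq_ltn_trans (size_polyC_leq1 _)).
Qed.

Lemma affineP p : size p = 2%N -> exists a b, a != 0 /\ p = affine a b.
Proof.
move=> sp; exists p`_1, p`_0; split.
  by have := lead_coef_eq0 p; rewrite lead_coefE sp => ->; rewrite -size_poly_gt0 sp.
apply/polyP => i; rewrite coefD coefZ coefX coefC.
case: i => [|[|i]] /=; rewrite ?mulr0 ?mulr1 ?addr0 ?add0r //.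
by rewrite nth_default // sp.
Qed.

Lemma affine_comp a b p : affine a b \Po p = a *: p + b%:P.
Proof. by rewrite /affine comp_polyD comp_polyZ comp_polyX comp_polyC. Qed.

Lemma affine_inv a b : a != 0 -> affine a b \Po affine a^-1 (- b / a) = 'X.
Proof.
move=> a0; rewrite affine_comp /affine scalerDr scalerA divff // scale1r -mul_polyC -polyCM.
by rewrite mulrC divfK // -addrA -polyCD addNr addr0.
Qed.

Lemma affine_invr a b : a != 0 -> affine a^-1 (- b / a) \Po affine a b = 'X.
Proof.
move=> a0; rewrite affine_comp /affine scalerDr scalerA mulVf // scale1r -mul_polyC -polyCM.
by rewrite -addrA -polyCD mulNr [b / a]mulrC subrr addr0.
Qed.

Lemma linear_inverse p : size p = 2%N ->
  exists q : {poly F}, [/\ size q = 2%N, p \Po q = 'X & q \Po p = 'X].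
Proof.
move=> /affineP[a [b [a0 ->]]]; exists (affine a^-1 (- b / a)).
by rewrite size_affine ?invr_eq0 // affine_inv // affine_invr.
Qed.

Lemma pdeg_linear p : size p = 2%N -> pdeg p = 1%N.
Proof. by rewrite /pdeg => ->. Qed.

Lemma size_linear p : pdeg p = 1%N -> size p = 2%N.
Proof. by move=> d; rewrite size_pdeg d. Qed.

Lemma size_comp_linear p q : size p = 2%N -> size q = 2%N -> size (p \Po q) = 2%N.
Proof. by move=> sp sq; rewrite size_comp_poly2. Qed.

(** [D] consists of [pdeg u - 1] double points, hence of all the roots of the derivative, each of
    them simple; the two other points [a], [b] of the fibers are simple. Both sides then have the
    same roots and leading coefficient. *)
Lemma chebyshev_product u : (0 < pdeg u)%N -> chebyshev_ramified u ->
  exists c1 c2 a b, [/\ c1 != c2, a != b &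
    ('X - a%:P) * ('X - b%:P) * u^`() ^+ 2 =
    ((pdeg u)%:R ^+ 2) *: ((u - c1%:P) * (u - c2%:P))].
Proof.
move=> u0 [c1 [c2 [c12 le2 def]]].
pose W := fiber u c1 ++ fiber u c2.
have uW : uniq W.
  rewrite cat_uniq !uniq_fiber andbT /=; apply/hasPn => y /=.
  by rewrite !mem_fiber // => /eqP->; rewrite eq_sym.
have memW x : x \in W -> (mult u x <= 2)%N.
  by rewrite mem_cat !mem_fiber // => /orP[]/eqP h; apply: le2; [left|right].
pose S := [seq x <- W | mult u x == 1%N]; pose D := [seq x <- W | mult u x != 1%N].
have multD x : x \in D -> mult u x = 2%N.
  rewrite mem_filter => /andP[x1 /memW x2]; have := mult_gt0 x u0.
  by case: (mult u x) x1 x2 => [|[|[]]].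
have sW : (\sum_(x <- W) mult u x = 2 * pdeg u)%N by rewrite big_cat /= !sum_mult // mul2n addnn.
have sSD : (size S + size D = size W)%N by rewrite !size_filter count_predC.
have sSD2 : (size S + 2 * size D = 2 * pdeg u)%N.
  rewrite -[RHS]sW (bigID (fun x => mult u x == 1%N)) /=; congr (_ + _)%N; rewrite -big_filter.
    by rewrite (eq_big_seq (fun _ => 1%N)) ?sum1_size // => x; rewrite mem_filter => /andP[/eqP].
  rewrite (eq_big_seq (fun _ => 2%N)) => [|x /multD //].
  by rewrite big_const_seq count_predT iter_addn_0.
have sWE : size W = (size (fiber u c1) + size (fiber u c2))%N by rewrite size_cat.
have sf1 := size_fiber_pdeg c1 u0; have sf2 := size_fiber_pdeg c2 u0.
have u'0 := deriv_neq0 u0.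
have sD : size D = (pdeg u).-1.
  apply/eqP; rewrite eqn_leq; apply/andP; split; last by move: sSD sSD2 sWE def sf1 sf2; lia.
  have := sum_mult_pred_le u0 (filter_uniq _ uW : uniq D).
  rewrite (eq_big_seq (fun _ => 1%N)) => [|x /multD -> //].
  by rewrite sum1_size.
have sS : size S = 2%N by lia.
have uS : uniq S by rewrite filter_uniq.
have uD : uniq D by rewrite filter_uniq.
have [a [b SE]] : exists a b, S = [:: a; b] by case: (S) sS => [|a [|b []]] // _; exists a, b.
have ab : a != b by move: uS; rewrite SE /= inE andbT.
exists c1, c2, a, b; split=> //.
have lu' : lead_coef u^`() = (pdeg u)%:R * lead_coef u.
  rewrite !lead_coefE coef_deriv -/(pdeg u) -/(pdeg u^`()) pdeg_deriv prednK //.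
  by rewrite mulr_natl.
have rD : all (root u^`()) D.
  apply/allP => x /multD; rewrite mult_deriv // => -[m1].
  by rewrite -dvdp_XsubCl XsubC_dvd // m1.
have sD' : size u^`() = (size D).+1 by rewrite size_neq0 // pdeg_deriv sD.
have u'E : u^`() = ((pdeg u)%:R * lead_coef u) *: \prod_(x <- D) ('X - x%:P).
  by rewrite -lu'; apply: all_roots_prod_XsubC => //; rewrite uniq_rootsE.
have fibE c : u - c%:P = lead_coef u *: \prod_(x <- fiber u c) ('X - x%:P) ^+ mult u x.
  rewrite {1}(rootseqE (u - c%:P)) lead_coef_subC // -prodr_undup_exp_count -/(fiber u c).
  congr (_ *: _); apply: eq_big_seq => x; rewrite mem_fiber // => /eqP e.
  by rewrite /mult e mup_rootseq // subC_neq0.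
rewrite !fibE -scalerAl -scalerAr -big_cat /= -/W (bigID (fun x => mult u x == 1%N)) /=.
have -> : \prod_(x <- W | mult u x == 1%N) ('X - x%:P) ^+ mult u x = ('X - a%:P) * ('X - b%:P).
  rewrite -big_filter -/S (eq_big_seq (fun x => 'X - x%:P)) => [|x].
    by rewrite SE big_cons big_seq1.
  by rewrite mem_filter => /andP[/eqP->].
have -> : \prod_(x <- W | mult u x != 1%N) ('X - x%:P) ^+ mult u x = \prod_(x <- D) ('X - x%:P) ^+ 2.
  by rewrite -big_filter -/D; apply: eq_big_seq => x /multD->.
rewrite prodrXl u'E exprZn -scalerAr !scalerA; congr (_ *: _).
by rewrite exprMn -mulrA.
Qed.

Lemma deriv_affine a b : (affine a b)^`() = a%:P.
Proof. by rewrite /affine derivD derivZ derivX derivC addr0 alg_polyC. Qed.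

Lemma chebyshev_like_of_ramified u : (0 < pdeg u)%N -> chebyshev_ramified u -> chebyshev_like u.
Proof.
move=> u0 /(chebyshev_product u0)[c1 [c2 [a [b [c12 ab E]]]]].
have two0 : 2%:R != 0 :> F by rewrite pnatr_eq0.
have cc0 : c1 - c2 != 0 by rewrite subr_eq0.
(* The affine map with coefficients [s], [s'] sends [c1], [c2] to [1], [-1]; the one with [d], [d']
   sends [1], [-1] to [a], [b]. *)
pose s := 2%:R / (c1 - c2); pose s' := - (c1 + c2) / (c1 - c2).
have s0 : s != 0 by rewrite mulf_neq0 ?invr_eq0.
pose d := (a - b) / 2%:R; pose d' := (a + b) / 2%:R.
have d0 : d != 0 by rewrite mulf_neq0 ?invr_eq0 // subr_eq0.
pose v := affine s s' \Po (u \Po affine d d').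
have dv : pdeg v = pdeg u.
  by rewrite !pdeg_comp !(pdeg_linear (size_affine _ _)) // mul1n muln1.
exists (affine s^-1 (- s' / s)), (affine d^-1 (- d' / d)), v; split.
- by rewrite size_affine ?invr_eq0.
- by rewrite size_affine ?invr_eq0.
- rewrite /v -!comp_polyA affine_inv // comp_polyXr comp_polyA affine_invr //.
  by rewrite comp_polyX.
rewrite /pell dv.
have v' : v^`() = (s * d)%:P * (u^`() \Po affine d d').
  rewrite /v affine_comp derivD derivC addr0 derivZ deriv_comp deriv_affine.
  by rewrite -mul_polyC [(s * d)%:P]polyCM; ring.
have aE : a%:P = d%:P + d'%:P :> {poly F} by rewrite -polyCD; congr _%:P; rewrite /d /d'; field.
have bE : b%:P = d'%:P - d%:P :> {poly F} by rewrite -polyCB; congr _%:P; rewrite /d /d'; field.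
have X2 : d%:P ^+ 2 * ('X^2 - 1) = (('X - a%:P) * ('X - b%:P)) \Po affine d d'.
  rewrite comp_polyM !comp_polyB !comp_polyX !comp_polyC /affine aE bE -mul_polyC.
  by ring.
have v2 : v ^+ 2 - 1 = s%:P ^+ 2 * (((u - c1%:P) * (u - c2%:P)) \Po affine d d').
  rewrite /v affine_comp comp_polyM !comp_polyB !comp_polyC -mul_polyC.
  have -> : s'%:P = 1 - s%:P * c1%:P by rewrite -polyCM -polyCB; congr _%:P; rewrite /s /s'; field.
  have -> : c2%:P = c1%:P - (2%:R / s)%:P.
    by rewrite -polyCB; congr _%:P; rewrite /s; field; rewrite cc0.
  have : s%:P * (2%:R / s)%:P = 2%:R by rewrite -polyCM mulrC divfK // rmorph_nat.
  move: (2%:R / s)%:P => z sz; set w := u \Po _.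
  ring: sz.
rewrite v' v2 -mul_polyC.
have := congr1 (fun p => p \Po affine d d') E.
rewrite /= comp_polyM -X2 rmorphXn /= comp_polyZ -mul_polyC => E'.
rewrite [RHS]mulrCA -E' [(s * d)%:P]polyCM.
by move: (u^`() \Po _) => w; ring.
Qed.

End Chebyshev.

(** * Chebyshev polynomials from their differential equation *)

Section ChebyshevPolynomials.
Variable F : numClosedFieldType.
Implicit Types u v w p q : {poly F}.

Definition chebyshev_ode (d : nat) w : Prop :=
  ('X^2 - 1) * w^`()^`() + 'X * w^`() = (d%:R ^+ 2)%:P * w.

(** With [k = pdeg w], the coefficients of degree [k] give [k * (k - 1) + k = d ^ 2]. *)
Lemma chebyshev_ode_pdeg d w : chebyshev_ode d w -> w != 0 -> pdeg w = d.
Proof.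
move=> ode w0; have := congr1 (fun p : {poly F} => p`_(pdeg w)) ode.
rewrite /= mulrBl mul1r coefD coefB coefCM coefXM coefXnM !coef_deriv.
have -> : w`_(pdeg w).+2 = 0 by rewrite nth_default // size_neq0.
rewrite mul0rn mul0rn subr0.
have -> : (if (pdeg w < 2)%N then 0 else w`_(pdeg w - 2).+2 *+ (pdeg w - 2).+2 *+ (pdeg w - 2).+1)
   + (if pdeg w == 0%N then 0 else w`_(pdeg w).-1.+1 *+ (pdeg w).-1.+1) = (pdeg w)%:R ^+ 2 * w`_(pdeg w).
  case: (pdeg w) => [|[|k]] /=; rewrite ?addr0 ?expr0n ?mul0r ?add0r ?expr1n ?mul1r //.
  rewrite subn2 /= -mulrnA -mulrnDr -natrX mulr_natl; congr (_ *+ _); lia.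
have lw : w`_(pdeg w) != 0 by rewrite -lead_coefE lead_coef_eq0.
move/(mulIf lw)/eqP; rewrite eqrXn2 ?ler0n // eqr_nat => /eqP //.
Qed.

(** Differentiate the Pell equation and cancel twice the derivative of [v]. *)
Lemma pell_ode v : (0 < pdeg v)%N -> pell v -> chebyshev_ode (pdeg v) v.
Proof.
move=> v0 P; have v'0 := deriv_neq0 v0.
have d1 : (1 : {poly F})^`() = 0 by rewrite -polyC1 derivC.
have := congr1 (@deriv F) P; rewrite -mul_polyC.
rewrite !(derivM, derivB, derivC, derivXn, deriv_exp, d1) /= => e.
have two0 : 2%:R != 0 :> {poly F} by rewrite -polyC_natr polyC_eq0 pnatr_eq0.
apply: (mulfI (mulf_neq0 two0 v'0)); rewrite /chebyshev_ode.
move: e; move: (_%:P) => D e.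
move/eqP: e; rewrite -subr_eq0 => /eqP e.
by apply/eqP; rewrite -subr_eq0; apply/eqP; rewrite -[RHS]e; ring.
Qed.

(** [T + U * s = (X + s) ^ n] with [s ^ 2 = X ^ 2 - 1]: the first entry is [T_n], the second the
    Chebyshev polynomial of the second kind of index [n - 1]. The derivatives of the pair are
    expressed through the pair itself. *)
Fixpoint chebyshev_pair n : {poly F} * {poly F} :=
  if n is k.+1 then
    let: (T, U) := chebyshev_pair k in ('X * T + ('X^2 - 1) * U, T + 'X * U)
  else (1, 0).

Lemma chebyshev_pair_deriv n :
  let: (T, U) := chebyshev_pair n in
  T^`() = n%:R * U /\ ('X^2 - 1) * U^`() = n%:R * T - 'X * U.
Proof.
have d1 : (1 : {poly F})^`() = 0 by rewrite -polyC1 derivC.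
elim: n => [|n] /=; first by rewrite d1 deriv0 !mulr0 mul0r subr0.
case: (chebyshev_pair n) => T U [T' U'].
rewrite !(derivD, derivN, derivM, derivX, d1) /= T' -natr1; split.
  transitivity (T + 'X * (n%:R * U) + 'X *+ 2 * U + ('X^2 - 1) * U^`()); first by ring.
  by rewrite U'; ring.
transitivity (('X^2 - 1) * (n%:R * U) + ('X^2 - 1) * U + 'X * (('X^2 - 1) * U^`())); first by ring.
by rewrite U'; ring.
Qed.

Definition chebyshev_poly n := (chebyshev_pair n).1.

Lemma chebyshev_poly_ode n : chebyshev_ode n (chebyshev_poly n).
Proof.
have := chebyshev_pair_deriv n; rewrite /chebyshev_poly; case: chebyshev_pair => T U /= [T' U'].
rewrite /chebyshev_ode T' derivM -polyC_natr derivC mul0r add0r mulrCA U' polyCM -polyC_natr.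
by rewrite polyC_natr; ring.
Qed.

Lemma chebyshev_poly_neq0 n : chebyshev_poly n != 0.
Proof.
have : (chebyshev_poly n).[1] = 1.
  rewrite /chebyshev_poly; elim: n => [|n] /=; first by rewrite hornerC.
  case: chebyshev_pair => T U /= T1.
  by rewrite !hornerE T1 expr1n subrr mul0r addr0.
by apply: contra_eqN => /eqP->; rewrite horner0 eq_sym oner_neq0.
Qed.

(** With matched leading coefficients the difference solves the same linear equation in degree below
    [d], which [chebyshev_ode_pdeg] permits only for 0. *)
Lemma pell_chebyshev v : (0 < pdeg v)%N -> pell v ->
  exists2 l, l != 0 & v = l *: chebyshev_poly (pdeg v).
Proof.
move=> v0 /(pell_ode v0) ode; set d := pdeg v in ode *; set T := chebyshev_poly d.
have T0 : T != 0 by apply: chebyshev_poly_neq0.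
have dT : pdeg T = d by apply: chebyshev_ode_pdeg T0; apply: chebyshev_poly_ode.
have vN0 := pdeg_gt0_neq0 v0.
have lv : lead_coef v != 0 by rewrite lead_coef_eq0.
have lT : lead_coef T != 0 by rewrite lead_coef_eq0.
exists (lead_coef v / lead_coef T); first by rewrite mulf_neq0 ?invr_eq0.
set l := _ / _.
have l0 : l != 0 by rewrite mulf_neq0 ?invr_eq0.
apply/eqP; rewrite -subr_eq0; apply: contraT => w0.
have : pdeg (v - l *: T) = d.
  apply: chebyshev_ode_pdeg w0; have := chebyshev_poly_ode d; rewrite -/T => odeT.
  move: ode odeT; rewrite /chebyshev_ode !derivB !derivZ -!mul_polyC => e1 e2.
  transitivity ((d%:R ^+ 2)%:P * v - l%:P * ((d%:R ^+ 2)%:P * T)); last by ring.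
  by rewrite -e1 -e2; ring.
have : (size (v - l *: T)%R < size v)%N.
  apply: size_sub_lead => //; first by rewrite size_scale // !size_neq0 // dT.
  by rewrite lead_coefZ divfK.
by rewrite !size_neq0 // ltnS -/d => lt e; rewrite e ltnn in lt.
Qed.

End ChebyshevPolynomials.

(** * Special components *)

Section Special.
Variable F : numClosedFieldType.
Implicit Types l u v w p q f g A B : {poly F}.

Lemma special_compl l u : size l = 2%N -> special u -> special (l \Po u).
Proof.
move=> sl [[c [t [k uE]]]|[mu [nu [v [smu snu -> pv]]]]]; last first.
  by right; exists (l \Po mu), nu, v; rewrite size_comp_linear // comp_polyA.
have [a [b [a0 lE]]] := affineP sl.
left; exists (a * c + b), t, (a * k).
rewrite pdeg_comp pdeg_linear // mul1n [in LHS]uE lE affine_comp scalerDr scalerA.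
by rewrite -mul_polyC -polyCM polyCD addrAC.
Qed.

Lemma pow_form_compr l u c t : size l = 2%N -> pow_form u c l.[t] -> pow_form (u \Po l) c t.
Proof.
move=> sl [k uE]; have [a [b [a0 lE]]] := affineP sl.
exists (k * a ^+ pdeg u); rewrite pdeg_comp (pdeg_linear sl) muln1.
rewrite [in LHS]uE comp_polyD comp_polyC comp_polyZ rmorphXn /= comp_polyB comp_polyX comp_polyC.
have -> : l - l.[t]%:P = a *: ('X - t%:P).
  rewrite lE !hornerE /affine scalerBr -[a *: t%:P]mul_polyC -polyCM polyCD opprD.
  by rewrite addrACA subrr addr0.
by rewrite exprZn scalerA.
Qed.

Lemma linear_surj l y : size l = 2%N -> exists x : F, l.[x] = y.
Proof.
move=> /linear_inverse[q [_ lq _]]; exists q.[y].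
by rewrite -horner_comp lq hornerX.
Qed.

Lemma special_compr l u : size l = 2%N -> special u -> special (u \Po l).
Proof.
move=> sl [[c [t ut]]|[mu [nu [v [smu snu -> pv]]]]]; last first.
  by right; exists mu, (nu \Po l), v; rewrite size_comp_linear // -!comp_polyA.
have [x lx] := linear_surj t sl; rewrite -lx in ut.
by left; exists c, x; apply: pow_form_compr.
Qed.

Lemma special_ramified u : (0 < pdeg u)%N -> chebyshev_ramified u -> special u.
Proof. by move=> u0 /(chebyshev_like_of_ramified u0); right. Qed.

Lemma mult_linear l x : size l = 2%N -> mult l x = 1%N.
Proof.
move=> sl; have l0 : (0 < pdeg l)%N by rewrite pdeg_linear.
apply/eqP; rewrite eqn_leq mult_gt0 // andbT -[X in (_ <= X)%N](pdeg_linear sl).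
by rewrite -(sum_mult l.[x] l0) (big_rem x) ?mem_fiber //= leq_addr.
Qed.

(** At a point of multiplicity [k > 2] the derivative vanishes, so the value [c] of [v] satisfies
    [c ^ 2 = 1] and [v + c] is nonzero there. The right side of the Pell equation then vanishes to
    order [k], the left side to order at least [2 * (k - 1)]. *)
Lemma pell_mult_le v x : (0 < pdeg v)%N -> pell v -> (mult v x <= 2)%N.
Proof.
move=> v0 P; have [//|m2] := leqP (mult v x) 2.
have mE := mult_deriv x v0; have v'0 := deriv_neq0 v0.
have X0 : 'X^2 - 1 != 0 :> {poly F} by rewrite -size_poly_gt0 -polyC1 size_XnsubC.
have d0 : (pdeg v)%:R ^+ 2 != 0 :> F by rewrite expf_neq0 // pnatr_eq0 -lt0n.
have v'x : v^`().[x] = 0.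
  apply/rootP; rewrite -dvdp_XsubCl XsubC_dvd //; lia.
have := congr1 (horner^~ x) P; rewrite !hornerE v'x ?expr0n /= ?mul0r ?mulr0 => /esym/eqP.
rewrite mulf_eq0 (negbTE d0) /= => /eqP vx.
set c := v.[x] in vx; have c2 : c ^+ 2 = 1 by apply/eqP; rewrite -subr_eq0 vx.
have c0 : c != 0 by apply/eqP => c0; move/eqP: c2; rewrite c0 expr0n eq_sym oner_eq0.
have vE : v ^+ 2 - 1 = (v - c%:P) * (v + c%:P).
  by rewrite -subr_sqr -polyC_exp c2.
have vc : ~~ root (v + c%:P) x.
  by rewrite rootE !hornerE -/c -mulr2n mulrn_eq0 /= c0.
have := congr1 (mup x) P; rewrite mupZ // vE (mupMl _ vc) -/(mult v x).
rewrite mupM ?expf_neq0 // mup_exp // => e.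
by move: e m2; rewrite mE; lia.
Qed.

Lemma chebyshev_like_mult_le u x : (0 < pdeg u)%N -> chebyshev_like u -> (mult u x <= 2)%N.
Proof.
move=> u0 [mu [nu [v [smu snu uE pv]]]].
have dv : pdeg v = pdeg u by rewrite uE !pdeg_comp (pdeg_linear smu) (pdeg_linear snu) mul1n muln1.
have v0 : (0 < pdeg v)%N by rewrite dv.
have dmu := pdeg_linear smu; have dnu := pdeg_linear snu.
rewrite uE !mult_comp ?pdeg_comp ?dmu ?dnu ?muln1 //.
by rewrite (mult_linear _ smu) (mult_linear _ snu) mul1n muln1 pell_mult_le.
Qed.

Lemma pow_form_mult u c t x : (0 < pdeg u)%N -> pow_form u c t -> (1 < mult u x)%N -> x = t.
Proof.
move=> u0 [k uE] m1; have k0 : k != 0.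
  by apply: contraTneq u0 => k0; rewrite uE k0 scale0r addr0 /pdeg size_polyC; case: (c == 0).
have : root u^`() x.
  by rewrite -dvdp_XsubCl XsubC_dvd ?deriv_neq0 //; have := mult_deriv x u0; lia.
rewrite uE derivD derivC add0r derivZ deriv_exp derivXsubC mul1r rootE !hornerE hornerMn.
rewrite mulf_eq0 (negbTE k0) mulrn_eq0 /= -[pdeg u == 0%N]negbK -lt0n u0 /=.
by rewrite !hornerE expf_eq0 subr_eq0 => /andP[_ /eqP].
Qed.

(** If the fiber has two points, one of them has multiplicity divisible by [e], hence above 2. This
    rules out the Chebyshev case, and in the power case the point must be the center. *)
Lemma special_almost_multiple e u c : (0 < pdeg u)%N -> (2 < e)%N -> special u ->
  almost_multiple e u c -> exists t, pow_form u c t.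
Proof.
move=> u0 e2 su al.
have [s1|s2] := leqP (size (fiber u c)) 1.
  by have [t ut] := fiber_neq0 c u0; exists t; apply: pow_form_of_fiber.
have [x ux mx] : exists2 x, u.[x] = c & (2 < mult u x)%N.
  have := uniq_fiber u c; case E : (fiber u c) s2 => [|x [|y s]] // _ /= /andP[].
  rewrite inE negb_or => /andP[/eqP xy _] _.
  have ux : u.[x] = c by apply/eqP; rewrite -mem_fiber // E inE eqxx.
  have uy : u.[y] = c by apply/eqP; rewrite -mem_fiber // E !inE eqxx orbT.
  have [ex|ex] := boolP (e %| mult u x)%N.
    by exists x => //; apply: leq_trans e2 _; rewrite dvdn_leq ?mult_gt0.
  have [ey|ey] := boolP (e %| mult u y)%N.
    by exists y => //; apply: leq_trans e2 _; rewrite dvdn_leq ?mult_gt0.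
  by case: xy; apply: al.
case: su => [[c' [t ut]]|/(chebyshev_like_mult_le x u0)]; last by rewrite leqNgt mx.
exists t; have xt := pow_form_mult u0 ut (ltnW mx).
suff <- : c' = c by [].
by apply/esym/eqP; rewrite -ux xt (pow_formE _ u0 ut).
Qed.

End Special.

(** * Special polynomials with a rotation symmetry *)

Section Equivariant.
Variable F : numClosedFieldType.
Implicit Types l u v w p q f g A B : {poly F}.

Lemma pow_form_small u : (0 < pdeg u)%N -> (pdeg u <= 2)%N -> exists c t, pow_form u c t.
Proof.
move=> u0 u2; have [u1|u1] := eqVneq (pdeg u) 1%N.
  have [t ut] := fiber_neq0 0 u0; exists 0, t; apply: pow_form_of_fiber => //.
  by rewrite -u1 size_fiber_pdeg.
have d2 : pdeg u = 2%N by lia.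
have [t /rootP ut] : exists t, root u^`() t.
  by apply/closed_rootP; rewrite size_neq0 ?deriv_neq0 // pdeg_deriv d2.
exists u.[t], t; apply: pow_form_of_fiber => //.
have mt : (1 < mult u t)%N.
  by rewrite mult_deriv // ltnS -XsubC_dvd ?deriv_neq0 // dvdp_XsubCl; apply/rootP.
have := sum_mult_pred_fiber u.[t] u0; rewrite d2 (big_rem t) ?mem_fiber //=; lia.
Qed.

(** The rotation permutes the critical points of [u]. The only one is [w], so [w] is fixed, and the
    only fixed point of the rotation is [t]. *)
Lemma pow_form_equivariant u (c w t z : F) : (0 < pdeg u)%N -> z != 1 -> z != 0 ->
  pow_form u c w -> equivariant u t z -> exists c', pow_form u c' t.
Proof.
move=> u0 z1 z0 uw [a [b E]]; have [u1|u1] := eqVneq (pdeg u) 1%N.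
  exists u.[t]; apply: pow_form_of_fiber => //.
  by rewrite -u1 size_fiber_pdeg.
have mw : (1 < mult u w)%N by rewrite (mult_pow_form u0 uw); lia.
have u'w : u^`().[w] = 0.
  by apply/rootP; rewrite -dvdp_XsubCl XsubC_dvd ?deriv_neq0 // -ltnS -mult_deriv.
have := congr1 (fun p : {poly F} => p^`().[w]) E.
rewrite /= derivD derivZ derivC addr0 hornerZ u'w mulr0 deriv_comp hornerM horner_comp.
have -> : (rotation t z)^`() = z%:P.
  by rewrite /rotation derivD derivC derivZ derivXsubC add0r alg_polyC.
rewrite hornerC => /eqP; rewrite mulf_eq0 (negbTE z0) orbF => /eqP rw.
have rwE : (rotation t z).[w] = w.
  apply: (pow_form_mult u0 uw); rewrite mult_deriv // ltnS -XsubC_dvd ?deriv_neq0 // dvdp_XsubCl.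
  exact/rootP.
move: rwE; rewrite /rotation !hornerE => /eqP; rewrite -subr_eq0.
have -> : t + z * (w - t) - w = (z - 1) * (w - t) by ring.
rewrite mulf_eq0 subr_eq0 (negbTE z1) subr_eq0 /= => /eqP wt.
by exists c; rewrite -wt.
Qed.

(* The Pell equations of [v] and of [v \Po affine z s] give an identity whose
   quadratic term in [v] has degree [2 * pdeg v] unless its coefficient vanishes. *)
Lemma pell_affine_symmetry v (a b z s : F) : (2 < pdeg v)%N -> pell v -> z != 0 ->
  v \Po affine z s = a *: v + b%:P -> z ^+ 2 = 1.
Proof.
move=> v2 P z0 E.
have v0 : (0 < pdeg v)%N by lia.
have vN0 := pdeg_gt0_neq0 v0.
have a0 : a != 0.
  apply/eqP => a0; have := congr1 (@pdeg F) E.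
  rewrite pdeg_comp (pdeg_linear (size_affine _ z0)) muln1 a0 scale0r add0r.
  by rewrite {2}/pdeg size_polyC => e; move: v2; rewrite e; case: (b == 0).
set r := affine z s in E; pose D : {poly F} := ((pdeg v)%:R ^+ 2)%:P.
have D0 : D != 0 by rewrite polyC_eq0 expf_neq0 // pnatr_eq0 -lt0n.
have P0 : ('X^2 - 1) * v^`() ^+ 2 = D * (v ^+ 2 - 1) by rewrite P -mul_polyC.
have P1 : (r ^+ 2 - 1) * (v^`() \Po r) ^+ 2 = D * ((a%:P * v + b%:P) ^+ 2 - 1).
  have := congr1 (fun p : {poly F} => p \Po r) P0.
  by rewrite /= !comp_polyM !comp_polyB comp_polyC !rmorphXn /= comp_polyX E -polyC1 !comp_polyC -mul_polyC.
have v'r : z%:P * (v^`() \Po r) = a%:P * v^`().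
  have := congr1 (@deriv F) E; rewrite deriv_comp deriv_affine derivD derivZ derivC addr0 => e.
  by rewrite mulrC e mul_polyC.
have key : a%:P ^+ 2 * v ^+ 2 * ((r ^+ 2 - 1) - z%:P ^+ 2 * ('X^2 - 1)) =
    a%:P ^+ 2 * (r ^+ 2 - 1) + z%:P ^+ 2 * ('X^2 - 1) * (2%:R * a%:P * b%:P * v + b%:P ^+ 2 - 1).
  apply: (mulfI D0).
  have e1 : (r ^+ 2 - 1) * (a%:P ^+ 2 * (D * (v ^+ 2 - 1))) =
            z%:P ^+ 2 * ('X^2 - 1) * (D * ((a%:P * v + b%:P) ^+ 2 - 1)).
    rewrite -P0 -P1.
    transitivity (('X^2 - 1) * (r ^+ 2 - 1) * (a%:P * v^`()) ^+ 2); first by ring.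
    by rewrite -v'r; ring.
  move/eqP: e1; rewrite -subr_eq0 => /eqP e1.
  by apply/eqP; rewrite -subr_eq0; apply/eqP; rewrite -[RHS]e1; ring.
have rE : (r ^+ 2 - 1) - z%:P ^+ 2 * ('X^2 - 1) = (2%:R * z * s)%:P * 'X + (s ^+ 2 - 1 + z ^+ 2)%:P.
  by rewrite /r /affine -mul_polyC !(polyCM, polyCD, polyCN, polyC_exp, polyC1); ring.
have : (r ^+ 2 - 1) - z%:P ^+ 2 * ('X^2 - 1) = 0.
  apply/eqP; apply: contraT => K0; have := congr1 (fun p : {poly F} => size p) key => /=.
  have -> : size (a%:P ^+ 2 * v ^+ 2 * ((r ^+ 2 - 1) - z%:P ^+ 2 * ('X^2 - 1))) =
     (2 * pdeg v + pdeg ((r ^+ 2 - 1) - z%:P ^+ 2 * ('X^2 - 1))).+1.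
    have da : pdeg (a%:P : {poly F}) = 0%N by rewrite /pdeg size_polyC a0.
    have n2 : a%:P ^+ 2 != 0 :> {poly F} by rewrite expf_neq0 // polyC_eq0.
    have n3 : v ^+ 2 != 0 by rewrite expf_neq0.
    have n1 := mulf_neq0 n2 n3; rewrite (size_neq0 (mulf_neq0 n1 K0)).
    by rewrite (pdegM n1 K0) (pdegM n2 n3) !pdegX da mul0n add0n mulnC.
  have sX : (size ('X^2 - 1 : {poly F})%R <= 3)%N by rewrite -polyC1 size_XnsubC.
  have sr : (size (r ^+ 2 - 1)%R <= 3)%N.
    rewrite (leq_trans (size_polyD _ _)) // geq_max size_polyN size_poly1 andbT.
    rewrite size_neq0 ?expf_neq0 -?size_poly_gt0 ?size_affine //.
    by rewrite pdegX (pdeg_linear (size_affine _ z0)).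
  have sc (k : F) p : (size (k%:P * p)%R <= size p)%N by rewrite mul_polyC size_scale_leq.
  have sv : size v = (pdeg v).+1 by rewrite size_neq0.
  have : (size (a%:P ^+ 2 * (r ^+ 2 - 1) + z%:P ^+ 2 * ('X^2 - 1) * (2%:R * a%:P * b%:P * v + b%:P ^+ 2 - 1))%R <= pdeg v + 3)%N.
    rewrite (leq_trans (size_polyD _ _)) // geq_max; apply/andP; split.
      by rewrite -polyC_exp (leq_trans (sc _ _)) // (leq_trans sr) // leq_addl.
    have w1 : (size (2%:R * a%:P * b%:P * v + b%:P ^+ 2 - 1)%R <= (pdeg v).+1)%N.
      rewrite -addrA (leq_trans (size_polyD _ _)) // geq_max -{1}polyC_natr -!polyCM -sv sc /=.
      rewrite -polyC_exp -polyC1 -polyCB sv (leq_trans (size_polyC_leq1 _)) //.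
    rewrite -mulrA -polyC_exp (leq_trans (sc _ _)) // (leq_trans (size_polyMleq _ _)) //.
    by move: sX w1; move: (size _) (size _) => x y; lia.
  by move=> le e; rewrite -e in le; lia.
rewrite rE => H.
have := congr1 (fun p : {poly F} => p`_1) H; have := congr1 (fun p : {poly F} => p`_0) H.
rewrite !coefD !coefMX !coefC /= !addr0 add0r => h0 /eqP.
rewrite !mulf_eq0 pnatr_eq0 (negbTE z0) /= => /eqP s0.
by move: h0; rewrite s0 expr0n /= add0r addrC => /eqP; rewrite subr_eq0 => /eqP.
Qed.

(** By [pell_affine_symmetry] the Chebyshev case in degree above 2 forces [z ^+ 2 = 1]; in degree at
    most 2 every polynomial is a power. *)
Lemma special_equivariant u (t z : F) : (0 < pdeg u)%N -> z ^+ 2 != 1 -> z != 0 ->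
  special u -> equivariant u t z -> exists c, pow_form u c t.
Proof.
move=> u0 z2 z0 su eq_u.
have z1 : z != 1 by apply: contraNneq z2 => ->; rewrite expr1n.
have [du|du] := leqP (pdeg u) 2.
  by have [c [w uw]] := pow_form_small u0 du; apply: pow_form_equivariant uw eq_u.
case: su => [[c [w uw]]|[mu [nu [v [smu snu uE pv]]]]].
  exact: pow_form_equivariant uw eq_u.
exfalso; case: eq_u => a [b E].
have dv : pdeg v = pdeg u by rewrite uE !pdeg_comp (pdeg_linear smu) (pdeg_linear snu) mul1n muln1.
have [k [q [k0 muE]]] := affineP smu.
have Ev : v \Po nu \Po rotation t z = a *: (v \Po nu) + ((a * q + b - q) / k)%:P.
  apply: (@mulfI _ k%:P); first by rewrite polyC_eq0.
  move: E; rewrite uE muE -comp_polyA !affine_comp -!mul_polyC.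
  set x := (v \Po nu) \Po _; set y := v \Po nu => E.
  have -> : k%:P * x = a%:P * (k%:P * y + q%:P) + b%:P - q%:P by rewrite -E addrK.
  rewrite [RHS]mulrDr -[in RHS]polyCM [k * _]mulrC divfK // !(polyCD, polyCM, polyCN).
  by ring.
(* [nu] conjugates the rotation about [t] to an affine map with the same multiplier [z]. *)
have nuR : nu \Po rotation t z = affine z (nu.[t] - z * nu.[t]) \Po nu.
  have [al [be [al0 ->]]] := affineP snu.
  rewrite !affine_comp /rotation !hornerE /affine.
  by rewrite -!mul_polyC !(polyCD, polyCM, polyCB, polyCN); ring.
have : v \Po affine z (nu.[t] - z * nu.[t]) = a *: v + ((a * q + b - q) / k)%:P.
  apply: (@comp_poly_inj _ _ _ nu); first by rewrite pdeg_linear.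
  by rewrite -comp_polyA -nuR comp_polyA Ev comp_polyD comp_polyZ comp_polyC.
by move/(pell_affine_symmetry _ pv z0); rewrite dv du => /(_ isT) /eqP; rewrite (negbTE z2).
Qed.

End Equivariant.

(** * Reduction from several degrees to two *)

Section GcdInduction.
Variables (L S : nat -> Prop).
Hypothesis L_gcd : forall a b, L a -> L b -> L (gcdn a b).
Hypothesis S_coprime : forall a b, L a -> L b -> coprime a b -> S a \/ S b.
Hypothesis S_triple : forall a b e, L a -> L b -> L e -> (e %| b)%N -> coprime a e ->
  (2 < e)%N -> S (gcdn a b) -> S a \/ S b.

Lemma gcd_induction (s : seq nat) : (forall d, d \in s -> L d) ->
  \big[gcdn/0%N]_(d <- s) d = 1%N -> exists2 d, d \in s & S d.
Proof.
have [N] := ubnP (size s); elim: N s => // N IHN [|a [|b [|c s]]] sN Ls.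
- by rewrite big_nil.
- rewrite big_seq1 => a1; have La : L a by apply: Ls; rewrite inE eqxx.
  have : S a \/ S a by apply: S_coprime; rewrite // a1.
  by exists a; rewrite ?inE ?eqxx //; case: H.
- rewrite big_cons big_seq1 => /eqP ab.
  have [||Sa|Sb] := @S_coprime a b _ _ ab; try by apply: Ls; rewrite !inE eqxx ?orbT.
    by exists a; rewrite // !inE eqxx.
  by exists b; rewrite // !inE eqxx orbT.
set s' := c :: s in sN Ls *.
rewrite 2!big_cons; set e := \big[gcdn/0%N]_(d <- s') d => abe.
have La : L a by apply: Ls; rewrite inE eqxx.
have Lb : L b by apply: Ls; rewrite !inE eqxx orbT.
have Ls' d : d \in s' -> L d by move=> ds; apply: Ls; rewrite 2!in_cons ds !orbT.
(* The empty gcd is 0, for which [L] is not given; the induction therefore starts from one-element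
   lists. *)
have Le : L e.
  rewrite /e /s'; have : forall d, d \in c :: s -> L d by [].
  elim: (s) (c) => [|c1 s1 IHs] c0 Lc; first by rewrite big_seq1; apply: Lc; rewrite inE.
  rewrite big_cons; apply: L_gcd; first by apply: Lc; rewrite inE eqxx.
  by apply: IHs => d ds; apply: Lc; rewrite inE ds orbT.
clearbody s'.
have abP : S a \/ S b -> exists2 d, d \in [:: a, b & s'] & S d.
  by case; [exists a|exists b]; rewrite ?inE ?eqxx ?orbT.
have sub x d : x \in [:: a; b] -> d \in x :: s' -> d \in [:: a, b & s'].
  rewrite !inE => /orP[]/eqP-> /orP[->|->]; rewrite ?orbT //.
have [] := IHN (gcdn a b :: s').
- by move: sN; rewrite /=; lia.
- by move=> d; rewrite inE => /predU1P[->|/Ls' //]; apply: L_gcd.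
- by rewrite big_cons -gcdnA -/e abe.
move=> d; rewrite inE => /predU1P[->|ds Sd]; last first.
  by exists d => //; rewrite !inE ds !orbT.
move=> Sq.
have [be|be] := eqVneq (gcdn b e) 1%N.
  have [|||d' d's Sd'] := IHN (b :: s'); first by move: sN; rewrite /=; lia.
  - by move=> d'; rewrite inE => /predU1P[->|/Ls'].
  - by rewrite big_cons.
  by exists d' => //; apply: (sub b); rewrite // !inE eqxx orbT.
have [ae|ae] := eqVneq (gcdn a e) 1%N.
  have [|||d' d's Sd'] := IHN (a :: s'); first by move: sN; rewrite /=; lia.
  - by move=> d'; rewrite inE => /predU1P[->|/Ls'].
  - by rewrite big_cons.
  by exists d' => //; apply: (sub a); rewrite // !inE eqxx.
apply: abP.
have [q1|q1] := eqVneq (gcdn a b) 1%N; first by apply: S_coprime => //; apply/eqP.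
have c1 : coprime a (gcdn b e) by apply/eqP.
have c2 : coprime b (gcdn a e) by rewrite /coprime gcdnCA abe.
have Lbe := L_gcd Lb Le; have Lae := L_gcd La Le.
have [e1|e1] := ltnP 2 (gcdn b e).
  by apply: (S_triple La Lb Lbe) => //; apply: dvdn_gcdl.
have [e2|e2] := ltnP 2 (gcdn a e).
  suff [] : S b \/ S a by [right|left].
  by apply: (S_triple Lb La Lae) => //; [apply: dvdn_gcdl|rewrite gcdnC].
(* [L] does not exclude 0, so this value is treated apart: [gcdn b e = 0] would force
   [gcdn a b = 1]. *)
have gt0 (x : nat) y : gcdn x y != 1%N -> (gcdn x y <= 2)%N -> gcdn x y = 0%N \/ gcdn x y = 2%N.
  by case: (gcdn x y) => [|[|[|]]] //; [left|right].
have cc : gcdn (gcdn a e) (gcdn b e) = 1%N.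
  apply/eqP; rewrite -dvdn1 -abe dvdn_gcd dvdn_gcdr andbT.
  exact: dvdn_trans (dvdn_gcdl _ _) (dvdn_gcdl _ _).
case: (gt0 _ _ be e1) cc => [z|->].
  have e0 : e = 0%N by move/eqP: z; rewrite -leqn0 leqNgt gcdn_gt0 negb_or -!leqNgt !leqn0 => /andP[_ /eqP].
  by case/negP: q1; move: abe; rewrite e0 !gcdn0 => ->.
case: (gt0 _ _ ae e2) => -> //.
Qed.

End GcdInduction.

(** * Components of a fixed polynomial *)

Section Factors.
Variable F : numClosedFieldType.
Implicit Types l u v w p q f g A B : {poly F}.

(** The common left factor in [ritt_square] has the degree of [f], so it equals [f] up to an
    invertible linear factor. *)
Lemma left_factor f g A B : (0 < pdeg (f \Po A))%N -> f \Po A = g \Po B ->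
  (pdeg f %| pdeg g)%N -> exists X : {poly F}, g = f \Po X.
Proof.
move=> d0 e dv; have d0' := d0; rewrite e in d0'; move: d0 d0'; rewrite !pdeg_comp !muln_gt0.
move=> /andP[f0 A0] /andP[g0 B0].
have [Q [W [f' [g' [A' [B' [[fE gE _ _] _ _ dQ _]]]]]]] := ritt_square f0 g0 A0 B0 e.
have f'1 : size f' = 2%N.
  apply: size_linear; apply/eqP; rewrite -(eqn_pmul2l f0) muln1.
  by rewrite {1}(gcdn_idPl dv) in dQ; rewrite -{1}dQ -pdeg_comp -fE.
have [h [_ fh _]] := linear_inverse f'1.
by exists (h \Po g'); rewrite fE gE comp_polyA -[Q \Po f' \Po h]comp_polyA fh comp_polyXr.
Qed.

Lemma right_factor f g A B : (0 < pdeg (f \Po A))%N -> f \Po A = g \Po B ->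
  (pdeg A %| pdeg B)%N -> exists X : {poly F}, B = X \Po A.
Proof.
move=> d0 e dv; have d0' := d0; rewrite e in d0'; move: d0 d0'; rewrite !pdeg_comp !muln_gt0.
move=> /andP[f0 A0] /andP[g0 B0].
have [Q [W [f' [g' [A' [B' [[_ _ AE BE] _ _ _ dW]]]]]]] := ritt_square f0 g0 A0 B0 e.
have A'1 : size A' = 2%N.
  apply: size_linear; apply/eqP; rewrite -(eqn_pmul2r A0) mul1n.
  by rewrite {1}(gcdn_idPl dv) in dW; rewrite -{1}dW -pdeg_comp -AE.
have [h [_ _ hA]] := linear_inverse A'1.
by exists (B' \Po h); rewrite AE BE -comp_polyA [h \Po _]comp_polyA hA comp_polyX.
Qed.

Lemma pow_form_special u c t : pow_form u c t -> special u.
Proof. by move=> ut; left; exists c, t. Qed.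

Lemma pow_form_comp p q c t x : (0 < pdeg p)%N -> pow_form p c t -> pow_form q t x ->
  pow_form (p \Po q) c x.
Proof.
move=> p0 [k pE] [k' qE].
have e : q - t%:P = k' *: ('X - x%:P) ^+ pdeg q by rewrite {1}qE addrAC subrr add0r.
exists (k * k' ^+ pdeg p); rewrite pdeg_comp [in LHS]pE comp_polyD comp_polyC comp_polyZ.
rewrite rmorphXn /= comp_polyB comp_polyX comp_polyC e exprZn scalerA -exprM.
by rewrite [(pdeg q * _)%N]mulnC.
Qed.

Lemma ritt_second_left f g A B : (0 < pdeg f)%N -> (0 < pdeg g)%N -> coprime (pdeg f) (pdeg g) ->
  pdeg A = pdeg g -> pdeg B = pdeg f -> f \Po A = g \Po B ->
  special g \/ exists c x, pow_form f c x /\ almost_multiple (pdeg f) g c.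
Proof.
move=> f0 g0 cfg dA dB e; have [] := ritt_second f0 g0 cfg dA dB e.
- by move=> [c [x [y [t [fx al _ _]]]]]; right; exists c, x.
- by move=> [c [x [y [t [gx _ _ _]]]]]; left; apply: pow_form_special gx.
by move=> [_ cg _ _]; left; apply: special_ramified.
Qed.

Lemma ritt_second_right f g A B : (0 < pdeg f)%N -> (0 < pdeg g)%N -> coprime (pdeg f) (pdeg g) ->
  pdeg A = pdeg g -> pdeg B = pdeg f -> f \Po A = g \Po B ->
  special A \/ exists y t, pow_form B y t /\ forall z, z ^+ pdeg B = 1 -> equivariant A t z.
Proof.
move=> f0 g0 cfg dA dB e; have [] := ritt_second f0 g0 cfg dA dB e.
- by move=> [c [x [y [t [_ _ By eqA]]]]]; right; exists y, t; rewrite dB.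
- by move=> [c [x [y [t [_ _ Ay _]]]]]; left; apply: pow_form_special Ay.
by move=> [_ _ cA _]; left; apply: special_ramified; rewrite ?dA.
Qed.

Lemma coprime_special_left f g A B : (0 < pdeg f)%N -> (0 < pdeg g)%N ->
  coprime (pdeg f) (pdeg g) -> pdeg A = pdeg g -> pdeg B = pdeg f -> f \Po A = g \Po B ->
  special f \/ special g.
Proof.
move=> f0 g0 cfg dA dB e; have [|[c [x [fx _]]]] := ritt_second_left f0 g0 cfg dA dB e.
  by right.
by left; apply: pow_form_special fx.
Qed.

Lemma coprime_special_right f g A B : (0 < pdeg f)%N -> (0 < pdeg g)%N ->
  coprime (pdeg f) (pdeg g) -> pdeg A = pdeg g -> pdeg B = pdeg f -> f \Po A = g \Po B ->
  special A \/ special B.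
Proof.
move=> f0 g0 cfg dA dB e; have [|[c [x [By _]]]] := ritt_second_right f0 g0 cfg dA dB e.
  by left.
by right; apply: pow_form_special By.
Qed.

End Factors.

Lemma prim_root_exists (F : numClosedFieldType) e : (0 < e)%N -> exists z : F, e.-primitive_root z.
Proof.
move=> e0; pose p : {poly F} := 'X^e - 1.
have sp : size p = e.+1 by rewrite /p -polyC1 size_XnsubC.
have p0 : p != 0 by rewrite -size_poly_gt0 sp.
have dp : pdeg p = e by rewrite /pdeg sp.
have pg0 : (0 < pdeg p)%N by rewrite dp.
have ru : all e.-unity_root (rootseq p).
  by apply/allP => z; rewrite -root_rootseq.
have us : uniq (rootseq p).
  apply: count_mem_uniq => z; have [zr|/count_memPn //] := boolP (z \in rootseq p).
  have pz : p.[z] = 0 by apply/rootP; rewrite root_rootseq.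
  have := mult_deriv z pg0; rewrite /mult pz subr0 mup_rootseq // => ->.
  congr _.+1; apply: mupNroot; rewrite /p derivB derivXn -polyC1 derivC subr0 rootE hornerMn hornerXn.
  rewrite mulrn_eq0 negb_or -lt0n e0 /= expf_neq0 //.
  apply/eqP => z0; move: pz; rewrite /p z0 !hornerE ?hornerXn expr0n gtn_eqF // sub0r.
  by move/eqP; rewrite oppr_eq0 oner_eq0.
have : has e.-primitive_root (rootseq p).
  by apply: has_prim_root => //; rewrite size_rootseq // dp.
by move=> /hasP[z _ zP]; exists z.
Qed.

Section Components.
Variables (F : numClosedFieldType) (V : {poly F}).
Hypothesis V0 : (0 < pdeg V)%N.
Implicit Types l u v w p q f g A B : {poly F}.

Definition left_component d f := pdeg f = d /\ exists A, V = f \Po A.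
Definition right_component d A := pdeg A = d /\ exists f, V = f \Po A.
Definition left_degree d := exists f, left_component d f.
Definition right_degree d := exists A, right_component d A.
Definition left_special d := exists f, left_component d f /\ special f.
Definition right_special d := exists A, right_component d A /\ special A.

Lemma comp_gt0 f A : V = f \Po A -> (0 < pdeg f)%N /\ (0 < pdeg A)%N.
Proof. by move=> e; move: V0; rewrite e pdeg_comp muln_gt0 => /andP. Qed.

Lemma left_component_dvd f g d e : left_component d f -> left_component e g -> (d %| e)%N ->
  exists X : {poly F}, g = f \Po X.
Proof.
move=> [<- [A VA]] [<- [B VB]] de; apply: (@left_factor _ f g A B) => //.
  by rewrite -VA.
by rewrite -VA.
Qed.

Lemma right_component_dvd A B d e : right_component d A -> right_component e B -> (d %| e)%N ->
  exists X : {poly F}, B = X \Po A.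
Proof.
move=> [<- [f VA]] [<- [g VB]] de; apply: (@right_factor _ f g A B) => //.
  by rewrite -VA.
by rewrite -VA.
Qed.

(** Two left components of equal degree differ by a linear factor, so being special depends on the
    degree alone; this lets the induction run on degrees. *)
Lemma left_special_component d f : left_special d -> left_component d f -> special f.
Proof.
move=> [g [gd sg]] fd; have [X fX] := left_component_dvd gd fd (dvdnn d).
have [g0 _] : (0 < pdeg g)%N /\ True by case: gd => _ [A /comp_gt0[]].
rewrite fX; apply: special_compr sg; apply: size_linear; apply/eqP.
rewrite -(eqn_pmul2l g0) -pdeg_comp -fX muln1.
by case: gd fd => -> _ [-> _].
Qed.

Lemma right_special_component d A : right_special d -> right_component d A -> special A.
Proof.
move=> [B [Bd sB]] Ad; have [X AX] := right_component_dvd Bd Ad (dvdnn d).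
have [B0 _] : (0 < pdeg B)%N /\ True by case: Bd => _ [f /comp_gt0[]].
rewrite AX; apply: special_compl sB; apply: size_linear; apply/eqP.
rewrite -(eqn_pmul2r B0) -pdeg_comp -AX mul1n.
by case: Bd Ad => -> _ [-> _].
Qed.

Lemma left_degree_gcd a b : left_degree a -> left_degree b -> left_degree (gcdn a b).
Proof.
move=> [f [<- [A VA]]] [g [<- [B VB]]].
have [f0 A0] := comp_gt0 VA; have [g0 B0] := comp_gt0 VB.
have e : f \Po A = g \Po B by rewrite -VA.
have [Q [W [f' [g' [A' [B' [[fE _ _ _] _ _ dQ _]]]]]]] := ritt_square f0 g0 A0 B0 e.
by exists Q; split=> //; exists (f' \Po A); rewrite comp_polyA -fE.
Qed.

Lemma right_degree_gcd a b : right_degree a -> right_degree b -> right_degree (gcdn a b).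
Proof.
move=> [A [<- [f VA]]] [B [<- [g VB]]].
have [f0 A0] := comp_gt0 VA; have [g0 B0] := comp_gt0 VB.
have e : f \Po A = g \Po B by rewrite -VA.
have [Q [W [f' [g' [A' [B' [[_ _ AE _] _ _ _ dW]]]]]]] := ritt_square f0 g0 A0 B0 e.
by exists W; split=> //; exists (f \Po A'); rewrite -comp_polyA -AE.
Qed.

Lemma left_coprime_relation a b f g : coprime a b -> left_component a f -> left_component b g ->
  exists A B, [/\ pdeg A = b, pdeg B = a & f \Po A = g \Po B].
Proof.
move=> cab [fa [A VA]] [gb [B VB]].
have [f0 A0] := comp_gt0 VA; have [g0 B0] := comp_gt0 VB.
have e : f \Po A = g \Po B by rewrite -VA.
have [Q [W [f' [g' [A' [B' [[fE gE _ _] e' [d1 d2 _ _ _] dQ _]]]]]]] := ritt_square f0 g0 A0 B0 e.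
rewrite fa gb (eqP cab) in dQ; exists A', B'; rewrite -d1 -d2; split.
- by rewrite -gb gE pdeg_comp dQ mul1n.
- by rewrite -fa fE pdeg_comp dQ mul1n.
by rewrite fE gE -!comp_polyA e'.
Qed.

Lemma right_coprime_relation a b A B : coprime a b -> right_component a A -> right_component b B ->
  exists f g, [/\ pdeg f = b, pdeg g = a & f \Po A = g \Po B].
Proof.
move=> cab [Aa [f VA]] [Bb [g VB]].
have [f0 A0] := comp_gt0 VA; have [g0 B0] := comp_gt0 VB.
have e : f \Po A = g \Po B by rewrite -VA.
have [Q [W [f' [g' [A' [B' [[_ _ AE BE] e' [d1 d2 _ _ _] _ dW]]]]]]] := ritt_square f0 g0 A0 B0 e.
rewrite Aa Bb (eqP cab) in dW; exists f', g'; rewrite d1 d2; split.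
- by rewrite -Bb BE pdeg_comp dW muln1.
- by rewrite -Aa AE pdeg_comp dW muln1.
by rewrite AE BE !comp_polyA e'.
Qed.

Lemma left_special_coprime a b : left_degree a -> left_degree b -> coprime a b ->
  left_special a \/ left_special b.
Proof.
move=> [f fa] [g gb] cab; have [A [B [dA dB e]]] := left_coprime_relation cab fa gb.
have [df [A1 /comp_gt0[f0 _]]] := fa; have [dg [B1 /comp_gt0[g0 _]]] := gb.
have [|||sf|sg] := coprime_special_left f0 g0 _ _ _ e; rewrite ?df ?dg //.
  by left; exists f.
by right; exists g.
Qed.

Lemma right_special_coprime a b : right_degree a -> right_degree b -> coprime a b ->
  right_special a \/ right_special b.
Proof.
move=> [A Aa] [B Bb] cab; have [f [g [df dg e]]] := right_coprime_relation cab Aa Bb.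
have [dA [A1 /comp_gt0[_ A0]]] := Aa; have [dB [B1 /comp_gt0[_ B0]]] := Bb.
have f0 : (0 < pdeg f)%N by rewrite df -dB.
have g0 : (0 < pdeg g)%N by rewrite dg -dA.
have [|||sA|sB] := coprime_special_right f0 g0 _ _ _ e; rewrite ?df ?dg ?dA ?dB //.
- by rewrite coprime_sym.
- by left; exists A.
by right; exists B.
Qed.

(** Write [g = h \Po X] with [h] of degree [e]. If [f] is not special, [h] is a power over some [c];
    then [e] divides all multiplicities of [g] over [c], and those of [f] with at most one
    exception. This descends to [Q], which is therefore a power with a center [w], and from there to
    [f'] and [g'] over [w]. *)
Lemma left_special_triple a b e : left_degree a -> left_degree b -> left_degree e ->
  (e %| b)%N -> coprime a e -> (2 < e)%N -> left_special (gcdn a b) ->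
  left_special a \/ left_special b.
Proof.
move=> [f fa] [g gb] [h he] eb cae e2 sq.
have [X gX] := left_component_dvd he gb eb.
have [df [A VA]] := fa; have [dg [B VB]] := gb; have [dh [C VC]] := he.
have [f0 A0] := comp_gt0 VA; have [g0 B0] := comp_gt0 VB; have [h0 C0] := comp_gt0 VC.
have X0 : (0 < pdeg X)%N by move: g0; rewrite gX pdeg_comp muln_gt0 => /andP[].
have efg : f \Po A = g \Po B by rewrite -VA.
have [Q [W [f' [g' [A' [B' [[fE gE _ _] e' [d1 d2 f'0 g'0 cfg] dQ _]]]]]]] := ritt_square f0 g0 A0 B0 efg.
have Q0 : (0 < pdeg Q)%N by rewrite dQ gcdn_gt0 f0.
have sQ : special Q.
  apply: (left_special_component sq); split; first by rewrite dQ df dg.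
  by exists (f' \Po A); rewrite comp_polyA -fE.
have cea : coprime e a by rewrite coprime_sym.
have [A1 [B1 [dA1 dB1 e1]]] := left_coprime_relation cea he fa.
have [|||sf|[c [x [hx al]]]] := ritt_second_left h0 f0 _ _ _ e1; rewrite ?dh ?df //.
  by left; exists f.
rewrite dh in al.
have allg y : g.[y] = c -> (e %| mult g y)%N.
  rewrite gX horner_comp => /eqP; rewrite (pow_formE _ h0 hx) => /eqP Xy.
  by rewrite mult_comp // Xy (mult_pow_form h0 hx) dh dvdn_mulr.
have alQ : almost_multiple e Q c.
  (* If [e] divided the multiplicities of [f] at all points over [w], it would divide [mult Q w]
     times each of the coprime degrees of [f'] and [g']. *)
  have bad (w : F) : Q.[w] = c -> ~~ (e %| mult Q w)%N -> exists2 y, f'.[y] = w & ~~ (e %| mult f y)%N.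
    move=> Qw ew; have [/hasP[y yf ey]|/hasPn all] :=
        boolP (has (fun y => ~~ (e %| mult f y)%N) (fiber f' w)).
      by exists y => //; apply/eqP; rewrite -mem_fiber.
    case/negP: ew; suff : (e %| gcdn (mult Q w * pdeg f') (mult Q w * pdeg g'))%N.
      by rewrite -muln_gcdr (eqP cfg) muln1.
    rewrite dvdn_gcd; apply/andP; split.
      rewrite -(sum_mult w f'0) big_distrr /= big_seq; apply: dvdn_sum => y yf.
      have := all y yf; rewrite negbK fE mult_comp //.
      by move: yf; rewrite mem_fiber // => /eqP->.
    rewrite -(sum_mult w g'0) big_distrr /= big_seq; apply: dvdn_sum => y.
    rewrite mem_fiber // => /eqP gy; have := allg y.
    by rewrite gE horner_comp gy mult_comp // gy; apply.
  move=> w w' Qw Qw' /(bad _ Qw)[y yw ey] /(bad _ Qw')[y' yw' ey'].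
  by rewrite -yw -yw' (al y y') // fE horner_comp ?yw ?yw'.
have [w Qw] := special_almost_multiple Q0 e2 sQ alQ.
have mw := mult_pow_form Q0 Qw.
have ceq : coprime e (pdeg Q) by rewrite dQ df (coprime_dvdr _ cea) // dvdn_gcdl.
(* [mult Q w] is the degree of [Q], which is prime to [e], so composing with [Q] does not affect
   divisibility by [e]. *)
have red (p : {poly F}) (y : F) : (0 < pdeg p)%N -> p.[y] = w -> (e %| mult (Q \Po p) y)%N = (e %| mult p y)%N.
  by move=> p0 py; rewrite mult_comp // py mw Gauss_dvdr.
have [||sf'|sg'] := coprime_special_left f'0 g'0 cfg _ _ e'; rewrite ?d1 ?d2 //.
  left; exists f; split=> //.
  have [|t f't] := special_almost_multiple f'0 e2 sf' (c := w).
    move=> y y' fy fy'; rewrite -(red f' y) // -(red f' y') // -fE; apply: al; rewrite fE horner_comp ?fy ?fy';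
      by apply/eqP; rewrite (pow_formE _ Q0 Qw).
  by rewrite fE; apply: pow_form_special (pow_form_comp Q0 Qw f't).
right; exists g; split=> //.
have [|t g't] := special_almost_multiple g'0 e2 sg' (c := w).
  move=> y y' gy gy'; rewrite -(red g' y) // -gE allg // gE horner_comp gy.
  by apply/eqP; rewrite (pow_formE _ Q0 Qw).
by rewrite gE; apply: pow_form_special (pow_form_comp Q0 Qw g't).
Qed.

(** The mirror argument, with the rotation of order [e] about the center of the power [C] in place
    of divisibility: it fixes [B = X \Po C], and if [A] is not special it acts on [A] by an affine
    map. *)
Lemma right_special_triple a b e : right_degree a -> right_degree b -> right_degree e ->
  (e %| b)%N -> coprime a e -> (2 < e)%N -> right_special (gcdn a b) ->
  right_special a \/ right_special b.
Proof.
move=> [A Aa] [B Bb] [C Ce] eb cae e2 sq.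
have [X BX] := right_component_dvd Ce Bb eb.
have [dA [f VA]] := Aa; have [dB [g VB]] := Bb; have [dC [h VC]] := Ce.
have [f0 A0] := comp_gt0 VA; have [g0 B0] := comp_gt0 VB; have [h0 C0] := comp_gt0 VC.
have efg : f \Po A = g \Po B by rewrite -VA.
have [Q [W [f' [g' [A' [B' [[_ _ AE BE] e' [d1 d2 f'0 g'0 cfg] _ dW]]]]]]] := ritt_square f0 g0 A0 B0 efg.
have W0 : (0 < pdeg W)%N by rewrite dW gcdn_gt0 A0.
have A'0 : (0 < pdeg A')%N by rewrite -d2.
have B'0 : (0 < pdeg B')%N by rewrite -d1.
have sW : special W.
  apply: (right_special_component sq); split; first by rewrite dW dA dB.
  by exists (f \Po A'); rewrite -comp_polyA -AE.
have [p [r [dp dr e1]]] := right_coprime_relation cae Aa Ce.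
have p0 : (0 < pdeg p)%N by rewrite dp -dC.
have r0 : (0 < pdeg r)%N by rewrite dr -dA.
have cpr : coprime (pdeg p) (pdeg r) by rewrite dp dr coprime_sym.
have [||sA|[y [t [Ct eqA]]]] := ritt_second_right p0 r0 cpr _ _ e1; rewrite ?dp ?dr ?dA ?dC //.
  by left; exists A.
have e0 : (0 < e)%N by lia.
have [z zP] := prim_root_exists F e0.
have ze : z ^+ e = 1 by apply: prim_expr_order.
have z0 : z != 0 by rewrite (prim_root_eq0 zP) -lt0n.
have [l [b' eA]] := eqA z (etrans (congr1 _ dC) ze).
set R := rotation t z in eA.
have BR : B \Po R = B.
  by rewrite BX -comp_polyA (pow_form_rotation z Ct) dC ze scale1r addrC subrK.
have ndvd k : coprime k e -> ~~ (e %| k * 2)%N.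
  by move=> ke; rewrite Gauss_dvdr 1?coprime_sym //; apply/negP => /dvdn_leq; lia.
have z2 k : coprime k e -> (z ^+ k) ^+ 2 != 1.
  by move=> ke; rewrite -exprM -(prim_order_dvd zP) ndvd.
have cqe : coprime (pdeg W) e by rewrite dW dA dB (coprime_dvdl _ cae) // dvdn_gcdl.
have sR : size R = 2%N by apply: size_rotation.
(* [W \Po R] and [W] are right components, of equal degree, of one polynomial, so they differ by a
   linear factor. *)
have eqW : equivariant W t z.
  have e3 : A' \Po (W \Po R) = (l *: A' + b'%:P) \Po W.
    by rewrite comp_polyA -AE eA comp_polyD comp_polyZ comp_polyC -AE.
  have dWR : pdeg (W \Po R) = pdeg W by rewrite pdeg_comp (pdeg_linear sR) muln1.
  have [||Y WY] := right_factor _ (esym e3).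
  - by rewrite -e3 pdeg_comp dWR muln_gt0 A'0.
  - by rewrite dWR.
  have sY : size Y = 2%N.
    by apply: size_linear; apply/eqP; rewrite -(eqn_pmul2r W0) -pdeg_comp -WY dWR mul1n.
  have [k [j [_ YE]]] := affineP sY.
  by exists k, j; rewrite -/R WY YE affine_comp.
have z21 : z ^+ 2 != 1 by have := z2 1%N; rewrite expr1; apply; apply: coprime1n.
have [c Wc] := special_equivariant W0 z21 z0 sW eqW.
(* Seen through [W] the rotation has multiplier [zq], whose square is not 1 because [e > 2] is prime
   to the degree of [W]. *)
pose zq := z ^+ pdeg W.
have zq0 : zq != 0 by rewrite expf_neq0.
have WR : W \Po R = rotation c zq \Po W.
  rewrite (pow_form_rotation z Wc) /rotation comp_polyD comp_polyZ comp_polyB comp_polyX !comp_polyC.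
  by [].
have equiv p' k j : (p' \Po W) \Po R = k *: (p' \Po W) + j%:P -> equivariant p' c zq.
  move=> e3; exists k, j; apply: (comp_poly_inj W0).
  by rewrite -comp_polyA -WR comp_polyA e3 comp_polyD comp_polyZ comp_polyC.
have [||sA'|sB'] := coprime_special_right f'0 g'0 cfg _ _ e'; rewrite ?d1 ?d2 //.
  left; exists A; split=> //; have eqA' : equivariant A' c zq by apply: (equiv _ l b'); rewrite -AE eA.
  have [c' A'c] := special_equivariant A'0 (z2 _ cqe) zq0 sA' eqA'.
  by rewrite AE; apply: pow_form_special (pow_form_comp A'0 A'c Wc).
right; exists B; split=> //; have eqB' : equivariant B' c zq.
  by apply: (equiv _ 1 0); rewrite -BE BR scale1r addr0.
have [c' B'c] := special_equivariant B'0 (z2 _ cqe) zq0 sB' eqB'.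
by rewrite BE; apply: pow_form_special (pow_form_comp B'0 B'c Wc).
Qed.

End Components.

Theorem left_special_exists (F : numClosedFieldType) (V : {poly F}) (s : seq nat) :
  (0 < pdeg V)%N -> (forall d, d \in s -> left_degree V d) ->
  \big[gcdn/0%N]_(d <- s) d = 1%N -> exists2 d, d \in s & left_special V d.
Proof.
move=> V0; apply: gcd_induction.
- exact: left_degree_gcd.
- exact: left_special_coprime.
exact: left_special_triple.
Qed.

Theorem right_special_exists (F : numClosedFieldType) (V : {poly F}) (s : seq nat) :
  (0 < pdeg V)%N -> (forall d, d \in s -> right_degree V d) ->
  \big[gcdn/0%N]_(d <- s) d = 1%N -> exists2 d, d \in s & right_special V d.
Proof.
move=> V0; apply: gcd_induction.
- exact: right_degree_gcd.
- exact: right_special_coprime.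
exact: right_special_triple.
Qed.

(** * Return to the cosine definition and to linear equivalence *)

Local Open Scope complex_scope.

Lemma chebyshev_of_poly (R : realType) n : chebyshev_of n (chebyshev_poly R[i] n).
Proof.
move=> phi; rewrite /chebyshev_poly.
(* The sine identity for the second entry is carried along, as the addition formula for the cosine
   requires it. *)
suff [] : (chebyshev_pair R[i] n).1.[(cos phi)%:C] = (cos (phi *+ n))%:C /\
    (sin phi)%:C * (chebyshev_pair R[i] n).2.[(cos phi)%:C] = (sin (phi *+ n))%:C by [].
elim: n => [|n] /=; first by rewrite hornerC horner0 mulr0n cos0 sin0 mulr0.
case: chebyshev_pair => T U /= [hT hU].
have s2 : (cos phi)%:C ^+ 2 - 1 = - ((sin phi)%:C * (sin phi)%:C) :> R[i].
  have := congr1 (real_complex R) (cos2Dsin2 phi).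
  by rewrite rmorphD !rmorphXn rmorph1 /= => <-; ring.
rewrite mulrS; split.
  rewrite !hornerE hT s2 mulNr -mulrA hU -!rmorphM -rmorphB /= cosD.
  by [].
rewrite !hornerE mulrDr hT mulrCA hU -!rmorphM -rmorphD /= sinD.
by [].
Qed.

Lemma special_linearly_equivalent (R : realType) (u : {poly R[i]}) :
  (0 < pdeg u)%N -> special u ->
  exists V : {poly R[i]}, (is_chebyshev V \/ is_power V) /\ linearly_equivalent u V.
Proof.
move=> u0 [[c [t [k uE]]]|[mu [nu [v [smu snu uE pv]]]]].
  exists ('X^(pdeg u)); split; first by right; exists (pdeg u).
  have k0 : k != 0.
    by apply: contraTneq u0 => k0; rewrite uE k0 scale0r addr0 /pdeg size_polyC; case: (c == 0).
  exists (affine k c), ('X - t%:P); rewrite size_affine // size_XsubC; split=> //.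
  by rewrite affine_comp rmorphXn /= comp_polyX addrC.
have dv : pdeg v = pdeg u by rewrite uE !pdeg_comp (pdeg_linear smu) (pdeg_linear snu) mul1n muln1.
have v0 : (0 < pdeg v)%N by rewrite dv.
have [l l0 vE] := pell_chebyshev v0 pv.
exists (chebyshev_poly R[i] (pdeg v)); split.
  by left; exists (pdeg v) => //; apply: chebyshev_of_poly.
exists (mu \Po affine l 0), nu; split=> //.
  by rewrite size_comp_linear // size_affine.
by rewrite uE [in LHS]vE -comp_polyA affine_comp addr0 comp_polyZ.
Qed.

Unset Implicit Arguments.

Theorem theorem1p1 (R : realType) (r : nat) (hr : (1 <= r)%N)
    (P W : 'I_r -> {poly R[i]})
    (hP : forall i : 'I_r, (1 <= pdeg (P i))%N)
    (hW : forall i : 'I_r, (1 <= pdeg (W i))%N)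
    (hPW : forall i j : 'I_r, P i \Po W i = P j \Po W j)
    (hgcdP : \big[gcdn/0%N]_(i < r) pdeg (P i) = 1%N)
    (hgcdW : \big[gcdn/0%N]_(i < r) pdeg (W i) = 1%N) :
  (exists i : 'I_r, exists V : {poly R[i]},
      (is_chebyshev V \/ is_power V) /\ linearly_equivalent (P i) V)
  /\
  (exists i : 'I_r, exists V : {poly R[i]},
      (is_chebyshev V \/ is_power V) /\ linearly_equivalent (W i) V).
Proof.
pose i0 := Ordinal hr; pose V := P i0 \Po W i0.
have VE i : V = P i \Po W i by apply: hPW.
have V0 : (0 < pdeg V)%N by rewrite pdeg_comp muln_gt0 hP hW.
have lP i : left_component V (pdeg (P i)) (P i) by split=> //; exists (W i).
have rW i : right_component V (pdeg (W i)) (W i) by split=> //; exists (P i).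
split.
  have [||_ /mapP[i _ ->] sd] := left_special_exists V0 (s := [seq pdeg (P i) | i <- index_enum 'I_r]).
  - by move=> _ /mapP[i _ ->]; exists (P i).
  - by rewrite big_map.
  exists i; apply: special_linearly_equivalent; first exact: hP.
  exact: left_special_component sd (lP i).
have [||_ /mapP[i _ ->] sd] := right_special_exists V0 (s := [seq pdeg (W i) | i <- index_enum 'I_r]).
- by move=> _ /mapP[i _ ->]; exists (W i).
- by rewrite big_map.
exists i; apply: special_linearly_equivalent; first exact: hW.
exact: right_special_component sd (rW i).
Qed.
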